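(* Let $\Omega\subset\mathbb{R}^{2d}$ be measurable with $0<|\Omega|<\infty$ and let $p\in[1,\infty)$. The supremum $$L=\sup_{f\in L^2(\mathbb{R}^d)\setminus\{0\}}\frac{\left(\int_{\Omega}|Wf(z)|^p\,dz\right)^{1/p}}{\|f\|_{L^2}^2}$$ is attained, i.e. there exists $f\in L^2(\mathbb{R}^d)\setminus\{0\}$ for which the quotient equals $L$.
   Context: $|\Omega|$ denotes Lebesgue measure. For $f\in L^2(\mathbb{R}^d)$ (complex-valued), the Wigner distribution of $f$ is $$Wf(z)=\int_{\mathbb{R}^d} e^{-2\pi i\,\xi\cdot y} f\Big(x+\frac{y}{2}\Big)\overline{f\Big(x-\frac{y}{2}\Big)}\,dy,\qquad z=(x,\xi)\in\mathbb{R}^d\times\mathbb{R}^d=\mathbb{R}^{2d}.$$ *)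

(* Defs.v *)
From HB Require Import structures.
From mathcomp Require Import all_boot all_order all_algebra.
From mathcomp Require Import all_classical all_reals all_analysis.
From mathcomp Require Import complex.
Set Implicit Arguments.
Unset Strict Implicit.
Unset Printing Implicit Defensive.
Import Order.TTheory GRing.Theory Num.Theory.

Local Open Scope classical_set_scope.
Local Open Scope ring_scope.

(* Row vectors get the sigma-algebra generated by the coordinate maps, as the
   library does for tuples; for T := R this is the Borel sigma-algebra of R^n. *)
Definition measure_rV_display : measure_display -> measure_display.
Proof. exact. Qed.

Section measurable_rV.
Context {d} {T : sigmaRingType d} {n : nat}.

Let coord : 'I_n -> 'rV[T]_n -> T := fun i v => v ord0 i.

Let rV_set0 : g_sigma_preimage coord set0.
Proof. exact: sigma_algebra0. Qed.

Let rV_setC A : g_sigma_preimage coord A -> g_sigma_preimage coord (~` A).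
Proof. exact: sigma_algebraC. Qed.

Let rV_bigcup (F : _^nat) : (forall i, g_sigma_preimage coord (F i)) ->
  g_sigma_preimage coord (\bigcup_i (F i)).
Proof. exact: sigma_algebra_bigcup. Qed.

HB.instance Definition _ := @isMeasurable.Build (measure_rV_display d)
  'rV[T]_n (g_sigma_preimage coord) rV_set0 rV_setC rV_bigcup.

End measurable_rV.

Lemma measurable_rV_coord d (T : sigmaRingType d) n (i : 'I_n) :
  measurable_fun [set: 'rV[T]_n] (fun v : 'rV[T]_n => v ord0 i).
Proof.
move=> _ Y mY; rewrite setTI; apply: sub_sigma_algebra => /=.
rewrite -bigcup_seq/=; exists i => /=; first by rewrite mem_index_enum.
by exists Y => //; rewrite setTI.
Qed.

Lemma measurable_fun_rVP d1 d2 (T1 : measurableType d1) (T2 : measurableType d2)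
    n (f : T1 -> 'rV[T2]_n) :
  measurable_fun [set: T1] f <->
  forall i, measurable_fun [set: T1] (fun x => f x ord0 i).
Proof.
split=> [mf i|mf].
  exact: (measurableT_comp (measurable_rV_coord i) mf).
apply: (@measurability _ _ _ _ setT f
  (\big[setU/set0]_(i < n) preimage_set_system setT
     (fun v : 'rV[T2]_n => v ord0 i) measurable)) => //.
move=> _ [B + <-]; rewrite -bigcup_seq => -[i _ [A mA <-]].
rewrite setTI.
have -> : f @^-1` ([set: 'rV_n] `&` (fun v : 'rV_n => v ord0 i) @^-1` A) =
  setT `&` (fun x => f x ord0 i) @^-1` A by rewrite !setTI.
exact: mf.
Qed.

Section cons_rV.
Context {R : realType} {n : nat}.

Definition cons_rV (p : measurableTypeR R * 'rV[R]_n) : 'rV[R]_n.+1 :=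
  row_mx (const_mx p.1) p.2 : 'rV[R]_(1 + n).

Lemma measurable_cons_rV : measurable_fun setT cons_rV.
Proof.
apply/measurable_fun_rVP => i; rewrite /cons_rV.
case: (@split_ordP 1 n i) => j ->.
  apply: (eq_measurable_fun fst) => //.
  by move=> p _; exact: (esym (etrans (row_mxEl _ _ _ _) (mxE _ _ _ _))).
apply: (eq_measurable_fun (fun p : measurableTypeR R * 'rV[R]_n => p.2 ord0 j)).
  by move=> p _; exact: (esym (row_mxEr _ _ _ _)).
exact: (measurableT_comp (measurable_rV_coord j) measurable_snd).
Qed.

Definition uncons_rV (v : 'rV[R]_n.+1) : measurableTypeR R * 'rV[R]_n :=
  (v ord0 ord0, \row_i v ord0 (lift ord0 i)).

Lemma cons_rVK : cancel cons_rV uncons_rV.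
Proof.
move=> [x v]; rewrite /uncons_rV; congr pair.
  have -> : ord0 = lshift n ord0 :> 'I_(1 + n) by exact: ord_inj.
  exact: etrans (row_mxEl (const_mx x : 'M[R]_1) v _ _) (mxE _ _ _ _).
apply/rowP => i; rewrite mxE.
rewrite (_ : lift ord0 i = rshift 1 i); first exact: row_mxEr.
exact: ord_inj.
Qed.

Lemma measurable_uncons_rV : measurable_fun setT uncons_rV.
Proof.
apply: measurable_fun_pair; first exact: measurable_rV_coord.
apply/measurable_fun_rVP => i.
apply: (eq_measurable_fun (fun v : 'rV[R]_n.+1 => v ord0 (lift ord0 i))).
  by move=> v _; rewrite mxE.
exact: measurable_rV_coord.
Qed.

End cons_rV.

Lemma product_measure_sigma_finite d1 d2 (T1 : measurableType d1)
    (T2 : measurableType d2) (R : realType)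
    (m1 : {sigma_finite_measure set T1 -> \bar R})
    (m2 : {sigma_finite_measure set T2 -> \bar R}) :
  sigma_finite setT (m1 \x m2)%E.
Proof.
have /sigma_finiteP[F [TF ndF Foo]] := sigma_finiteT m1.
have /sigma_finiteP[G [TG ndG Goo]] := sigma_finiteT m2.
exists (fun n => F n `*` G n).
  rewrite -setXTT TF TG predeqE => -[x y]; split.
    move=> [/= [n _ Fnx] [k _ Gky]]; exists (maxn n k) => //; split.
    - by move: x Fnx; exact/subsetPset/ndF/leq_maxl.
    - by move: y Gky; exact/subsetPset/ndG/leq_maxr.
  by move=> [n _ []/= ? ?]; split; exists n.
move=> k; have [? ?] := Foo k; have [? ?] := Goo k.
split; first exact: measurableX.
by rewrite product_measure1E// lte_mul_pinfty// ge0_fin_numE.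
Qed.

Section lebesgue_rV_step.
Context {R : realType} {n : nat}.
Variable mu : {sigma_finite_measure set 'rV[R]_n -> \bar R}.

Definition lebesgue_rV_step : set 'rV[R]_n.+1 -> \bar R :=
  pushforward (lebesgue_measure \x mu)%E cons_rV.

Let step0 : lebesgue_rV_step set0 = 0%E.
Proof. by rewrite /lebesgue_rV_step /pushforward preimage_set0 measure0. Qed.

Let step_ge0 A : (0 <= lebesgue_rV_step A)%E.
Proof. by rewrite /lebesgue_rV_step /pushforward measure_ge0. Qed.

Let measurable_cons_preimage A : measurable A ->
  measurable ((@cons_rV R n) @^-1` A).
Proof. by move=> mA; rewrite -[X in measurable X]setTI; exact: measurable_cons_rV. Qed.

Let step_sigma_additive : semi_sigma_additive lebesgue_rV_step.
Proof.
move=> F mF tF mUF; rewrite /lebesgue_rV_step /pushforward preimage_bigcup.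
apply: measure_semi_sigma_additive.
- by move=> k; exact: measurable_cons_preimage.
- apply/trivIsetP => /= i j _ _ ij; rewrite -preimage_setI.
  by move/trivIsetP : tF => /(_ _ _ _ _ ij) ->//; rewrite preimage_set0.
- by rewrite -preimage_bigcup; exact: measurable_cons_preimage.
Qed.

HB.instance Definition _ := isMeasure.Build _ _ _ lebesgue_rV_step
  step0 step_ge0 step_sigma_additive.

Let step_sigma_finite : sigma_finite setT lebesgue_rV_step.
Proof.
have [F TF mF] := product_measure_sigma_finite lebesgue_measure mu.
exists (fun k => uncons_rV @^-1` F k).
  by rewrite -preimage_bigcup -TF preimage_setT.
move=> k; have [mFk Fkoo] := mF k; split.
  by rewrite -[X in measurable X]setTI; exact: measurable_uncons_rV.
rewrite /lebesgue_rV_step /pushforward -comp_preimage.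
by rewrite (_ : uncons_rV \o cons_rV = id) //; apply/funext/cons_rVK.
Qed.

HB.instance Definition _ := Measure_isSigmaFinite.Build _ _ _ lebesgue_rV_step
  step_sigma_finite.

End lebesgue_rV_step.

(* Lebesgue measure on the Borel sets of R^n, the n-fold product of the
   one-dimensional one; R^0 is a single point of mass 1. *)
Fixpoint lebesgue_rV (R : realType) (n : nat) :
    {sigma_finite_measure set 'rV[R]_n -> \bar R} :=
  match n with
  | 0 => \d_(0 : 'rV[R]_0)
  | n.+1 => lebesgue_rV_step (lebesgue_rV R n)
  end.

Lemma measurable_rV_box (R : realType) n (A : 'I_n -> set R) :
  (forall i, measurable (A i)) ->
  measurable [set v : 'rV[R]_n | forall i, A i (v ord0 i)].
Proof.
move=> mA.
have -> : [set v : 'rV[R]_n | forall i, A i (v ord0 i)] =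
    \big[setI/setT]_(i < n) ((fun v : 'rV[R]_n => v ord0 i) @^-1` A i).
  apply/seteqP; split=> [v Av|v].
    by rewrite -bigcap_seq => i _; exact: Av.
  by rewrite -bigcap_seq => Av i; exact: (Av i (mem_index_enum i)).
apply: bigsetI_measurable => i _; rewrite -[X in measurable X]setTI.
exact: measurable_rV_coord.
Qed.

Lemma lebesgue_rV_box (R : realType) n (A : 'I_n -> set R) :
  (forall i, measurable (A i)) ->
  lebesgue_rV R n [set v | forall i, A i (v ord0 i)] =
  (\prod_(i < n) lebesgue_measure (A i))%E.
Proof.
elim: n A => [|n IHn] A mA.
  rewrite big_ord0 /= diracE mem_set//=.
  by case.
rewrite big_ord_recl -IHn// /= /lebesgue_rV_step /pushforward.
rewrite -product_measure1E; last 2 first.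
- exact: mA.
- by apply: (@measurable_rV_box R n (fun i => A (lift ord0 i))).
congr product_measure1; apply/seteqP; split=> -[x v] /=.
  have := cons_rVK (x, v); rewrite /uncons_rV => -[x0 v0] Av.
  split=> [|i]; first by rewrite -x0; exact: Av.
  by rewrite -v0 mxE; exact: Av.
have := cons_rVK (x, v); rewrite /uncons_rV => -[x0 v0] [Ax Av] i.
have [->|[j ->]] : i = ord0 \/ exists j, i = lift ord0 j.
  by case: (unliftP ord0 i) => [j ->|->]; [right; exists j|left].
  by rewrite x0.
have <- : v ord0 j = cons_rV (x, v) ord0 (lift ord0 j).
  by rewrite -[in LHS]v0 mxE.
exact: Av.
Qed.

(* Lebesgue measure on the sigma-algebra of Lebesgue measurable subsets of R^n,
   i.e., the completion of lebesgue_rV. *)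
Definition completed_lebesgue_rV {R : realType} {n : nat} :
    set (caratheodory_type (lebesgue_rV R n)^*%mu) -> \bar R :=
  completed_measure_extension (mu := lebesgue_rV R n).

HB.instance Definition _ (R : realType) n :=
  Measure.on (@completed_lebesgue_rV R n).

(* The same two measures on R^(2d) = R^d x R^d. *)
Definition lebesgue_phase {R : realType} {d : nat} :
    set ('rV[R]_d * 'rV[R]_d) -> \bar R :=
  (lebesgue_rV R d \x lebesgue_rV R d)%E.

HB.instance Definition _ (R : realType) d :=
  Measure.on (@lebesgue_phase R d).

HB.instance Definition _ (R : realType) d :=
  Measure_isSigmaFinite.Build _ _ _ (@lebesgue_phase R d)
    (product_measure_sigma_finite (lebesgue_rV R d) (lebesgue_rV R d)).

Definition completed_lebesgue_phase {R : realType} {d : nat} :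
    set (caratheodory_type (@lebesgue_phase R d)^*%mu) -> \bar R :=
  completed_measure_extension (mu := @lebesgue_phase R d).

HB.instance Definition _ (R : realType) d :=
  Measure.on (@completed_lebesgue_phase R d).

Section wigner.
Context {R : realType} {d : nat}.
Implicit Types (f : 'rV[R]_d -> R[i]) (z : 'rV[R]_d * 'rV[R]_d).

Local Notation mu := (@completed_lebesgue_rV R d).
Local Notation lebesgueType := (caratheodory_type (lebesgue_rV R d)^*%mu).
Local Notation Re := complex.Re.
Local Notation Im := complex.Im.
Local Notation normc := ComplexField.Normc.normc.

Definition expi (t : R) : R[i] := (cos t +i* sin t)%C.

Definition dotv (x y : 'rV[R]_d) : R := \sum_(i < d) x ord0 i * y ord0 i.

(* Integral of a complex-valued function; it is meaningful when the real and
   imaginary parts are integrable, as is the case in the definition of wigner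
   for f in L^2, by the Cauchy-Schwarz inequality. *)
Definition cintegral (g : 'rV[R]_d -> R[i]) : R[i] :=
  ((\int[mu]_y Re (g y)) +i* (\int[mu]_y Im (g y)))%C.

Definition wigner f z : R[i] :=
  let: (x, xi) := z in
  cintegral (fun y => expi (- (2 * pi * dotv xi y)) *
    f (x + 2^-1 *: y) * conjc (f (x - 2^-1 *: y))).

Definition L2norm f : \bar R :=
  ('N[mu]_2%:E[(fun x => (normc (f x))%:E)])%E.

Definition L2 : set ('rV[R]_d -> R[i]) := [set f |
  [/\ measurable_fun [set: lebesgueType] (fun x => Re (f x)),
      measurable_fun [set: lebesgueType] (fun x => Im (f x)) &
      (L2norm f < +oo)%E]].

(* Functions that represent the zero element of L^2(R^d). *)
Definition ae_zero : set ('rV[R]_d -> R[i]) := [set f |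
  {ae mu, forall x, f x = 0}].

Definition wigner_quotient (Omega : set ('rV[R]_d * 'rV[R]_d)) (p : R) f :
    \bar R :=
  ((\int[@completed_lebesgue_phase R d]_(z in Omega)
      ((normc (wigner f z)) `^ p)%:E) `^ p^-1 / L2norm f ^+ 2)%E.

End wigner.

(* Main.v *)
Require Import Defs.
From HB Require Import structures.
From mathcomp Require Import all_boot all_order all_algebra.
From mathcomp Require Import all_classical all_reals all_analysis.
From mathcomp Require Import measurable_realfun complex ring lra.
Set Implicit Arguments.
Unset Strict Implicit.
Unset Printing Implicit Defensive.
Import Order.TTheory GRing.Theory Num.Theory.
Import numFieldNormedType.Exports.

(** The quadratic form of point reflections.  On L^2(R^d), viewed as a real
    Hilbert space with the real part ip of the hermitian product, let D_z be the
    unitary time-frequency shift by z (tfshift) and refl z the point reflection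
    of phase space at z.  A change of variables gives
    Wf(z) = 2^d ip (refl z f) f (wigner_wform), so the problem is to maximize
    N(Wf) / ||f||^2, where N is the L^p norm over Omega.  The difficulty is that
    mass escaping to infinity in phase space need not disappear from Omega:
    two profiles escaping in opposite directions keep interacting there.

    Take unit vectors f_n whose quotients tend to the supremum L > 0, and weak
    limits along an ultrafilter.  Uniformly bounded functions on phase space that
    tend to 0 locally uniformly tend to 0 for N, since Omega has finite measure
    (normOm_locally_null).  If f_n has a weak limit f, then the interaction of f
    with f_n - f is such a function, and f_n - f contributes at most
    L ||f_n - f||^2; comparing masses, L ||f||^2 <= N(Wf), so that f is a
    maximizer unless f = 0 (weak_limit_maximizes).

    Suppose f = 0.  If all the coefficients of f_n against the shifts of a fixed
    window were small, two applications of the Plancherel identity would make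
    Wf_n small in L^2 on bounded sets, hence small for N (vanishing_estimate).
    So some coefficients at points z_n stay large, and z_n tends to infinity
    (escaping_profile).  As refl w D_z is, up to a phase, D_{-z} refl w
    (refl_tfshift), the form sees the opposite shifts together: let g and h be
    the weak limits of D_{-z_n} f_n and D_{z_n} f_n, with g nonzero.  In the
    expansion of the form at f_n = D_{z_n} g + D_{-z_n} h + r_n every term
    vanishes in the limit except that of r_n and the interaction of the two
    profiles, which is 2 Re (e^{i s_n(w)} u(w)) for a fixed function u and a
    linear phase s_n, faster and faster as n grows.  Comparing masses as before,
    L (||g||^2 + ||h||^2) is at most, in the limit, the norm of this interaction
    (interaction_lower).

    A tiny translation of phase space changes s_n by any prescribed constant and
    hardly moves u, so that the norm does not depend on an additional constant
    phase in the limit.  Averaging its p-th power over all constant phases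
    removes s_n altogether, and therefore some constant phase t does at least as
    well as s_n (phase_averaging).  Now four times Re (e^{it} u) is the difference of
    the forms at g + k and at g - k, for k the vector h rotated by -t, whose
    masses add up to 2 (||g||^2 + ||h||^2) by the parallelogram identity.  Hence
    each of these two vectors that is nonzero is a maximizer
    (aligned_profiles_maximize).

    The argument takes place over a Borel set Omega and Borel functions; every
    set and function measurable for the completion agrees with a Borel one away
    from a null set (caratheodory_approx, caratheodory_fun). *)

Local Open Scope classical_set_scope.
Local Open Scope ring_scope.

Local Notation Re := complex.Re.
Local Notation Im := complex.Im.
Local Notation normc := ComplexField.Normc.normc.

(** * Complex-valued functions and their integrals *)

Section complex_facts.
Context {R : realType}.
Implicit Types (a b c : R[i]) (t : R).

Lemma eqcP a b : Re a = Re b -> Im a = Im b -> a = b.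
Proof. by case: a b => [a1 a2] [b1 b2] /= -> ->. Qed.

Definition sqn a : R := Re a ^+ 2 + Im a ^+ 2.

Lemma sqn_ge0 a : 0 <= sqn a.
Proof. by rewrite addr_ge0 ?sqr_ge0. Qed.

Lemma normc_sqrt a : normc a = Num.sqrt (sqn a).
Proof. by case: a. Qed.

Lemma normc_ge0 a : 0 <= normc a.
Proof. by rewrite normc_sqrt sqrtr_ge0. Qed.

Lemma sqnE a : sqn a = normc a ^+ 2.
Proof. by rewrite normc_sqrt sqr_sqrtr// sqn_ge0. Qed.

Lemma sqnM a b : sqn (a * b) = sqn a * sqn b.
Proof. by case: a b => [a1 a2] [b1 b2]; rewrite /sqn /=; ring. Qed.

Lemma sqnN a : sqn (- a) = sqn a.
Proof. by case: a => [a1 a2]; rewrite /sqn /=; ring. Qed.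

Lemma sqn_conj a : sqn (conjc a) = sqn a.
Proof. by case: a => [a1 a2]; rewrite /sqn /=; ring. Qed.

Lemma sqn0 : sqn 0 = 0.
Proof. by rewrite /sqn /= expr0n addr0. Qed.

Lemma sqn_eq0 a : sqn a = 0 -> a = 0.
Proof.
case: a => [x y]; rewrite /sqn /= => /eqP.
by rewrite paddr_eq0 ?sqr_ge0// !sqrf_eq0 => /andP[/eqP -> /eqP ->].
Qed.

Lemma sqnD a b : sqn (a + b) <= 2 * (sqn a + sqn b).
Proof.
case: a b => [a1 a2] [b1 b2]; rewrite /sqn /=.
have := sqr_ge0 (a1 - b1); have := sqr_ge0 (a2 - b2); nra.
Qed.

Lemma conjc_div_normc a : normc a != 0 ->
  conjc a * ((normc a)^-1)%:C%C * a = (normc a)%:C%C.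
Proof.
case: a => x y; rewrite normc_sqrt; set s := Num.sqrt _ => s0.
have ss : x ^+ 2 + y ^+ 2 = s ^+ 2 by rewrite sqr_sqrtr// sqn_ge0.
apply: eqcP => /=; last by ring.
by transitivity ((x ^+ 2 + y ^+ 2) / s); [ring|rewrite ss expr2 mulfK].
Qed.

Lemma normcM a b : normc (a * b) = normc a * normc b.
Proof. exact: ComplexField.Normc.normcM. Qed.

Lemma normc_conj a : normc (conjc a) = normc a.
Proof. by rewrite !normc_sqrt sqn_conj. Qed.

Lemma cReM a b : Re (a * b) = Re a * Re b - Im a * Im b.
Proof. by case: a b => [a1 a2] [b1 b2]. Qed.

Lemma cImM a b : Im (a * b) = Re a * Im b + Im a * Re b.
Proof. by case: a b => [a1 a2] [b1 b2]. Qed.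

Lemma cReD a b : Re (a + b) = Re a + Re b.
Proof. by case: a b => [a1 a2] [b1 b2]. Qed.

Lemma cImD a b : Im (a + b) = Im a + Im b.
Proof. by case: a b => [a1 a2] [b1 b2]. Qed.

Lemma cReN a : Re (- a) = - Re a.
Proof. by case: a. Qed.

Lemma cImN a : Im (- a) = - Im a.
Proof. by case: a. Qed.

Lemma cReJ a : Re (conjc a) = Re a.
Proof. by case: a. Qed.

Lemma cImJ a : Im (conjc a) = - Im a.
Proof. by case: a. Qed.

Lemma le_Re_normc a : `|Re a| <= normc a.
Proof. by rewrite normc_sqrt -sqrtr_sqr ler_wsqrtr// lerDl sqr_ge0. Qed.

Lemma le_Im_normc a : `|Im a| <= normc a.
Proof. by rewrite normc_sqrt -sqrtr_sqr ler_wsqrtr// lerDr sqr_ge0. Qed.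

Lemma normc_le a : normc a <= `|Re a| + `|Im a|.
Proof.
rewrite normc_sqrt -(ger0_norm (addr_ge0 (normr_ge0 (Re a)) (normr_ge0 (Im a)))).
rewrite -sqrtr_sqr ler_wsqrtr// sqrrD !real_normK ?num_real// /sqn.
by rewrite lerD2r lerDl mulrn_wge0// mulr_ge0.
Qed.

Lemma expi0 : expi 0 = 1 :> R[i].
Proof. by rewrite /expi cos0 sin0. Qed.

Lemma expiD s t : expi (s + t) = expi s * expi t.
Proof. by apply: eqcP; rewrite /= ?cosD// sinD; ring. Qed.

Lemma sqn_expi t : sqn (expi t) = 1.
Proof. by rewrite /sqn /= cos2Dsin2. Qed.

Lemma normc_expi t : normc (expi t) = 1.
Proof. by rewrite normc_sqrt sqn_expi sqrtr1. Qed.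

Lemma conj_expi t : conjc (expi t) = expi (- t).
Proof. by rewrite /expi cosN sinN. Qed.

End complex_facts.

Section cmeas.
Context {d} {T : measurableType d} {R : realType}.
Implicit Types f g : T -> R[i].

Definition cmeas f := measurable_fun setT (fun x => Re (f x)) /\
  measurable_fun setT (fun x => Im (f x)).

Lemma cmeas_cst c : cmeas (fun=> c).
Proof. by split; exact: measurable_cst. Qed.

Lemma cmeasD f g : cmeas f -> cmeas g -> cmeas (fun x => f x + g x).
Proof.
move=> [f1 f2] [g1 g2]; split.
  by under eq_fun do rewrite cReD; exact: measurable_funD.
by under eq_fun do rewrite cImD; exact: measurable_funD.
Qed.

Lemma cmeasM f g : cmeas f -> cmeas g -> cmeas (fun x => f x * g x).
Proof.
move=> [f1 f2] [g1 g2]; split.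
  under eq_fun do rewrite cReM.
  by apply: measurable_funB; exact: measurable_funM.
under eq_fun do rewrite cImM.
by apply: measurable_funD; exact: measurable_funM.
Qed.

Lemma cmeasJ f : cmeas f -> cmeas (fun x => conjc (f x)).
Proof.
move=> [f1 f2]; split; first by under eq_fun do rewrite cReJ.
by under eq_fun do rewrite cImJ; exact: measurableT_comp.
Qed.

Lemma cmeas_expi (h : T -> R) : measurable_fun setT h ->
  cmeas (fun x => expi (h x)).
Proof.
move=> mh; split; apply: measurableT_comp => //;
  apply: continuous_measurable_fun.
- exact: continuous_cos.
- exact: continuous_sin.
Qed.

Lemma measurable_sqn f : cmeas f -> measurable_fun setT (fun x => sqn (f x)).
Proof.
by move=> [f1 f2]; apply: measurable_funD; exact: measurable_funX.
Qed.

Lemma measurable_normc f : cmeas f -> measurable_fun setT (fun x => normc (f x)).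
Proof.
move=> mf; under eq_fun do rewrite normc_sqrt.
apply: measurableT_comp; last exact: measurable_sqn.
apply: continuous_measurable_fun; exact: sqrt_continuous.
Qed.

End cmeas.

Lemma cmeas_comp d1 d2 (T1 : measurableType d1) (T2 : measurableType d2)
    (R : realType) (f : T2 -> R[i]) (h : T1 -> T2) :
  cmeas f -> measurable_fun setT h -> cmeas (fun x => f (h x)).
Proof. by move=> [f1 f2] mh; split; [exact: (measurableT_comp f1 mh)|exact: (measurableT_comp f2 mh)]. Qed.

Section cint.
Context {d} {T : measurableType d} {R : realType}.
Variable mu : {measure set T -> \bar R}.
Implicit Types f g : T -> R[i].

Definition cint f : R[i] := ((\int[mu]_x Re (f x)) +i* (\int[mu]_x Im (f x)))%C.

Definition cintegrable f := mu.-integrable setT (fun x => (Re (f x))%:E) /\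
  mu.-integrable setT (fun x => (Im (f x))%:E).

Lemma cintegrableP f : cmeas f ->
  cintegrable f <-> (\int[mu]_x (normc (f x))%:E < +oo)%E.
Proof.
move=> mf; split=> [[/integrableP[_ f1] /integrableP[_ f2]]|foo].
  apply: (@le_lt_trans _ _ (\int[mu]_x (`|(Re (f x))%:E| + `|(Im (f x))%:E|))%E).
    apply: ge0_le_integral => //.
    - by move=> x _; rewrite lee_fin normc_ge0.
    - exact/measurable_EFinP/measurable_normc.
    - by apply: emeasurable_funD; apply: measurableT_comp => //;
        apply/measurable_EFinP; case: mf.
    - by move=> x _; rewrite lee_fin normc_le.
  rewrite ge0_integralD//; first by rewrite lte_add_pinfty.
  - by apply: measurableT_comp => //; apply/measurable_EFinP; case: mf.
  - by apply: measurableT_comp => //; apply/measurable_EFinP; case: mf.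
have mn : measurable_fun setT (fun x => (normc (f x))%:E).
  exact/measurable_EFinP/measurable_normc.
have ni : mu.-integrable setT (fun x => (normc (f x))%:E).
  apply/integrableP; split=> //.
  by under eq_integral do rewrite gee0_abs ?lee_fin ?normc_ge0//.
split; apply: (le_integrable _ _ _ ni) => //.
- by apply/measurable_EFinP; case: mf.
- by move=> x _; rewrite !abse_EFin lee_fin (ger0_norm (normc_ge0 _)) le_Re_normc.
- by apply/measurable_EFinP; case: mf.
- by move=> x _; rewrite !abse_EFin lee_fin (ger0_norm (normc_ge0 _)) le_Im_normc.
Qed.

Lemma cintegrable_cmeas f : cintegrable f -> cmeas f.
Proof.
by move=> [/integrableP[/measurable_EFinP ? _] /integrableP[/measurable_EFinP ? _]].
Qed.

Lemma cintegrable_normc f : cintegrable f ->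
  mu.-integrable setT (fun x => (normc (f x))%:E).
Proof.
move=> fi; have mf := cintegrable_cmeas fi; apply/integrableP; split.
  exact/measurable_EFinP/measurable_normc.
under eq_integral do rewrite gee0_abs ?lee_fin ?normc_ge0//.
exact/cintegrableP.
Qed.

Lemma le_cintegrable f (h : T -> R) : cmeas f ->
  mu.-integrable setT (fun x => (h x)%:E) -> (forall x, normc (f x) <= h x) ->
  cintegrable f.
Proof.
move=> mf hi fh; apply/cintegrableP => //.
apply: le_lt_trans (integrable_lty _ hi) => //; apply: ge0_le_integral => //.
- by move=> x _; rewrite lee_fin normc_ge0.
- exact/measurable_EFinP/measurable_normc.
- by case/integrableP : hi.
- by move=> x _; rewrite lee_fin fh.
Qed.

Lemma eq_cint f g : f =1 g -> cint f = cint g.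
Proof. by move=> /funext ->. Qed.

Lemma cintegrableZ c f : cintegrable f -> cintegrable (fun x => c * f x).
Proof.
move=> [f1 f2]; split.
  under eq_fun do rewrite cReM EFinB !EFinM.
  by apply: integrableB => //; exact: integrableZl.
under eq_fun do rewrite cImM EFinD !EFinM.
by apply: integrableD => //; exact: integrableZl.
Qed.

Lemma cintZ c f : cintegrable f -> cint (fun x => c * f x) = c * cint f.
Proof.
move=> [f1 f2].
have RZ (a : R) (h : T -> R) : mu.-integrable setT (fun x => (h x)%:E) ->
    mu.-integrable setT (fun x => (a * h x)%:E).
  by move=> ?; under eq_fun do rewrite EFinM; exact: integrableZl.
apply: eqcP; rewrite /= ?cReM ?cImM /=.
  rewrite -!RintegralZl// -RintegralB//=; [|exact: RZ|exact: RZ].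
  by apply: eq_Rintegral => x _; rewrite cReM.
rewrite -!RintegralZl// -RintegralD//=; [|exact: RZ|exact: RZ].
by apply: eq_Rintegral => x _; rewrite cImM.
Qed.

Lemma cintegrableJ f : cintegrable f -> cintegrable (fun x => conjc (f x)).
Proof.
move=> [f1 f2]; split; first by under eq_fun do rewrite cReJ.
by under eq_fun do rewrite cImJ EFinN; exact: integrableN.
Qed.

Lemma cintJ f : cintegrable f -> cint (fun x => conjc (f x)) = conjc (cint f).
Proof.
move=> [f1 f2]; apply: eqcP; rewrite /= ?cReJ ?cImJ /=.
  by apply: eq_Rintegral => x _; rewrite cReJ.
rewrite -mulN1r -RintegralZl//.
by apply: eq_Rintegral => x _; rewrite cImJ mulN1r.
Qed.

(** Rotating the integrand so that its integral becomes a nonnegative real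
    reduces the triangle inequality to the monotonicity of real integrals. *)
Lemma normc_cint_le f : cintegrable f ->
  normc (cint f) <= \int[mu]_x normc (f x).
Proof.
move=> fi; set c := cint f.
have [c0|cN0] := eqVneq (normc c) 0.
  by rewrite c0; apply: Rintegral_ge0 => x _; exact: normc_ge0.
pose u := conjc c * ((normc c)^-1)%:C%C.
have uc : u * c = (normc c)%:C%C.
  exact: conjc_div_normc.
have nu : normc u = 1.
  rewrite /u normcM normc_conj.
  suff -> : normc ((normc c)^-1)%:C%C = (normc c)^-1 by rewrite divff.
  by rewrite normc_sqrt /sqn /= expr0n addr0 sqrtr_sqr ger0_norm// invr_ge0 normc_ge0.
have -> : normc c = Re (cint (fun x => u * f x)) by rewrite cintZ// uc.
rewrite /=; apply: le_Rintegral => //.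
- by case: (cintegrableZ u fi).
- exact: cintegrable_normc.
- move=> x _; apply: le_trans (ler_norm _) _; apply: le_trans (le_Re_normc _) _.
  by rewrite normcM nu mul1r.
Qed.

End cint.

Section cint_pushforward.
Context {d1 d2} {T1 : measurableType d1} {T2 : measurableType d2} {R : realType}.

Lemma cint_comp (mu : {measure set T1 -> \bar R}) (nu : {measure set T2 -> \bar R})
    (h : T1 -> T2) (k : R) (mh : measurable_fun setT h) (k0 : 0 <= k) (f : T2 -> R[i]) :
  (forall A, measurable A -> mu (h @^-1` A) = (k%:E * nu A)%E) ->
  cintegrable nu f ->
  cintegrable mu (fun x => f (h x)) /\ cint mu (fun x => f (h x)) = k%:C%C * cint nu f.
Proof.
move=> hE fi.
have key (u : T2 -> R) : nu.-integrable setT (fun x => (u x)%:E) ->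
    mu.-integrable setT (fun x => (u (h x))%:E) /\
    \int[mu]_x u (h x) = k * \int[nu]_x u x.
  move=> ui; have mu_ := measurable_int _ ui.
  have ge0E (v : T2 -> \bar R) : measurable_fun setT v -> (forall x, 0 <= v x)%E ->
      (\int[mu]_x v (h x) = k%:E * \int[nu]_x v x)%E.
    move=> mv v0.
    rewrite -(ge0_integral_mscale _ _ (NngNum k0))//.
    rewrite [LHS](_ : _ = \int[pushforward mu h]_x v x)%E; last first.
      by rewrite ge0_integral_pushforward// => y _; exact: v0.
    by apply: eq_measure_integral => A mA _ /=; rewrite /pushforward hE.
  have ui' : mu.-integrable setT (fun x => (u (h x))%:E).
    apply/integrableP; split; first exact: measurableT_comp mu_ mh.
    rewrite (ge0E (fun x => `|(u x)%:E|)%E)//; last exact: measurableT_comp.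
    by rewrite lte_mul_pinfty//; case/integrableP : ui.
  split=> //; rewrite /Rintegral.
  have -> : (\int[mu]_x (u (h x))%:E = k%:E * \int[nu]_x (u x)%:E)%E.
    rewrite [RHS]muleC [in RHS]integralE [LHS]integralE.
    rewrite muleBl//; last by rewrite fin_num_adde_defr//; exact: integrable_pos_fin_num.
    congr (_ - _)%E; rewrite muleC.
      rewrite -[in LHS]/((fun x => (u x)%:E) \o h)%E funepos_comp.
      by apply: ge0E => //; exact: measurable_funepos.
    rewrite -[in LHS]/((fun x => (u x)%:E) \o h)%E funeneg_comp.
    by apply: ge0E => //; exact: measurable_funeneg.
  by rewrite fineM//; exact: integrable_fin_num.
have [f1 f2] := fi; have [g1 e1] := key _ f1; have [g2 e2] := key _ f2.
by split=> //; apply: eqcP; rewrite /= ?cReM ?cImM /= ?e1 ?e2; ring.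
Qed.

End cint_pushforward.

Section cint_fubini.
Context {d1 d2} {T1 : measurableType d1} {T2 : measurableType d2} {R : realType}.
Variables (m1 : {sigma_finite_measure set T1 -> \bar R})
          (m2 : {sigma_finite_measure set T2 -> \bar R}).

Lemma cmeas_cint (F : T1 * T2 -> R[i]) : cmeas F ->
  cmeas (fun x => cint m2 (fun y => F (x, y))).
Proof.
have key (u : T1 * T2 -> R) : measurable_fun setT u ->
    measurable_fun setT (fun x => \int[m2]_y u (x, y)).
  move=> mu; apply: measurableT_comp.
    exact: fine_measurable.
  under eq_fun do rewrite integralE.
  apply: emeasurable_funB.
    rewrite (_ : (fun x => _) = fubini_F m2 (EFin \o u)^\+%E); last first.
      by apply/funext => x; apply: eq_integral => y _; rewrite !funeposE.
    apply: measurable_fun_fubini_tonelli_F => //.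
    exact/measurable_funepos/measurable_EFinP.
  rewrite (_ : (fun x => _) = fubini_F m2 (EFin \o u)^\-%E); last first.
    by apply/funext => x; apply: eq_integral => y _; rewrite !funenegE.
  apply: measurable_fun_fubini_tonelli_F => //.
  exact/measurable_funeneg/measurable_EFinP.
by move=> [F1 F2]; split; [exact: (key _ F1)|exact: (key _ F2)].
Qed.

Lemma cint_fubini (F : T1 * T2 -> R[i]) : cmeas F ->
  (\int[m1]_x \int[m2]_y (normc (F (x, y)))%:E < +oo)%E ->
  cint m1 (fun x => cint m2 (fun y => F (x, y))) =
  cint m2 (fun y => cint m1 (fun x => F (x, y))).
Proof.
move=> mF Foo.
have key (u : T1 * T2 -> R) : measurable_fun setT u ->
    (forall z, `|u z| <= normc (F z)) ->
    \int[m1]_x (\int[m2]_y u (x, y)) = \int[m2]_y (\int[m1]_x u (x, y)).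
  move=> mu uF.
  have ui : (m1 \x m2)%E.-integrable setT (fun z => (u z)%:E).
    apply/integrable12ltyP; first exact/measurable_EFinP.
    apply: le_lt_trans Foo; apply: ge0_le_integral => //=.
    - by move=> x _; exact: integral_ge0.
    - apply: (@measurable_fun_fubini_tonelli_F _ _ T1 T2 R m2 (fun z => `|(u z)%:E|)%E) => //.
      by apply: measurableT_comp => //; exact/measurable_EFinP.
    - apply: (@measurable_fun_fubini_tonelli_F _ _ T1 T2 R m2 (fun z => (normc (F z))%:E)) => //.
        exact/measurable_EFinP/measurable_normc.
      by move=> z; rewrite lee_fin normc_ge0.
    - move=> x _; apply: ge0_le_integral => //=.
      + by apply/measurable_EFinP/measurableT_comp => //; exact: measurableT_comp.
      + by apply/measurable_EFinP; exact: measurableT_comp (measurable_normc mF) _.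
      + by move=> y _; rewrite lee_fin.
  rewrite /Rintegral.
  have E1 : (\int[m1]_x (fine (\int[m2]_y (u (x, y))%:E))%:E =
     \int[m1]_x \int[m2]_y (u (x, y))%:E)%E.
    apply: ae_eq_integral => //.
    - apply/measurable_EFinP; apply: measurableT_comp; first exact: fine_measurable.
      exact: (measurable_fubini_F ui).
    - exact: (measurable_fubini_F ui).
    - apply: filterS (ae_integrable1 ui) => x xi _.
      by rewrite fineK//; exact: integrable_fin_num.
  have E2 : (\int[m2]_y (fine (\int[m1]_x (u (x, y))%:E))%:E =
     \int[m2]_y \int[m1]_x (u (x, y))%:E)%E.
    apply: ae_eq_integral => //.
    - apply/measurable_EFinP; apply: measurableT_comp; first exact: fine_measurable.
      exact: (measurable_fubini_G ui).
    - exact: (measurable_fubini_G ui).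
    - apply: filterS (ae_integrable2 ui) => x xi _.
      by rewrite fineK//; exact: integrable_fin_num.
  by rewrite E1 E2 (Fubini ui).
apply: eqcP => /=.
  by apply: (key (fun z => Re (F z))) => [|z]; [case: mF|exact: le_Re_normc].
by apply: (key (fun z => Im (F z))) => [|z]; [case: mF|exact: le_Im_normc].
Qed.

End cint_fubini.


(** * Square-integrable functions *)

Section real_complete.
Context {d} {T : measurableType d} {R : realType}.
Variable mu : {measure set T -> \bar R}.

(** Along a fast subsequence the increments h_k satisfy
    int sum_k 4^k h_k^2 < oo, so that almost everywhere |h_k| = O(2^-k) and the
    subsequence converges; Fatou's lemma then bounds the distance to the
    limit. *)
Lemma L2_real_complete (g : nat -> T -> R) :
  (forall n, measurable_fun setT (g n)) ->
  (forall e : R, 0 < e -> exists N, forall m n, (N <= m)%N -> (N <= n)%N ->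
    (\int[mu]_x ((g m x - g n x) ^+ 2)%:E <= e%:E)%E) ->
  exists2 G : T -> R, measurable_fun setT G &
    forall e : R, 0 < e -> exists N, forall n, (N <= n)%N ->
      (\int[mu]_x ((G x - g n x) ^+ 2)%:E <= e%:E)%E.
Proof.
move=> mg cg.
pose eps k : R := (1 / (2 ^ k.+1)%:R) / 4 ^+ k.
have eps0 k : 0 < eps k by rewrite !divr_gt0 ?exprn_gt0// ltr0n expn_gt0.
have /choice[N HN] : forall k, exists N, forall m n, (N <= m)%N -> (N <= n)%N ->
    (\int[mu]_x ((g m x - g n x) ^+ 2)%:E <= (eps k)%:E)%E.
  by move=> k; exact: cg.
pose phi k := maxn k (\max_(i < k.+1) N i)%N.
have phiN k : (N k <= phi k)%N.
  by rewrite leq_max (leq_bigmax (F := fun i : 'I_k.+1 => N i) ord_max) orbT.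
have phi_mono j k : (j <= k)%N -> (phi j <= phi k)%N.
  move=> jk; rewrite /phi geq_max !leq_max jk/=; apply/orP; right.
  apply/bigmax_leqP => i _.
  by apply: (leq_bigmax (F := fun i : 'I_k.+1 => N i) (widen_ord (jk : (j.+1 <= k.+1)%N) i)).
pose h k x := g (phi k.+1) x - g (phi k) x.
have mh k : measurable_fun setT (fun x => (h k x) ^+ 2).
  by apply: measurable_funX; exact: measurable_funB.
pose S x : \bar R := (\sum_(k <oo) (4 ^+ k * h k x ^+ 2)%:E)%E.
have t0 k x : (0 <= (4 ^+ k * h k x ^+ 2)%:E)%E.
  by rewrite lee_fin mulr_ge0 ?sqr_ge0 ?exprn_ge0 ?ler0n.
have mt k : measurable_fun setT (fun x => (4 ^+ k * h k x ^+ 2)%:E).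
  by apply/measurable_EFinP; exact: measurable_funM.
have mS : measurable_fun setT S.
  by apply: ge0_emeasurable_sum => // *; exact: t0.
have S0 x : (0 <= S x)%E by exact: nneseries_ge0.
have iS : (\int[mu]_x S x <= 1)%E.
  rewrite integral_nneseries//.
  apply: (le_trans _ (epsilon_trick0 xpredT ler01)).
  apply: lee_nneseries => k *; first by apply: integral_ge0 => x _; exact: t0.
  under eq_integral do rewrite EFinM.
  rewrite ge0_integralZl ?lee_fin ?exprn_ge0//; last 2 first.
  - exact/measurable_EFinP.
  - by move=> x _; rewrite lee_fin sqr_ge0.
  have := HN k _ _ (leq_trans (phiN k) (phi_mono _ _ (leqnSn k))) (phiN k).
  move=> /(lee_wpmul2l (x := (4 ^+ k : R)%:E)) => /(_ _)/le_trans; apply.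
    by rewrite lee_fin exprn_ge0.
  by rewrite -EFinM lee_fin /eps mulrC divfK// expf_neq0.
have cS x : S x \is a fin_num -> cvgn (fun k => g (phi k) x).
  move=> Sx; pose M : R := Num.sqrt (fine (S x)).
  have hM k : `|h k x| <= M * (2^-1) ^+ k.
    have : ((4 ^+ k * h k x ^+ 2)%:E <= (fine (S x))%:E)%E.
      rewrite fineK//; apply: le_trans (nneseries_lim_ge (k.+1) _) => [|n _ _].
        rewrite big_nat_recr//= leeDr// sume_ge0// => n _; exact: t0.
      exact: t0.
    rewrite lee_fin => hk; rewrite exprVn ler_pdivlMr ?exprn_gt0//.
    rewrite -[leLHS]ger0_norm ?mulr_ge0 ?exprn_ge0// -sqrtr_sqr ler_wsqrtr//.
    rewrite exprMn real_normK ?num_real// mulrC -exprM mulnC exprM.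
    by rewrite (_ : 2 ^+ 2 = 4 :> R)//; ring.
  suff : cvgn (series (telescope (fun k => g (phi k) x))).
    rewrite telescopeK => cu.
    have : cvgn (fun k => g (phi k) x - g (phi 0%N) x + g (phi 0%N) x).
      by apply: is_cvgD => //; exact: is_cvg_cst.
    by under eq_fun do rewrite subrK.
  apply: normed_cvg; apply: (@series_le_cvg _ _ (geometric M 2^-1)).
  - by move=> n /=.
  - by move=> n /=; rewrite mulr_ge0 ?sqrtr_ge0 ?exprn_ge0 ?invr_ge0.
  - by move=> n /=; exact: hM.
  - by apply: is_cvg_geometric_series; rewrite ger0_norm ?invr_ge0// invf_lt1 ?ltr1n.
pose G x := fine (limn_esup (fun k => (g (phi k) x)%:E)).
have mG : measurable_fun setT G.
  apply: measurableT_comp; first exact: fine_measurable.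
  by apply: measurable_fun_limn_esup => k; exact/measurable_EFinP.
have aeS : {ae mu, forall x, S x \is a fin_num}.
  have : mu.-integrable setT S.
    apply/integrableP; split=> //; under eq_integral do rewrite gee0_abs//.
    by rewrite (le_lt_trans iS) ?ltry.
  by move/(integrable_ae measurableT); apply: filterS => x; exact.
exists G => // e e0; have [n0 Hn0] := cg e e0; exists n0 => n nn0.
have ->: (\int[mu]_x ((G x - g n x) ^+ 2)%:E = \int[mu]_x
    limn_einf (fun k => ((g (phi k) x - g n x) ^+ 2)%:E))%E.
  apply: ge0_ae_eq_integral => //.
  - by apply/measurable_EFinP; apply: measurable_funX; exact: measurable_funB.
  - apply: measurableT_comp => //; apply: measurable_fun_limn_esup => k.
    by do 2 apply: measurableT_comp => //; apply: measurable_funX; exact: measurable_funB.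
  - by move=> x _; rewrite lee_fin sqr_ge0.
  - move=> x _; rewrite limn_einf_lim; apply: lime_ge; first exact: is_cvg_einfs.
    apply: nearW => k; apply: le_ereal_inf_tmp => _ [m _ <-].
    by rewrite lee_fin sqr_ge0.
  - apply: filterS aeS => x /cS gx _.
    have GE : G x = limn (fun k => g (phi k) x).
      have gE : (fun k => (g (phi k) x)%:E) @ \oo --> (limn (fun k => g (phi k) x))%:E.
        by apply: cvg_EFin => //; apply: nearW.
      by rewrite /G (cvg_limn_einf_sup gE).2.
    have gE2 : (fun k => ((g (phi k) x - g n x) ^+ 2)%:E) @ \oo --> ((G x - g n x) ^+ 2)%:E.
      apply: cvg_EFin; first by apply: nearW.
      rewrite GE expr2; under [X in X @ _ --> _]funext => k do rewrite /= expr2.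
      by apply: cvgM; apply: cvgB => //; exact: cvg_cst.
    by rewrite (cvg_limn_einf_sup gE2).1.
apply: le_trans (fatou _ _ _ _) _ => //.
- move=> k; apply/measurable_EFinP.
  by apply: measurable_funX; exact: measurable_funB.
- by move=> k x _; rewrite lee_fin sqr_ge0.
rewrite limn_einf_lim; apply: lime_le; first exact: is_cvg_einfs.
apply: nearW => k; apply: (le_trans (ereal_inf_lbound _)) (Hn0 (phi (maxn k n0)) n _ nn0).
  by exists (maxn k n0) => //=; exact: leq_maxl.
by rewrite /phi !leq_max leqnn orbT.
Qed.

End real_complete.

Section L2space.
Context {d} {T : measurableType d} {R : realType}.
Variable mu : {measure set T -> \bar R}.

Definition sqintegrable : {pred T -> R[i]} :=
  mem [set f | cmeas f /\ (\int[mu]_x (sqn (f x))%:E < +oo)%E].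

Lemma sqintegrableP (f : T -> R[i]) : reflect
  (cmeas f /\ (\int[mu]_x (sqn (f x))%:E < +oo)%E) (f \in sqintegrable).
Proof. by apply: (iffP idP); rewrite inE. Qed.

Lemma measurable_sqnE (f : T -> R[i]) : cmeas f ->
  measurable_fun setT (fun x => (sqn (f x))%:E).
Proof. by move=> mf; exact/measurable_EFinP/measurable_sqn. Qed.

Lemma sqintegrable_submod_closed : submod_closed sqintegrable.
Proof.
split.
  apply/sqintegrableP; split; first exact: cmeas_cst.
  by under eq_integral do rewrite sqn0; rewrite integral0 ltry.
move=> a f g /sqintegrableP[mf foo] /sqintegrableP[mg goo].
have maf : cmeas (fun x => a * f x) by apply: cmeasM => //; exact: cmeas_cst.
apply/sqintegrableP; split; first exact: cmeasD.
apply: (@le_lt_trans _ _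
  (\int[mu]_x ((2 * sqn a)%:E * (sqn (f x))%:E + 2%:E * (sqn (g x))%:E))%E).
  apply: ge0_le_integral => //.
  - by move=> x _; rewrite lee_fin sqn_ge0.
  - by apply: measurable_sqnE; exact: cmeasD.
  - by apply: emeasurable_funD; apply: measurable_funeM; exact: measurable_sqnE.
  - move=> x _; rewrite -!EFinM -EFinD lee_fin; apply: le_trans (sqnD _ _) _.
    by rewrite mulrDr -mulrA -sqnM.
rewrite ge0_integralD//; last 4 first.
- by move=> x _; rewrite -EFinM lee_fin !mulr_ge0 ?sqn_ge0.
- by apply: measurable_funeM; exact: measurable_sqnE.
- by move=> x _; rewrite -EFinM lee_fin mulr_ge0 ?sqn_ge0.
- by apply: measurable_funeM; exact: measurable_sqnE.
have Z (k : R) (h : T -> R[i]) : 0 <= k -> cmeas h ->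
    (\int[mu]_x (k%:E * (sqn (h x))%:E) = k%:E * \int[mu]_x (sqn (h x))%:E)%E.
  move=> k0 mh; apply: ge0_integralZl_EFin => //; last exact: measurable_sqnE.
  by move=> x _; rewrite lee_fin sqn_ge0.
rewrite !Z//; last by rewrite mulr_ge0 ?sqn_ge0.
by rewrite lte_add_pinfty// lte_mul_pinfty// lee_fin mulr_ge0 ?sqn_ge0.
Qed.

HB.instance Definition _ :=
  GRing.isSubmodClosed.Build _ _ sqintegrable sqintegrable_submod_closed.

Record L2T := MkL2 { l2fun :> T -> R[i]; l2funP : l2fun \in sqintegrable }.

HB.instance Definition _ := [isSub for l2fun].
HB.instance Definition _ := [Choice of L2T by <:].
HB.instance Definition _ := [SubChoice_isSubLmodule of L2T by <:].

Implicit Types f g h : L2T.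

Lemma l2_cmeas f : cmeas f.
Proof. by case/sqintegrableP : (l2funP f). Qed.

Lemma l2_lty f : (\int[mu]_x (sqn (f x))%:E < +oo)%E.
Proof. by case/sqintegrableP : (l2funP f). Qed.

Lemma l2DE f g x : (f + g) x = f x + g x. Proof. by []. Qed.
Lemma l2BE f g x : (f - g) x = f x - g x. Proof. by []. Qed.
Lemma l2ZE c f x : (c *: f) x = c * f x. Proof. by []. Qed.
Lemma l2P f g : (forall x, f x = g x) -> f = g.
Proof. by move=> fg; apply: val_inj; exact/funext. Qed.

Definition reJ (a b : R[i]) : R := Re a * Re b + Im a * Im b.

Lemma reJE (a b : R[i]) : reJ a b = Re (a * conjc b).
Proof. by case: a b => [? ?] [? ?]; rewrite /reJ /=; ring. Qed.

Lemma integrable_sqn f : mu.-integrable setT (fun x => (sqn (f x))%:E).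
Proof.
apply/integrableP; split; first exact/measurable_sqnE/l2_cmeas.
by under eq_integral do rewrite gee0_abs ?lee_fin ?sqn_ge0//; exact: l2_lty.
Qed.

Lemma cintegrable_l2 f g : cintegrable mu (fun x => f x * conjc (g x)).
Proof.
apply: (@le_cintegrable _ _ _ _ _ (fun x => sqn (f x) + sqn (g x))).
- by apply: cmeasM; [exact: l2_cmeas|apply: cmeasJ; exact: l2_cmeas].
- by under eq_fun do rewrite EFinD; apply: integrableD => //; exact: integrable_sqn.
- move=> x; rewrite normcM normc_conj !sqnE.
  by have := sqr_ge0 (normc (f x) - normc (g x));
     have := normc_ge0 (f x); have := normc_ge0 (g x); nra.
Qed.

Lemma integrable_reJ f g : mu.-integrable setT (fun x => (reJ (f x) (g x))%:E).
Proof. by under eq_fun do rewrite reJE; have [] := cintegrable_l2 f g. Qed.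

(** The real part of the hermitian product: it makes L2T a real Hilbert space
    on which complex phases act as isometries, and this is all the geometry
    that the Wigner distribution sees, since it is real-valued. *)
Definition ip f g : R := \int[mu]_x reJ (f x) (g x).

Definition nsq f : R := ip f f.

Lemma ipC f g : ip f g = ip g f.
Proof. by apply: eq_Rintegral => x _; rewrite /reJ; ring. Qed.

Lemma ipDl f g h : ip (f + g) h = ip f h + ip g h.
Proof.
rewrite -RintegralD//; [|exact: integrable_reJ|exact: integrable_reJ].
by apply: eq_Rintegral => x _; rewrite l2DE /reJ cReD cImD; ring.
Qed.

Lemma ipZl (a : R) f g : ip (a%:C%C *: f) g = a * ip f g.
Proof.
rewrite -RintegralZl//; last exact: integrable_reJ.
by apply: eq_Rintegral => x _; rewrite l2ZE /reJ cReM cImM /=; ring.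
Qed.

Lemma ipZJ c f g : ip (c *: f) g = ip f (conjc c *: g).
Proof.
by apply: eq_Rintegral => x _; rewrite !l2ZE /reJ !cReM !cImM cReJ cImJ; ring.
Qed.

Lemma ipDr f g h : ip f (g + h) = ip f g + ip f h.
Proof. by rewrite ipC ipDl ipC (ipC h). Qed.

Lemma ipZr (a : R) f g : ip f (a%:C%C *: g) = a * ip f g.
Proof. by rewrite ipC ipZl ipC. Qed.

Lemma ipNl f g : ip (- f) g = - ip f g.
Proof.
have -> : - f = ((-1 : R)%:C%C) *: f by rewrite rmorphN rmorph1 scaleN1r.
by rewrite ipZl mulN1r.
Qed.

Lemma ipNr f g : ip f (- g) = - ip f g.
Proof. by rewrite ipC ipNl ipC. Qed.

Lemma ip0l f : ip 0 f = 0.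
Proof. by rewrite -(subrr f) ipDl ipNl subrr. Qed.

Lemma reJxx (a : R[i]) : reJ a a = sqn a.
Proof. by rewrite /reJ /sqn !expr2. Qed.

Lemma nsqE f : nsq f = \int[mu]_x sqn (f x).
Proof. by apply: eq_Rintegral => x _; rewrite reJxx. Qed.

Lemma nsq_ge0 f : 0 <= nsq f.
Proof. by rewrite nsqE; apply: Rintegral_ge0 => x _; exact: sqn_ge0. Qed.

Lemma EFin_nsq f : ((nsq f)%:E = \int[mu]_x (sqn (f x))%:E)%E.
Proof. by rewrite nsqE fineK//; exact: integrable_fin_num (integrable_sqn f). Qed.

Lemma nsqD f g : nsq (f + g) = nsq f + nsq g + 2 * ip f g.
Proof. by rewrite /nsq !ipDl !ipDr (ipC g f); ring. Qed.

Lemma nsqN f : nsq (- f) = nsq f.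
Proof. by rewrite /nsq ipNl ipNr opprK. Qed.

Lemma nsqB f g : nsq (f - g) = nsq f + nsq g - 2 * ip f g.
Proof. by rewrite nsqD nsqN ipNr; ring. Qed.

Lemma nsqZ c f : nsq (c *: f) = sqn c * nsq f.
Proof.
rewrite /nsq ipZJ scalerA; have -> : conjc c * c = (sqn c)%:C%C.
  by case: c => a b; apply: eqcP; rewrite /= /sqn /=; ring.
by rewrite ipZr.
Qed.

Lemma nsq0 : nsq 0 = 0. Proof. exact: ip0l. Qed.

Lemma CS_sqr f g : (ip f g) ^+ 2 <= nsq f * nsq g.
Proof.
have key (t s : R) : 0 <= t ^+ 2 * nsq f + s ^+ 2 * nsq g + 2 * t * s * ip f g.
  have := nsq_ge0 (t%:C%C *: f + s%:C%C *: g).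
  by rewrite nsqD ipZl ipZr !nsqZ /sqn /= expr0n !addr0 !mulrA.
have [g0|g0] := eqVneq (nsq g) 0.
  have [->|ipN0] := eqVneq (ip f g) 0; first by rewrite expr0n/= g0 mulr0.
  have := key 1 (- (nsq f + 1) / ip f g); have := nsq_ge0 f.
  have -> : 2 * 1 * (- (nsq f + 1) / ip f g) * ip f g = - 2 * (nsq f + 1) by field.
  by rewrite g0; nra.
have gp : 0 < nsq g by rewrite lt_neqAle eq_sym g0 nsq_ge0.
have := key (nsq g) (- ip f g).
have -> : nsq g ^+ 2 * nsq f + (- ip f g) ^+ 2 * nsq g +
   2 * nsq g * - ip f g * ip f g = nsq g * (nsq f * nsq g - ip f g ^+ 2) by ring.
by rewrite pmulr_rge0// subr_ge0.
Qed.

Definition nrm f : R := Num.sqrt (nsq f).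

Lemma nrm_ge0 f : 0 <= nrm f. Proof. exact: sqrtr_ge0. Qed.

Lemma sqr_nrm f : nrm f ^+ 2 = nsq f.
Proof. by rewrite sqr_sqrtr// nsq_ge0. Qed.

Lemma CS f g : `|ip f g| <= nrm f * nrm g.
Proof.
by rewrite -sqrtrM ?nsq_ge0// -sqrtr_sqr ler_wsqrtr// CS_sqr.
Qed.

Lemma nrmZ c f : nrm (c *: f) = normc c * nrm f.
Proof. by rewrite /nrm nsqZ sqrtrM ?sqn_ge0// normc_sqrt. Qed.

(** Completeness for the real and imaginary parts, which are dominated by the
    modulus. *)
Lemma L2_complete (f : nat -> L2T) :
  (forall e, 0 < e -> exists N, forall m n, (N <= m)%N -> (N <= n)%N ->
    nsq (f m - f n) <= e) ->
  exists g, forall e, 0 < e -> exists N, forall n, (N <= n)%N -> nsq (g - f n) <= e.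
Proof.
move=> cf.
have part (u : R[i] -> R) (uB : forall a b, u (a - b) = u a - u b)
    (us : forall a, u a ^+ 2 <= sqn a) (um : forall k : L2T, measurable_fun setT (fun x => u (k x))) :
  forall e : R, 0 < e -> exists N, forall m n, (N <= m)%N -> (N <= n)%N ->
    (\int[mu]_x ((u (f m x) - u (f n x)) ^+ 2)%:E <= e%:E)%E.
  move=> e /cf[N HN]; exists N => m n Nm Nn.
  apply: (@le_trans _ _ ((nsq (f m - f n))%:E)%E); last by rewrite lee_fin HN.
  rewrite EFin_nsq; apply: ge0_le_integral => //.
  - by move=> x _; rewrite lee_fin sqr_ge0.
  - by apply/measurable_EFinP; apply: measurable_funX; exact: measurable_funB.
  - exact/measurable_sqnE/l2_cmeas.
  - by move=> x _; rewrite lee_fin l2BE -uB us.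
have rB (a b : R[i]) : Re (a - b) = Re a - Re b by rewrite cReD cReN.
have iB (a b : R[i]) : Im (a - b) = Im a - Im b by rewrite cImD cImN.
have rs (a : R[i]) : Re a ^+ 2 <= sqn a by rewrite lerDl sqr_ge0.
have is_ (a : R[i]) : Im a ^+ 2 <= sqn a by rewrite lerDr sqr_ge0.
have [G1 mG1 HG1] := L2_real_complete (fun n => (l2_cmeas (f n)).1)
  (part (fun a => Re a) rB rs (fun k => (l2_cmeas k).1)).
have [G2 mG2 HG2] := L2_real_complete (fun n => (l2_cmeas (f n)).2)
  (part (fun a => Im a) iB is_ (fun k => (l2_cmeas k).2)).
pose G x : R[i] := (G1 x +i* G2 x)%C.
have mG : cmeas G by [].
have near e : 0 < e -> exists N, forall n, (N <= n)%N ->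
    (\int[mu]_x (sqn (G x - f n x))%:E <= e%:E)%E.
  move=> e0; have e20 : 0 < e / 2 by rewrite divr_gt0.
  have [N1 H1] := HG1 _ e20; have [N2 H2] := HG2 _ e20.
  exists (maxn N1 N2) => n; rewrite geq_max => /andP[n1 n2].
  rewrite (splitr e) EFinD; apply: le_trans (leeD (H1 _ n1) (H2 _ n2)).
  rewrite -ge0_integralD//.
  - apply: ge0_le_integral => //.
    + by move=> x _; rewrite lee_fin sqn_ge0.
    + apply: measurable_sqnE; have [f1 f2] := l2_cmeas (f n).
      split; first by under eq_fun do rewrite cReD cReN; exact: measurable_funB.
      by under eq_fun do rewrite cImD cImN; exact: measurable_funB.
    + apply: emeasurable_funD; apply/measurable_EFinP; apply: measurable_funX;
        apply: measurable_funB => //; by case: (l2_cmeas (f n)).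
    + by move=> x _; rewrite -EFinD lee_fin /sqn cReD cReN cImD cImN.
  - by move=> x _; rewrite lee_fin sqr_ge0.
  - apply/measurable_EFinP; apply: measurable_funX; apply: measurable_funB => //.
    by case: (l2_cmeas (f n)).
  - by move=> x _; rewrite lee_fin sqr_ge0.
  - apply/measurable_EFinP; apply: measurable_funX; apply: measurable_funB => //.
    by case: (l2_cmeas (f n)).
have GL : G \in sqintegrable.
  have [N /(_ N (leqnn N)) HN] := near 1 ltr01.
  have GfN : (fun x => G x - f N x) \in sqintegrable.
    apply/sqintegrableP; split; last by rewrite (le_lt_trans HN) ?ltry.
    have [f1 f2] := l2_cmeas (f N).
    split; first by under eq_fun do rewrite cReD cReN; exact: measurable_funB.
    by under eq_fun do rewrite cImD cImN; exact: measurable_funB.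
  have -> : G = l2fun (MkL2 GfN + f N).
    by apply/funext => x; rewrite l2DE/= subrK.
  exact: l2funP.
exists (MkL2 GL) => e /near[N HN]; exists N => n /HN.
by rewrite -lee_fin EFin_nsq.
Qed.

End L2space.


(** * Riesz representation and weak limits along an ultrafilter *)

Section riesz.
Context {d} {T : measurableType d} {R : realType}.
Variable mu : {measure set T -> \bar R}.
Notation H := (L2T mu).

Definition closed_subspace (S : set H) := [/\ S 0,
  forall f g, S f -> S g -> S (f + g), forall (a : R) f, S f -> S (a%:C%C *: f) &
  forall g, (forall e, 0 < e -> exists2 s, S s & nsq (g - s) <= e) -> S g].

(** A minimizing sequence of the functional nsq g - 2 phi g in S is Cauchy by the
    parallelogram identity, and its limit represents phi on S. *)
Lemma riesz_in (S : set H) (phi : H -> R) (M : R) : closed_subspace S ->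
  (forall f g, phi (f + g) = phi f + phi g) ->
  (forall (a : R) f, phi (a%:C%C *: f) = a * phi f) ->
  (forall f, `|phi f| <= M * nrm f) ->
  exists2 g, S g & forall f, S f -> phi f = ip f g.
Proof.
move=> [S0 SD SZ Scl] phiD phiZ phiM.
pose J g := nsq g - 2 * phi g.
have JM g : - M ^+ 2 <= J g.
  have := phiM g; rewrite ler_norml /J -sqr_nrm => /andP[_].
  by have := sqr_ge0 (nrm g - M); nra.
pose A := J @` S.
have infA : has_inf A.
  split; first by exists (J 0), 0.
  by exists (- M ^+ 2) => _ [g _ <-]; exact: JM.
pose m := inf A.
have mJ g : S g -> m <= J g.
  by move=> Sg; apply: ge_inf; [case: infA|exists g].
have /choice[g Hg] : forall n : nat, exists g, S g /\ J g < m + n.+1%:R^-1.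
  move=> n; have [] := inf_adherent (_ : 0 < n.+1%:R^-1) infA => //.
  by move=> _ [g Sg <-] Jg; exists g.
have par a b : S a -> S b -> nsq (a - b) <= 2 * J a + 2 * J b - 4 * m.
  move=> Sa Sb; have := mJ _ (SZ (2^-1) _ (SD _ _ Sa Sb)).
  rewrite /J nsqZ phiZ phiD nsqB nsqD /sqn /= expr0n/= addr0.
  by nra.
have cvg_inv (e : R) : 0 < e -> exists N, forall n, (N <= n)%N -> n.+1%:R^-1 <= e.
  move=> e0; exists (Num.truncn e^-1) => n Nn.
  rewrite -[leRHS]invrK lef_pV2 ?posrE ?invr_gt0//.
  by apply/ltW; apply: lt_le_trans (truncnS_gt _) _; rewrite ler_nat.
have [|G HG] := @L2_complete _ _ _ mu g.
  move=> e e0; have [N HN] := cvg_inv (e / 4) (divr_gt0 e0 (ltr0n _ 4)).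
  exists N => j k /HN Nj /HN Nk.
  have [Sj Jj] := Hg j; have [Sk Jk] := Hg k.
  apply: le_trans (par _ _ Sj Sk) _.
  move: (J (g j)) (J (g k)) (j.+1%:R^-1) (k.+1%:R^-1) Nj Nk Jj Jk => a b c q.
  clearbody m; move=> {par mJ Hg} *; lra.
have SG : S G.
  apply: Scl => e /HG[N HN]; exists (g N); first by case: (Hg N).
  exact: HN.
exists G => // f Sf.
have key (t : R) : 0 <= 2 * t * (ip f G - phi f) + t ^+ 2 * nsq f.
  apply/ler_addgt0Pl => e e0.
  have c0 : 0 < 1 + `|2 * t| * nrm f by rewrite ltr_pwDl ?mulr_ge0 ?nrm_ge0.
  pose q := e / 2 / (1 + `|2 * t| * nrm f).
  have q0 : 0 < q by rewrite !divr_gt0.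
  have [N1 H1] := cvg_inv (e / 2) (divr_gt0 e0 (ltr0n _ 2)).
  have [N2 H2] := HG (q ^+ 2) (exprn_gt0 _ q0).
  pose n := maxn N1 N2; have [Sn Jn] := Hg n.
  have := mJ _ (SD _ _ Sn (SZ t _ Sf)).
  rewrite /J nsqD nsqZ ipZr phiD phiZ /sqn/= expr0n/= addr0 => mle.
  have n1 : n.+1%:R^-1 <= e / 2 by apply: H1; exact: leq_maxl.
  have qn : nrm (G - g n) <= q.
    by rewrite -(ger0_norm (ltW q0)) -sqrtr_sqr ler_wsqrtr// H2// leq_maxr.
  have cs : `|2 * t * ip (G - g n) f| <= e / 2.
    rewrite normrM; apply: le_trans (ler_wpM2l (normr_ge0 _) (CS _ _)) _.
    have : q * (1 + `|2 * t| * nrm f) = e / 2 by rewrite /q divfK// gt_eqF.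
    have := nrm_ge0 (G - g n); have := nrm_ge0 f; have := normr_ge0 (2 * t).
    have : 0 <= `|2 * t| * nrm f by rewrite mulr_ge0 ?nrm_ge0.
    have : `|2 * t| * (nrm (G - g n) * nrm f) = nrm (G - g n) * (`|2 * t| * nrm f) by ring.
    by move=> -> *; nra.
  move: cs; rewrite ler_norml ipDl ipNl (ipC G f) => /andP[cs1 cs2].
  move: cs1 Jn mle n1; rewrite /J; clear -m e t.
  move: (nsq (g n)) (phi (g n)) (ip (g n) f) (ip f G) (phi f) (nsq f) => a b i k u v.
  by move: (n.+1%:R^-1); clearbody m => q *; lra.
have [fc|cN0] := eqVneq (ip f G - phi f) 0.
  by apply/esym/eqP; rewrite -subr_eq0; apply/eqP.
have N0 : 0 < nsq f + 1 by rewrite ltr_wpDl ?nsq_ge0.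
have := key (- (ip f G - phi f) / (nsq f + 1)).
set c := ip f G - phi f in cN0 *.
have -> : 2 * (- c / (nsq f + 1)) * c + (- c / (nsq f + 1)) ^+ 2 * nsq f =
    - (c ^+ 2 * (nsq f + 2) / (nsq f + 1) ^+ 2) by field; rewrite gt_eqF.
rewrite oppr_ge0 leNgt => /negP[].
rewrite divr_gt0 ?exprn_gt0// mulr_gt0//; first by rewrite exprn_even_gt0.
by rewrite ltr_wpDl ?nsq_ge0.
Qed.

Lemma riesz (phi : H -> R) (M : R) :
  (forall f g, phi (f + g) = phi f + phi g) ->
  (forall (a : R) f, phi (a%:C%C *: f) = a * phi f) ->
  (forall f, `|phi f| <= M * nrm f) ->
  exists g, forall f, phi f = ip f g.
Proof.
move=> phiD phiZ phiM.
have [//|g _ Hg] := @riesz_in setT phi M _ phiD phiZ phiM.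
by exists g => f; exact: Hg.
Qed.

(** The representative g in S of the functional ip _ f on S is the orthogonal
    projection of f: the vector f - g is orthogonal to S. *)
Lemma closed_subspace_dense (S : set H) : closed_subspace S ->
  (forall h, (forall s, S s -> ip s h = 0) -> nsq h = 0) -> forall f, S f.
Proof.
move=> Scl Sort f.
have [|g Sg gP] := @riesz_in S (fun h => ip h f) (nrm f) Scl (fun a b => ipDl a b f)
    (fun a b => ipZl a b f).
  by move=> h; rewrite mulrC CS.
have [_ _ _] := Scl; apply => e e0; exists g => //.
rewrite Sort ?ltW// => s Ss; by rewrite ipDr ipNr (gP _ Ss) subrr.
Qed.

Section ultra.
Variable U : set_system nat.
Context {UU : UltraFilter U}.

(** A cluster point exists by compactness, and an ultrafilter converges to each
    of its cluster points. *)
Lemma ultra_bounded_cvg (x : nat -> R) (M : R) : (forall n, `|x n| <= M) ->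
  exists l : R, x @ U --> l.
Proof.
move=> xM.
have xU : (x @ U) `[- M, M]%classic.
  rewrite nbhs_simpl/=; apply: filterE => n; by rewrite /= in_itv/= -ler_norml.
have [l [_ clx]] := @segment_compact R (- M) M (x @ U) _ xU.
exists l => V lV.
have [//|VN] := in_ultra_setVsetC (x @^-1` V) UU.
by have [y [+ Vy]] := clx (~` V) V VN lV; move=> /(_ Vy).
Qed.

(** Every bounded sequence has a weak limit along U: the limits of its inner
    products with a fixed vector form a bounded functional. *)
Lemma weak_limit (f : nat -> H) (M : R) : (forall n, nsq (f n) <= M) ->
  exists g, forall h, (fun n => ip h (f n)) @ U --> ip h g.
Proof.
move=> fM.
have hM h n : `|ip h (f n)| <= Num.sqrt M * nrm h.
  rewrite mulrC; apply: le_trans (CS _ _) _.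
  by rewrite ler_wpM2l ?nrm_ge0// ler_wsqrtr.
have /choice[phi Hphi] : forall h, exists l : R, (fun n => ip h (f n)) @ U --> l.
  by move=> h; exact: ultra_bounded_cvg (hM h).
have [||| g Hg] := @riesz phi (Num.sqrt M).
- move=> a b; have h : (fun n => ip (a + b) (f n)) @ U --> phi a + phi b.
    by under eq_fun do rewrite ipDl; exact: cvgD.
  exact: cvg_unique (Hphi _) h.
- move=> a b; have h : (fun n => ip (a%:C%C *: b) (f n)) @ U --> a * phi b.
    by under eq_fun do rewrite ipZl; apply: cvgM => //; exact: cvg_cst.
  exact: cvg_unique (Hphi _) h.
- move=> h; rewrite ler_norml; apply/andP; split.
    apply: (closed_cvg (fun y : R => - (Num.sqrt M * nrm h) <= y) _ _ _ (Hphi h)).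
      exact: closed_ge.
    by apply: filterE => n; have := hM h n; rewrite ler_norml => /andP[].
  apply: (closed_cvg (fun y : R => y <= Num.sqrt M * nrm h) _ _ _ (Hphi h)).
    exact: closed_le.
  by apply: filterE => n; have := hM h n; rewrite ler_norml => /andP[].
by exists g => h; rewrite -Hg; exact: Hphi.
Qed.

End ultra.
End riesz.


(** * Density of step functions *)

Section density.
Context {d} {T : measurableType d} {R : realType}.
Variable mu : {measure set T -> \bar R}.

Definition cind (c : R[i]) (A : set T) : T -> R[i] := fun x => c * (\1_A x)%:C%C.

Lemma cmeas_cind c A : measurable A -> cmeas (cind c A).
Proof.
move=> mA; apply: cmeasM; first exact: cmeas_cst.
by split=> /=; [exact: measurable_indic|exact: measurable_cst].
Qed.

Lemma sqn_cind c A x : sqn (cind c A x) = sqn c * \1_A x.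
Proof.
rewrite /cind sqnM {2}/sqn /= expr0n addr0 indicE; congr (_ * _).
by case: (x \in A); rewrite ?expr0n ?expr1n.
Qed.

Lemma cind_L2 c A : measurable A -> (mu A < +oo)%E -> cind c A \in sqintegrable mu.
Proof.
move=> mA Aoo; apply/sqintegrableP; split; first exact: cmeas_cind.
under eq_integral do rewrite sqn_cind EFinM.
rewrite ge0_integralZl_EFin//; last 2 first.
- exact/measurable_EFinP/measurable_indic.
- exact: sqn_ge0.
by rewrite integral_indic// setIT lte_mul_pinfty// ?lee_fin ?sqn_ge0.
Qed.

Definition cindL2 c A (mA : measurable A) (Aoo : (mu A < +oo)%E) : L2T mu :=
  MkL2 (cind_L2 c mA Aoo).

Lemma Rintegral_indicM (A : set T) (u : T -> R) : measurable A ->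
  \int[mu]_x (\1_A x * u x) = \int[mu]_(x in A) u x.
Proof.
move=> mA; rewrite [RHS]Rintegral_mkcond; apply: eq_Rintegral => x _.
by rewrite patchE indicE; case: ifPn; rewrite ?mul1r ?mul0r.
Qed.

Lemma normc_le_sqn1 (a : R[i]) : normc a <= sqn a + 1.
Proof. by rewrite sqnE; have := sqr_ge0 (normc a - 2^-1); nra. Qed.

Lemma integrable_indic_l2 (A : set T) (h : L2T mu) (u : R[i] -> R) :
  measurable A -> (mu A < +oo)%E -> measurable_fun setT (fun x => u (h x)) ->
  (forall a, `|u a| <= normc a) ->
  mu.-integrable setT (fun x => (\1_A x * u (h x))%:E).
Proof.
move=> mA Aoo um un.
have g1 : mu.-integrable setT (fun x => (sqn (h x) + \1_A x)%:E).
  under eq_fun do rewrite EFinD; apply: integrableD => //; first exact: integrable_sqn.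
  apply/integrableP; split; first exact/measurable_EFinP/measurable_indic.
  under eq_integral do rewrite gee0_abs ?lee_fin//.
  by rewrite integral_indic// setIT.
apply: le_integrable g1 => //.
  by apply/measurable_EFinP; apply: measurable_funM => //; exact: measurable_indic.
move=> x _; rewrite !abse_EFin lee_fin normrM indicE ger0_norm//.
rewrite [leRHS]ger0_norm ?(addr_ge0 (sqn_ge0 _))//.
case: (x \in A); last by rewrite mul0r addr0 sqn_ge0.
by rewrite mul1r; apply: le_trans (un _) (normc_le_sqn1 _).
Qed.

Lemma ip_cindL2 c A mA Aoo (h : L2T mu) : ip (@cindL2 c A mA Aoo) h =
  Re c * (\int[mu]_(x in A) Re (h x)) + Im c * (\int[mu]_(x in A) Im (h x)).
Proof.
have i1 := integrable_indic_l2 mA Aoo (l2_cmeas h).1 (@le_Re_normc R).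
have i2 := integrable_indic_l2 mA Aoo (l2_cmeas h).2 (@le_Im_normc R).
have i1c := integrableZl measurableT (Re c) i1.
have i2c := integrableZl measurableT (Im c) i2.
rewrite /ip -(Rintegral_indicM (fun x => Re (h x)) mA).
rewrite -(Rintegral_indicM (fun x => Im (h x)) mA).
rewrite -(RintegralZl (Re c) measurableT i1) -(RintegralZl (Im c) measurableT i2).
rewrite -RintegralD//.
by apply: eq_Rintegral => x _; rewrite /reJ /= cReM cImM /=; ring.
Qed.

(** A square-integrable function orthogonal to the indicators of a generating
    pi-system has vanishing integrals over all measurable sets by Dynkin's
    theorem, hence vanishes. *)
Lemma L2_dense (G : set (set T)) (g : nat -> set T) (S : set (L2T mu)) :
  @measurable _ T = <<s G >> -> setI_closed G -> (forall k, G (g k)) ->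
  \bigcup_k g k = setT -> (forall k, (mu (g k) < +oo)%E) ->
  closed_subspace S ->
  (forall c A (mA : measurable A) (Aoo : (mu A < +oo)%E), G A -> S (cindL2 c mA Aoo)) ->
  forall f, S f.
Proof.
move=> mG GI Gg gT goo Scl SG; apply: closed_subspace_dense => // h hS.
have Gm A : G A -> measurable A by move=> GA; rewrite mG; exact: sub_gen_smallest.
have key (u : R[i] -> R) : measurable_fun setT (fun x => u (h x)) ->
    (forall a, `|u a| <= normc a) ->
    (forall A, G A -> (mu A < +oo)%E -> \int[mu]_(x in A) u (h x) = 0) ->
    {ae mu, forall x, u (h x) = 0}.
  move=> um un uG.
  have ui k := integrable_indic_l2 (Gm _ (Gg k)) (goo k) um un.
  have iS k B : measurable B -> mu.-integrable B (fun x => (\1_(g k) x * u (h x))%:E).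
    by move=> mB; apply: integrableS (ui k).
  have z k A : measurable A -> (\int[mu]_(x in A) (\1_(g k) x * u (h x))%:E = 0)%E.
    move=> mA; have : <<s G >> A by rewrite -mG.
    have onG B : G B -> (\int[mu]_(x in B) (\1_(g k) x * u (h x))%:E = 0)%E.
      move=> GB; rewrite -[LHS]fineK; last first.
        by apply: integrable_fin_num => //; [exact: Gm|apply: iS; exact: Gm].
      congr EFin; rewrite -/(Rintegral mu B (fun x => \1_(g k) x * u (h x))).
      rewrite -Rintegral_indicM; last exact: Gm.
      have GBg : G (B `&` g k) by exact: GI.
      have Bgoo : (mu (B `&` g k) < +oo)%E.
        by apply: le_lt_trans (goo k); apply: le_measure;
          rewrite ?inE; [exact: Gm|exact: Gm|exact: subIsetr].
      rewrite -(uG _ GBg Bgoo) -[RHS]Rintegral_indicM; last exact: Gm.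
      by apply: eq_Rintegral => x _; rewrite indicI/= mulrA.
    have oT : (\int[mu]_x (\1_(g k) x * u (h x))%:E = 0)%E.
      rewrite -(onG (g k))// [RHS]integral_mkcond; apply: eq_integral => x _.
      by rewrite patchE indicE; case: (x \in g k) => //=; rewrite mul0r.
    move: (A); clear A mA; apply: (@dynkin_induction _ T G
      (fun A => \int[mu]_(x in A) (\1_(g k) x * u (h x))%:E = 0)%E mG GI) => //.
    - move=> B mB B0; have := oT; rewrite -(setUv B) integral_setU//.
      + by rewrite B0 add0e.
      + exact: measurableC.
      + by apply: measurable_funTS; case/integrableP : (ui k).
      + by rewrite disj_set2E setICr.
    - move=> F mF tF F0; rewrite integral_bigcup//.
        by rewrite eseries0.
      by apply: iS; exact: bigcup_measurable.
  have zk k : {ae mu, forall x, \1_(g k) x * u (h x) = 0}.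
    have h1 : ae_eq mu setT (fun x => (\1_(g k) x * u (h x))%:E) (fun=> 0%E).
      apply: (integral_ae_eq measurableT (ui k) (measurable_cst _)) => E _ mE.
      by rewrite integral0 z.
    by apply: filterS h1 => x /(_ I) [].
  have := ae_foralln zk; apply: filterS => x xz.
  have [k _ gkx] : (\bigcup_k g k) x by rewrite gT.
  by have := xz k; rewrite indicE mem_set// mul1r.
have hr : {ae mu, forall x, Re (h x) = 0}.
  apply: key; [exact: (l2_cmeas h).1|exact: le_Re_normc|move=> A GA Aoo].
  have := hS _ (SG 1 A (Gm _ GA) Aoo GA); rewrite ip_cindL2 /=.
  by rewrite mul1r mul0r addr0.
have hi : {ae mu, forall x, Im (h x) = 0}.
  apply: (key (fun a => Im a)); [exact: (l2_cmeas h).2|exact: le_Im_normc|move=> A GA Aoo].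
  have := hS _ (SG 'i%C A (Gm _ GA) Aoo GA); rewrite ip_cindL2 /=.
  by rewrite mul1r mul0r add0r.
rewrite nsqE /Rintegral (ae_eq_integral (fun=> 0%E))//; first by rewrite integral0.
- exact/measurable_sqnE/l2_cmeas.
- apply: filterS2 hr hi => x r i _; by rewrite /sqn r i expr0n addr0.
Qed.

End density.


(** * Lebesgue measure on R^n *)

Section rV_measure.
Context {R : realType} {n : nat}.
Implicit Types (u v : 'I_n -> R) (x : 'rV[R]_n).
Local Notation lam := (lebesgue_rV R n).

Definition obox u v : set 'rV[R]_n := [set x | forall i, `]u i, v i]%classic (x ord0 i)].

Lemma measurable_obox u v : measurable (obox u v).
Proof. by apply: (@measurable_rV_box R n (fun i => `]u i, v i]%classic)) => i; exact: measurable_itv. Qed.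

Lemma oboxI u v u' v' : obox u v `&` obox u' v' =
  obox (fun i => Num.max (u i) (u' i)) (fun i => Num.min (v i) (v' i)).
Proof.
apply/seteqP; split => [x [h1 h2] i|x h].
  have := h1 i; have := h2 i; rewrite /= !in_itv/= gt_max le_min.
  by move=> /andP[-> ->] /andP[-> ->].
split=> i; have := h i; rewrite /= !in_itv/= gt_max le_min.
  by move=> /andP[/andP[-> _] /andP[-> _]].
by move=> /andP[/andP[_ ->] /andP[_ ->]].
Qed.

Definition oboxes : set (set 'rV[R]_n) := [set A | exists u v, A = obox u v].

Lemma oboxes_setI : setI_closed oboxes.
Proof. by move=> _ _ [u [v ->]] [u' [v' ->]]; rewrite oboxI; do 2 eexists. Qed.

Definition ocube (k : nat) : set 'rV[R]_n := obox (fun=> - k%:R) (fun=> k%:R).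

Lemma mem_ocube x : exists k, ocube k x.
Proof.
exists (Num.truncn (\sum_i `|x ord0 i|)).+1 => i; rewrite /= in_itv/=.
have h : `|x ord0 i| < (Num.truncn (\sum_i `|x ord0 i|)).+1%:R.
  apply: le_lt_trans (truncnS_gt _); rewrite (bigD1 i)//= lerDl.
  by apply: sumr_ge0 => j _.
by move: h; rewrite ltr_norml => /andP[-> /ltW].
Qed.

Lemma ocube_cover : \bigcup_k ocube k = setT.
Proof. by apply/seteqP; split=> // x _; have [k kx] := mem_ocube x; exists k. Qed.

Lemma lebesgue_obox u v : lam (obox u v) =
  (\prod_(i < n) Num.max 0 (v i - u i))%:E.
Proof.
rewrite (lebesgue_rV_box (A := fun i => `]u i, v i]%classic))//.
rewrite -prodEFin; apply: eq_bigr => i _.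
rewrite lebesgue_measure_itv/= lte_fin; case: ltP => uv.
  by rewrite -EFinB; congr EFin; rewrite max_r// subr_ge0 ltW.
by rewrite max_l// subr_le0.
Qed.

Lemma lebesgue_ocube_lty k : (lam (ocube k) < +oo)%E.
Proof. by rewrite lebesgue_obox ltry. Qed.

Lemma measurable_rVE : @measurable _ 'rV[R]_n = <<s oboxes >>.
Proof.
apply/seteqP; split; last first.
  apply: smallest_sub; first exact: sigma_algebra_measurable.
  by move=> _ [u [v ->]]; exact: measurable_obox.
pose T' := g_sigma_algebraType oboxes.
suff : measurable_fun setT (id : T' -> 'rV[R]_n).
  by move=> mid A mA; have := mid measurableT A mA; rewrite setTI preimage_id.
apply/measurable_fun_rVP => i.
apply: (@measurability _ _ T' (measurableTypeR R) setT _ (@ocitv R)) => //.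
move=> _ [_ [[a b] _ <-] <-]; rewrite setTI /=.
pose u k j : R := if j == i then a else - k%:R.
pose v k j : R := if j == i then b else k%:R.
have -> : (fun x : 'rV[R]_n => x ord0 i) @^-1` `]a, b]%classic =
    \bigcup_k obox (u k) (v k).
  apply/seteqP; split=> [x xab|x [k _ /(_ i)]]; last by rewrite /u /v eqxx.
  have [k kx] := mem_ocube x; exists k => // j; rewrite /u /v.
  by case: eqVneq => [->//|_]; exact: kx.
apply: (@bigcupT_measurable _ T') => k; apply: sub_sigma_algebra.
by exists (u k), (v k).
Qed.

Lemma rV_measure_unique (m1 m2 : {measure set 'rV[R]_n -> \bar R}) :
  (forall u v, m1 (obox u v) = m2 (obox u v)) -> (forall k, m1 (ocube k) < +oo)%E ->
  forall A, measurable A -> m1 A = m2 A.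
Proof.
move=> m12 m1oo A mA; apply: (measure_unique oboxes ocube) => //.
- exact: measurable_rVE.
- exact: oboxes_setI.
- by move=> k; do 2 eexists.
- exact: ocube_cover.
- by move=> _ [u [v ->]].
Qed.

Lemma measurable_affine (a : R) (b : 'rV[R]_n) : measurable_fun setT (fun x => a *: x + b).
Proof.
apply/measurable_fun_rVP => i; under eq_fun do rewrite !mxE.
apply: measurable_funD => //; apply: measurable_funM => //.
exact: measurable_rV_coord.
Qed.

(** The volume form: checked on boxes, whose preimages are again boxes up to
    the orientation of the half-open sides. *)
Lemma lebesgue_affine (a : R) (b : 'rV[R]_n) A : a != 0 -> measurable A ->
  lam ((fun x => a *: x + b) @^-1` A) = ((`|a| ^- n)%:E * lam A)%E.
Proof.
move=> a0 mA.
pose phi (x : 'rV[R]_n) := a *: x + b.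
pose mphi := isMeasurableFun.Build _ _ _ _ _ (measurable_affine a b).
pose f : {mfun 'rV[R]_n >-> 'rV[R]_n} := HB.pack phi mphi.
have k0 : 0 <= `|a| ^- n by rewrite invr_ge0 exprn_ge0.
pose m1 := mscale (NngNum k0) lam.
apply/esym; rewrite -[LHS]/(m1 A) -[RHS]/(pushforward lam f A).
apply: (@rV_measure_unique m1 (pushforward lam f)) => // [u v|k]; last first.
  change (((`|a| ^- n)%:E * lam (ocube k)) < +oo)%E.
  by rewrite lebesgue_obox -EFinM ltry.
transitivity ((`|a| ^- n)%:E * lam (obox u v))%E; first by [].
rewrite lebesgue_obox; transitivity (lam (f @^-1` obox u v)); last by [].
have -> : f @^-1` obox u v = [set x | forall i,
    [set t : R | u i < a * t + b ord0 i <= v i] (x ord0 i)].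
  apply/seteqP; split=> x h i; have := h i; rewrite /= in_itv/= /phi !mxE//.
have mi i : measurable [set t : R | u i < a * t + b ord0 i <= v i].
  rewrite [X in measurable X](_ : _ = setT `&` (fun t => a * t + b ord0 i) @^-1` `]u i, v i]%classic).
    have : measurable_fun setT (fun t : R => a * t + b ord0 i).
      by apply: measurable_funD => //; exact: measurable_funM.
    by apply => //; exact: measurable_itv.
  by rewrite setTI; apply/seteqP; split => t /=; rewrite in_itv.
rewrite [RHS](lebesgue_rV_box (A := fun i => [set t : R | u i < a * t + b ord0 i <= v i]) mi) -EFinM.
have -> : `|a| ^- n = \prod_(i < n) `|a|^-1 by rewrite prodr_const card_ord exprVn.
rewrite -big_split/= -prodEFin; apply: eq_bigr => i _.
have [a1|a1] := ltP 0 a.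
  have -> : [set t : R | u i < a * t + b ord0 i <= v i] =
      `](u i - b ord0 i) / a, (v i - b ord0 i) / a]%classic.
    apply/seteqP; split => t /=; rewrite in_itv/= ltr_pdivrMr// ler_pdivlMr//;
      by rewrite ltrBlDr lerBrDr (mulrC t).
  rewrite lebesgue_measure_itv/= lte_fin ltr_pM2r ?invr_gt0// ltrD2r gtr0_norm//.
  case: ltP => uv; last by rewrite max_l ?subr_le0// mulr0.
  by rewrite -EFinB; congr EFin; rewrite max_r ?subr_ge0 ?ltW//; ring.
have {a1}a1 : a < 0 by rewrite lt_neqAle a0.
have -> : [set t : R | u i < a * t + b ord0 i <= v i] =
    `[(v i - b ord0 i) / a, (u i - b ord0 i) / a[%classic.
  apply/seteqP; split => t /=; rewrite in_itv/= ler_ndivrMr// ltr_ndivlMr//;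
    by rewrite ltrBlDr lerBrDr (mulrC t) andbC.
rewrite lebesgue_measure_itv/= lte_fin ltr_nM2r ?invr_lt0// ltrD2r ltr0_norm//.
case: ltP => uv; last by rewrite max_l ?subr_le0// mulr0.
by rewrite -EFinB; congr EFin; rewrite max_r ?subr_ge0 ?ltW// invrN; ring.
Qed.

End rV_measure.


(** * Unitary weighted composition operators *)

Section wcomp.
Context {d} {T : measurableType d} {R : realType}.
Variable mu : {measure set T -> \bar R}.
Variables (h : T -> T) (w : T -> R[i]).
Hypothesis mh : measurable_fun setT h.
Hypothesis hE : forall A, measurable A -> mu (h @^-1` A) = mu A.
Hypothesis mw : cmeas w.
Hypothesis w1 : forall x, sqn (w x) = 1.

Lemma ge0_integral_preserving (g : T -> \bar R) : measurable_fun setT g ->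
  (forall x, 0 <= g x)%E -> (\int[mu]_x g (h x) = \int[mu]_x g x)%E.
Proof.
move=> mg g0; rewrite [LHS](_ : _ = \int[pushforward mu h]_x g x)%E; last first.
  by rewrite ge0_integral_pushforward// => y _; exact: g0.
by apply: eq_measure_integral => A mA _ /=; rewrite /pushforward hE.
Qed.

Lemma wcomp_subproof (f : L2T mu) : (fun x => w x * f (h x)) \in sqintegrable mu.
Proof.
apply/sqintegrableP; split.
  by apply: cmeasM => //; apply: cmeas_comp => //; exact: l2_cmeas.
under eq_integral do rewrite sqnM w1 mul1r.
rewrite (ge0_integral_preserving (g := fun x => (sqn (f x))%:E)).
- exact: l2_lty.
- exact/measurable_sqnE/l2_cmeas.
- by move=> x; rewrite lee_fin sqn_ge0.
Qed.

Definition wcomp f : L2T mu := MkL2 (wcomp_subproof f).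

Lemma wcompD f g : wcomp (f + g) = wcomp f + wcomp g.
Proof. by apply/val_inj/funext => x; rewrite /= mulrDr. Qed.

Lemma wcompZ c f : wcomp (c *: f) = c *: wcomp f.
Proof. by apply/val_inj/funext => x /=; rewrite mulrCA. Qed.

Lemma nsq_wcomp f : nsq (wcomp f) = nsq f.
Proof.
apply: EFin_inj; rewrite !EFin_nsq.
under eq_integral do rewrite /= sqnM w1 mul1r.
rewrite (ge0_integral_preserving (g := fun x => (sqn (f x))%:E))//.
- exact/measurable_sqnE/l2_cmeas.
- by move=> x; rewrite lee_fin sqn_ge0.
Qed.

End wcomp.

(** Polarization. *)
Lemma isometry_ip d (T : measurableType d) (R : realType) (mu : {measure set T -> \bar R})
  (L : L2T mu -> L2T mu) : (forall f g, L (f + g) = L f + L g) ->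
  (forall f, nsq (L f) = nsq f) -> forall f g, ip (L f) (L g) = ip f g.
Proof.
move=> LD Ln f g; have := Ln (f + g); rewrite LD !nsqD !Ln => h.
by lra.
Qed.

Lemma three_term_bound (R : realType) (e x y z : R) :
  x <= 2 * (y + z) -> y <= e / 10 -> z <= e / 10 -> 2 * (z + x) <= e.
Proof. by move=> *; lra. Qed.

Section strong_continuity.
Context {d} {T : measurableType d} {R : realType}.
Variable mu : {measure set T -> \bar R}.
Variables (I : Type) (P : R -> I -> Prop) (L : I -> L2T mu -> L2T mu).
Hypothesis Pmono : forall r s t, r <= s -> P r t -> P s t.
Hypothesis LD : forall t f g, L t (f + g) = L t f + L t g.
Hypothesis LZ : forall t c f, L t (c *: f) = c *: L t f.
Hypothesis Ln : forall t f, nsq (L t f) = nsq f.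

(** The vectors on which the operators L t tend to the identity as t becomes
    small, P r t meaning that t has size less than r. *)
Definition continuity_vectors : set (L2T mu) := [set f |
  forall e : R, 0 < e -> exists2 r : R, 0 < r & forall t, P r t -> nsq (L t f - f) <= e].

Lemma nsqD_le (f g : L2T mu) : nsq (f + g) <= 2 * (nsq f + nsq g).
Proof.
by have := nsq_ge0 (f - g); rewrite nsqB nsqD; lra.
Qed.

(** Closedness is the three-epsilon argument, the operators being isometries. *)
Lemma continuity_vectors_closed : closed_subspace continuity_vectors.
Proof.
have L0 t : L t 0 = 0 by have := LZ t 0 0; rewrite !scale0r.
have LN t f : L t (- f) = - L t f by rewrite -scaleN1r LZ scaleN1r.
split.
- by move=> e e0; exists 1 => // t _; rewrite L0 subrr nsq0 ltW.
- move=> f g Sf Sg e e0; have e4 : 0 < e / 4 by rewrite divr_gt0.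
  have [r1 r10 h1] := Sf _ e4; have [r2 r20 h2] := Sg _ e4.
  exists (Num.min r1 r2); first by rewrite lt_min r10.
  move=> t Pt; rewrite LD opprD addrACA; apply: le_trans (nsqD_le _ _) _.
  have l1 : Num.min r1 r2 <= r1 by rewrite ge_min lexx.
  have l2 : Num.min r1 r2 <= r2 by rewrite ge_min lexx orbT.
  by have := h1 t (Pmono l1 Pt); have := h2 t (Pmono l2 Pt); lra.
- move=> a f Sf e e0; have a0 : 0 < a ^+ 2 + 1 by rewrite ltr_wpDl ?sqr_ge0.
  have [r r0 hr] := Sf _ (divr_gt0 e0 a0); exists r => // t /hr.
  rewrite LZ -scalerBr nsqZ /sqn /= [0 ^+ 2]expr0n addr0 ler_pdivlMr//.
  by have := nsq_ge0 (L t f - f); nra.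
- move=> g Sg e e0; have e9 : 0 < e / 10 by rewrite divr_gt0.
  have [s Ss gs] := Sg _ e9; have [r r0 hr] := Ss _ e9; exists r => // t /hr Lts.
  have -> : L t g - g = L t (g - s) + ((L t s - s) - (g - s)).
    by rewrite LD LN opprB [L t s - s + _]addrA !subrK addrA subrK.
  apply: le_trans (nsqD_le _ _) _; rewrite Ln.
  have := nsqD_le (L t s - s) (- (g - s)); rewrite nsqN.
  move=> h; exact: three_term_bound h Lts gs.
Qed.

End strong_continuity.

(** When g has the norm of an indicator, ||g - c 1_A||^2 is controlled by a lower
    bound for their inner product alone, which is easy to obtain when g is
    nearly c on most of A. *)
Lemma indicator_continuity d (T : measurableType d) (R : realType)
    (mu : {measure set T -> \bar R}) (A : set T) (mA : measurable A)
    (Aoo : (mu A < +oo)%E) (c : R[i]) (g : L2T mu) (r : R) :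
  nsq g = nsq (cindL2 c mA Aoo) ->
  (r%:E <= \int[mu]_(x in A) (reJ (g x) c)%:E)%E ->
  nsq (g - cindL2 c mA Aoo) <= 2 * (sqn c * fine (mu A) - r).
Proof.
move=> gn rI; rewrite nsqB gn.
have -> : nsq (cindL2 c mA Aoo) = sqn c * fine (mu A).
  have -> : fine (mu A) = \int[mu]_x \1_A x.
    by rewrite /Rintegral integral_indic// setIT.
  transitivity (\int[mu]_x (sqn c * \1_A x)).
    by rewrite nsqE; apply: eq_Rintegral => x _; rewrite sqn_cind.
  apply: RintegralZl => //; apply/integrableP; split.
    exact/measurable_EFinP/measurable_indic.
  under eq_integral do rewrite /= ger0_norm//.
  by rewrite integral_indic// setIT.
suff : r <= ip g (cindL2 c mA Aoo) by lra.
rewrite -lee_fin /ip fineK; last exact/integrable_fin_num/integrable_reJ.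
apply: le_trans rI _; rewrite integral_mkcond le_eqVlt; apply/orP; left; apply/eqP.
apply: eq_integral => x _; rewrite patchE /reJ /cind /= cReM cImM /= indicE.
by case: (x \in A) => /=; congr EFin; ring.
Qed.


(** * Time-frequency shifts *)

Section dotv.
Context {R : realType} {d : nat}.
Implicit Types x y : 'rV[R]_d.

Lemma dotvC x y : dotv x y = dotv y x.
Proof. by apply: eq_bigr => i _; rewrite mulrC. Qed.

Lemma dotvDl x x' y : dotv (x + x') y = dotv x y + dotv x' y.
Proof. by rewrite -big_split/=; apply: eq_bigr => i _; rewrite mxE mulrDl. Qed.

Lemma dotvZl a x y : dotv (a *: x) y = a * dotv x y.
Proof. by rewrite mulr_sumr; apply: eq_bigr => i _; rewrite mxE mulrA. Qed.

Lemma dotvNl x y : dotv (- x) y = - dotv x y.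
Proof. by rewrite -scaleN1r dotvZl mulN1r. Qed.

Lemma dotvDr x y y' : dotv x (y + y') = dotv x y + dotv x y'.
Proof. by rewrite dotvC dotvDl !(dotvC x). Qed.

Lemma dotvZr a x y : dotv x (a *: y) = a * dotv x y.
Proof. by rewrite dotvC dotvZl dotvC. Qed.

Lemma dotvNr x y : dotv x (- y) = - dotv x y.
Proof. by rewrite dotvC dotvNl dotvC. Qed.

Lemma dotv0l y : dotv 0 y = 0.
Proof. by rewrite -(scale0r 0) dotvZl mul0r. Qed.

Lemma dotv_ge0 x : 0 <= dotv x x.
Proof. by apply: sumr_ge0 => i _; rewrite -expr2 sqr_ge0. Qed.

Lemma coord_sqr_le x i : x ord0 i ^+ 2 <= dotv x x.
Proof.
rewrite /dotv (bigD1 i)//= -expr2 lerDl; apply: sumr_ge0 => j _.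
by rewrite -expr2 sqr_ge0.
Qed.

Lemma measurable_dotv y : measurable_fun setT (fun x => dotv y x).
Proof.
apply: measurable_sum => i; apply: measurable_funM => //.
exact: measurable_rV_coord.
Qed.

Lemma dotv_le x y (r M : R) : (forall i, `|x ord0 i| <= r) ->
  (forall i, `|y ord0 i| <= M) -> `|dotv x y| <= r * (M *+ d).
Proof.
move=> xr yM; apply: le_trans (ler_norm_sum _ _ _) _.
have -> : r * (M *+ d) = \sum_(i < d) r * M by rewrite sumr_const card_ord mulrnAr.
by apply: ler_sum => i _; rewrite normrM ler_pM.
Qed.

End dotv.

Definition dotvE := (@dotvDl, @dotvDr, @dotvNl, @dotvNr, @dotvZl, @dotvZr).

Section shifts.
Context {R : realType} {d : nat}.
Local Notation lam := (lebesgue_rV R d).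
Local Notation V := 'rV[R]_d.
Local Notation H := (L2T lam).
Implicit Types (z w : V * V) (f g : H).

Lemma shift_measurable (a : V) : measurable_fun setT (fun t : V => t - a).
Proof.
by have := @measurable_affine R d 1 (- a); under eq_fun do rewrite scale1r.
Qed.

Lemma shift_preserving (a : V) (A : set V) : measurable A -> lam ((fun t : V => t - a) @^-1` A) = lam A.
Proof.
move=> mA; have := @lebesgue_affine R d 1 (- a) A (oner_neq0 _) mA.
by rewrite normr1 expr1n invr1 mul1e; under eq_fun do rewrite scale1r.
Qed.

Lemma opp_measurable : measurable_fun setT (fun t : V => - t).
Proof.
have := @measurable_affine R d (-1) 0.
by under eq_fun do rewrite scaleN1r addr0.
Qed.

Lemma opp_preserving (A : set V) : measurable A -> lam ((fun t : V => - t) @^-1` A) = lam A.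
Proof.
move=> mA; have := @lebesgue_affine R d (-1) 0 A _ mA.
rewrite normrN1 expr1n invr1 mul1e oppr_eq0 oner_eq0 => /(_ isT).
by under eq_fun do rewrite scaleN1r addr0.
Qed.

Definition shift_phase z (t : V) : R[i] :=
  expi (2 * pi * dotv z.2 (t - 2^-1 *: z.1)).

Lemma cmeas_shift_phase z : cmeas (shift_phase z).
Proof.
apply: cmeas_expi; apply: measurable_funM => //.
exact: (measurableT_comp (measurable_dotv z.2) (shift_measurable _)).
Qed.

Lemma sqn_shift_phase z t : sqn (shift_phase z t) = 1.
Proof. exact: sqn_expi. Qed.

(** Symmetric time-frequency shift (Schroedinger representation of the
    Heisenberg group). *)
Definition tfshift z f : H := wcomp (shift_measurable z.1)
  (@shift_preserving z.1) (cmeas_shift_phase z) (sqn_shift_phase z) f.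

Definition parity f : H := wcomp opp_measurable opp_preserving
  (cmeas_cst 1) (fun=> etrans (congr1 _ (esym expi0)) (sqn_expi 0)) f.

Definition symp z w : R := dotv z.2 w.1 - dotv w.2 z.1.

Lemma tfshiftE z f t : tfshift z f t =
  expi (2 * pi * dotv z.2 (t - 2^-1 *: z.1)) * f (t - z.1).
Proof. by []. Qed.

Lemma parityE f t : parity f t = f (- t).
Proof. by rewrite /= mul1r. Qed.

Lemma tfshiftD z f g : tfshift z (f + g) = tfshift z f + tfshift z g.
Proof. exact: wcompD. Qed.

Lemma tfshiftZ z c f : tfshift z (c *: f) = c *: tfshift z f.
Proof. exact: wcompZ. Qed.

Lemma nsq_tfshift z f : nsq (tfshift z f) = nsq f.
Proof. exact: nsq_wcomp. Qed.

Lemma parityD f g : parity (f + g) = parity f + parity g.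
Proof. exact: wcompD. Qed.

Lemma parityZ c f : parity (c *: f) = c *: parity f.
Proof. exact: wcompZ. Qed.

Lemma nsq_parity f : nsq (parity f) = nsq f.
Proof. exact: nsq_wcomp. Qed.

Lemma tfshift_comp z w f :
  tfshift z (tfshift w f) = expi (pi * symp z w) *: tfshift (z + w) f.
Proof.
apply: l2P => t; rewrite l2ZE !tfshiftE !mulrA -!expiD.
congr (expi _ * f _); last by rewrite /= opprD addrA.
by case: z w => [a b] [a' b']; rewrite /symp /= !dotvE; field.
Qed.

Lemma tfshift0 f : tfshift 0 f = f.
Proof.
apply: l2P => t; rewrite tfshiftE /= dotv0l mulr0 expi0 mul1r.
by rewrite subr0.
Qed.

Lemma symp_anti z w : symp w z = - symp z w.
Proof. by rewrite /symp opprB. Qed.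

Lemma sympNr z w : symp z (- w) = - symp z w.
Proof. by rewrite /symp /= !dotvE; ring. Qed.

Lemma sympNl z w : symp (- z) w = - symp z w.
Proof. by rewrite /symp /= !dotvE; ring. Qed.

Lemma sympZl a z w : symp (a *: z) w = a * symp z w.
Proof. by rewrite /symp /= !dotvE; ring. Qed.

Lemma sympxx z : symp z z = 0.
Proof. by rewrite /symp subrr. Qed.

Lemma tfshiftNK z f : tfshift (- z) (tfshift z f) = f.
Proof. by rewrite tfshift_comp sympNl sympxx oppr0 mulr0 expi0 scale1r addNr tfshift0. Qed.

Lemma tfshiftKN z f : tfshift z (tfshift (- z) f) = f.
Proof. by rewrite -{1}(opprK z) tfshiftNK. Qed.

Lemma tfshift2 z f : tfshift z (tfshift z f) = tfshift (2%:R *: z) f.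
Proof. by rewrite tfshift_comp sympxx mulr0 expi0 scale1r scaler_nat mulr2n. Qed.

Lemma tfshift_commute z w f :
  tfshift z (tfshift w f) = expi (2 * pi * symp z w) *: tfshift w (tfshift z f).
Proof.
rewrite !tfshift_comp scalerA -expiD (addrC w) (symp_anti z w).
by congr (expi _ *: _); ring.
Qed.

Lemma ip_tfshift z f g : ip (tfshift z f) (tfshift z g) = ip f g.
Proof. by apply: isometry_ip => *; [exact: tfshiftD|exact: nsq_tfshift]. Qed.

Lemma ip_tfshiftl z f g : ip (tfshift z f) g = ip f (tfshift (- z) g).
Proof. by rewrite -(ip_tfshift z f) tfshiftKN. Qed.

Lemma parityK f : parity (parity f) = f.
Proof. by apply: l2P => t; rewrite !parityE opprK. Qed.

Lemma parity_tfshift z f : parity (tfshift z f) = tfshift (- z) (parity f).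
Proof.
apply: l2P => t; rewrite tfshiftE !parityE tfshiftE /=.
congr (expi _ * f _); last by rewrite opprB addrC.
by rewrite !dotvE; field.
Qed.

(** The Grossmann-Royer operators: point reflections of phase space. *)
Definition refl z f : H := tfshift (2%:R *: z) (parity f).

Lemma reflE z f t : refl z f t =
  expi (2 * pi * dotv (2%:R *: z.2) (t - z.1)) * f (2%:R *: z.1 - t).
Proof. by rewrite tfshiftE parityE /= scalerA mulVf// scale1r opprB. Qed.

Lemma reflD z f g : refl z (f + g) = refl z f + refl z g.
Proof. by rewrite /refl parityD tfshiftD. Qed.

Lemma reflZ z c f : refl z (c *: f) = c *: refl z f.
Proof. by rewrite /refl parityZ tfshiftZ. Qed.

Lemma nsq_refl z f : nsq (refl z f) = nsq f.
Proof. by rewrite nsq_tfshift nsq_parity. Qed.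

Lemma reflK z f : refl z (refl z f) = f.
Proof. by rewrite /refl parity_tfshift parityK tfshiftKN. Qed.

Lemma ip_refl z f g : ip (refl z f) g = ip f (refl z g).
Proof.
rewrite -[in LHS](reflK z g); apply: isometry_ip => *; [exact: reflD|exact: nsq_refl].
Qed.

(** A reflection turns a shift into its inverse.  Hence the interaction of D_w f
    with D_{-w} g is that of f with g up to a phase, however large w is, while
    D_w f interacts with itself like two profiles that are 2 w apart: profiles
    that escape matter in opposite pairs. *)
Lemma refl_tfshift z w f : refl z (tfshift w f) =
  expi (4 * pi * symp w z) *: tfshift (- w) (refl z f).
Proof.
rewrite /refl parity_tfshift tfshift_commute; congr (expi _ *: _).
by rewrite sympNr sympZl (symp_anti w); ring.
Qed.

Definition small (r : R) z := (forall i, `|z.1 ord0 i| < r) /\ (forall i, `|z.2 ord0 i| < r).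

Lemma cvg_bigprod (I : Type) (s : seq I) (F : I -> R -> R) (l : I -> R)
    (X : set_system R) : Filter X -> (forall i, F i r @[r --> X] --> l i) ->
  (fun r => \prod_(i <- s) F i r) @ X --> \prod_(i <- s) l i.
Proof.
move=> FX Fl; elim: s => [|i s IHs].
  by rewrite big_nil; under eq_fun do rewrite big_nil; exact: cvg_cst.
by rewrite big_cons; under eq_fun do rewrite big_cons; exact: cvgM.
Qed.

Lemma prod_width_cvg (c : 'I_d -> R) (e : R) : 0 < e -> exists2 r, 0 < r &
  \prod_(i < d) Num.max 0 (c i) - e <= \prod_(i < d) Num.max 0 (c i - 2 * r).
Proof.
move=> e0.
have : (fun r : R => \prod_(i < d) Num.max 0 (c i - 2 * r)) @ 0^'+ -->
    \prod_(i < d) Num.max 0 (c i - 2 * 0).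
  apply: cvg_bigprod => i; rewrite maxr_absE; under eq_fun do rewrite maxr_absE.
  have h : (c i - 2 * r) @[r --> 0^'+] --> c i - 2 * 0.
    apply: cvgB; first exact: cvg_cst.
    apply: cvgM; first exact: cvg_cst.
    by apply: cvg_at_right_filter; exact: cvg_id.
  apply: cvgM; last exact: cvg_cst.
  apply: cvgD; first by apply: cvgD => //; exact: cvg_cst.
  by apply: cvg_norm; apply: cvgB => //; exact: cvg_cst.
under eq_bigr do rewrite mulr0 subr0.
move=> /cvgrPdist_le /(_ e e0) h.
have [r [r0 hr]] : exists r, 0 < r /\ `|\prod_(i < d) Num.max 0 (c i) -
    \prod_(i < d) Num.max 0 (c i - 2 * r)| <= e.
  near (0 : R)^'+ => r; exists r; split; first by near: r; exact: nbhs_right_gt.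
  by near: r.
by exists r => //; move: hr; rewrite ler_norml => /andP[_]; lra.
Unshelve. all: by end_near. Qed.

Lemma box_arith (s L eta b : R) : 0 <= s -> 0 <= L -> 0 < eta -> eta <= 1 ->
  L - eta <= b -> 2 * (s * L - s * (1 - eta) * b) <= 2 * (s + 1) * (1 + L) * eta.
Proof.
move=> s0 L0 eta0 eta1 LB.
have : s * ((1 - eta) * (L - eta)) <= s * ((1 - eta) * b).
  by rewrite ler_wpM2l// ler_wpM2l// subr_ge0.
have : 0 <= s * (eta * eta) by rewrite !mulr_ge0 ?(ltW eta0).
have : 0 <= (1 + L) * eta by rewrite mulr_ge0 ?addr_ge0 ?(ltW eta0).
lra.
Qed.

(** On the indicator of a box A the displacement of A costs little measure, and
    the modulation is almost trivial on A since A is bounded. *)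
Lemma tfshift_box_continuity (u v : 'I_d -> R) (c : R[i]) (mA : measurable (obox u v))
  (Aoo : (lam (obox u v) < +oo)%E) : continuity_vectors small tfshift (cindL2 c mA Aoo).
Proof.
move=> e e0; pose L : R := \prod_(i < d) Num.max 0 (v i - u i).
have L0 : 0 <= L by apply: prodr_ge0 => i _; rewrite le_max lexx.
have LE : fine (lam (obox u v)) = L by rewrite lebesgue_obox.
pose eta := Num.min 1 (e / (2 * (sqn c + 1) * (1 + L))).
have c1 : 0 < sqn c + 1 by rewrite ltr_wpDl ?sqn_ge0.
have eta0 : 0 < eta by rewrite lt_min ltr01 divr_gt0// mulr_gt0 ?mulr_gt0// ltr_pwDl.
have eta1 : eta <= 1 by rewrite ge_min lexx.
have etae : 2 * (sqn c + 1) * (1 + L) * eta <= e.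
  rewrite mulrC -ler_pdivlMr; first by rewrite ge_min lexx orbT.
  by rewrite mulr_gt0 ?mulr_gt0// ltr_pwDl.
have [r1 r10 Lr] := prod_width_cvg (fun i => v i - u i) eta0.
have [r2 r20 cosr] : exists2 r : R, 0 < r & forall x, `|x| < r -> 1 - eta <= cos x.
  have /cvgrPdist_le /(_ _ eta0) := @continuous_cos R 0.
  rewrite cos0 => /nbhs_ballP[r /= r0 hr]; exists r => // x xr.
  have := hr x; rewrite /ball/= sub0r normrN => /(_ xr).
  by rewrite ler_norml => /andP[_]; lra.
pose M : R := 1 + \sum_i (`|u i| + `|v i|).
have M0 : 0 < M by rewrite ltr_pwDl// sumr_ge0// => i _; rewrite addr_ge0.
pose K := 2 * pi * ((M + 1) *+ d) + 1.
have K0 : 0 < K.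
  by rewrite ltr_wpDl// mulr_ge0 ?mulr_ge0 ?pi_ge0// mulrn_wge0// addr_ge0// ltW.
pose r : R := Num.min (Num.min r1 1) (r2 / K).
have r0 : 0 < r by rewrite !lt_min r10 ltr01/= divr_gt0.
have rr1 : r <= r1 by rewrite !ge_min lexx.
have r1' : r <= 1 by rewrite !ge_min lexx orbT.
have rK : r * K <= r2 by rewrite -ler_pdivlMr// !ge_min lexx !orbT.
exists r => // z [za zb].
pose B := obox (fun i => Num.max (u i) (u i + z.1 ord0 i))
               (fun i => Num.min (v i) (v i + z.1 ord0 i)).
have mB : measurable B by exact: measurable_obox.
have BA : B `<=` obox u v.
  move=> x Bx i; have := Bx i; rewrite /= !in_itv/= gt_max le_min.
  by move=> /andP[/andP[-> _] /andP[-> _]].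
have Bs x : B x -> obox u v (x - z.1).
  move=> Bx i; have := Bx i; rewrite /= !in_itv/= !mxE gt_max le_min.
  by rewrite ltrBrDr lerBlDr => /andP[/andP[_ ->] /andP[_ ->]].
have LB : L - eta <= fine (lam B).
  rewrite lebesgue_obox /=; apply: le_trans Lr _; apply: ler_prod => i _.
  rewrite le_max lexx /= ge_max le_max lexx/= le_max; apply/orP; right.
  have := za i; rewrite ltr_norml => /andP[h1 h2].
  by case: (lerP (u i)) => ?; case: (lerP (v i)) => ?; lra.
have LB0 : 0 <= fine (lam B) by rewrite fine_ge0.
have theta x : obox u v x -> 1 - eta <= cos (2 * pi * dotv z.2 (x - 2^-1 *: z.1)).
  move=> xA; apply: cosr; apply: lt_le_trans rK.
  rewrite normrM ger0_norm ?mulr_ge0 ?pi_ge0//.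
  have := @dotv_le R d z.2 (x - 2^-1 *: z.1) r (M + 1) (fun i => ltW (zb i)).
  move=> /(_ _)/(ler_wpM2l (mulr_ge0 (ler0n _ 2) (pi_ge0 R))) h.
  apply: le_lt_trans (h _) _ => [i|]; last first.
    rewrite (_ : r * K = 2 * pi * (r * ((M + 1) *+ d)) + r) ?ltrDl//.
    by rewrite /K; ring.
  rewrite !mxE; have := xA i; rewrite /= in_itv/= => /andP[h1 h2].
  have h3 : `|u i| + `|v i| <= M - 1.
    rewrite /M [1 + _]addrC addrK (bigD1 i)//= lerDl sumr_ge0//.
  have := za i; have := ler_norm (v i); have := ler_norm (- u i); rewrite normrN.
  have := normr_ge0 (u i); have := normr_ge0 (v i).
  rewrite ltr_norml => ? ? ? ? /andP[? ?].
  by apply/ler_normlP; split; lra.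
have pt x : obox u v x ->
    sqn c * (1 - eta) * \1_B x <= reJ (tfshift z (cindL2 c mA Aoo) x) c.
  move=> xA; rewrite tfshiftE /= /cind /reJ /expi.
  set th := _ * dotv _ _; have tht := theta _ xA; rewrite -/th in tht.
  rewrite (_ : _ + _ = sqn c * cos th * \1_(obox u v) (x - z.1)); last first.
    by rewrite /sqn !cReM !cImM /=; case: (c) => ca cb /=; ring.
  rewrite -!mulrA ler_wpM2l ?sqn_ge0//.
  have [xB|xB] := pselect (B x).
    by rewrite !indicE !mem_set// ?mulr1//; exact: Bs.
  rewrite [\1_B x]indicE memNset// mulr0 mulr_ge0//.
  by apply: le_trans tht; rewrite subr_ge0.
apply: le_trans (@indicator_continuity _ _ _ _ _ mA Aoo c _
    (sqn c * (1 - eta) * fine (lam B)) _ _) _.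
- by rewrite nsq_tfshift.
- have s0 : 0 <= sqn c * (1 - eta) by rewrite mulr_ge0 ?sqn_ge0// subr_ge0.
  have Boo : (lam B < +oo)%E by rewrite lebesgue_obox ltry.
  rewrite EFinM fineK ?ge0_fin_numE//.
  have <- : (\int[lam]_(x in obox u v) (\1_B x)%:E = lam B)%E.
    by rewrite integral_indic// setIidl.
  rewrite -ge0_integralZl_EFin//; last exact/measurable_EFinP/measurable_indic.
  apply: ge0_le_integral => //.
  + by move=> x _; rewrite -EFinM lee_fin mulr_ge0.
  + by apply: measurable_funeM; exact/measurable_EFinP/measurable_indic.
  + apply/measurable_EFinP; apply: measurable_funTS; rewrite /reJ.
    have [m1 m2] := l2_cmeas (tfshift z (cindL2 c mA Aoo)).
    by apply: measurable_funD; apply: measurable_funM.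
- by rewrite LE; apply: le_trans etae; apply: box_arith => //; exact: sqn_ge0.
Qed.

Lemma tfshift_continuity f : continuity_vectors small tfshift f.
Proof.
move: f; apply: (@L2_dense _ _ _ lam (@oboxes R d) (@ocube R d)).
- exact: measurable_rVE.
- exact: oboxes_setI.
- by move=> k; do 2 eexists.
- exact: ocube_cover.
- exact: lebesgue_ocube_lty.
- apply: continuity_vectors_closed.
  + by move=> r s z rs [h1 h2]; split=> i; [apply: lt_le_trans (h1 i) rs|apply: lt_le_trans (h2 i) rs].
  + exact: tfshiftD.
  + exact: tfshiftZ.
  + exact: nsq_tfshift.
- by move=> c A mA Aoo [u [v AE]]; subst A; exact: tfshift_box_continuity.
Qed.

(** The witness is w = J y / (2 |y|^2), where J is the symplectic rotation. *)
Lemma symp_dual (y : V * V) (r : R) : 0 < r ->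
  1 / r ^+ 2 < dotv y.1 y.1 + dotv y.2 y.2 -> exists2 w, small r w & symp y w = 2^-1.
Proof.
set N := _ + _ => r0 Ny.
have N0 : 0 < N by apply: lt_trans Ny; rewrite divr_gt0 ?exprn_gt0.
exists ((2 * N)^-1 *: y.2, - ((2 * N)^-1 *: y.1)); last first.
  rewrite /symp /= !dotvE opprK -mulrDr [dotv y.2 _ + _]addrC -/N.
  by field; rewrite gt_eqF.
have wsmall i (x : V) : dotv x x <= N -> `|((2 * N)^-1 *: x) ord0 i| < r.
  move=> xN; rewrite mxE -(ltr_pXn2r (n := 2))// ?nnegrE ?normr_ge0 ?(ltW r0)//.
  rewrite real_normK ?num_real// exprMn.
  have : x ord0 i ^+ 2 <= N by apply: le_trans xN; exact: coord_sqr_le.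
  move=> /(ler_wpM2l (exprn_ge0 2 (ltW _))) h.
  have i0 : 0 < (2 * N)^-1 by rewrite invr_gt0 mulr_gt0.
  apply: le_lt_trans (h _ i0) _.
  have -> : (2 * N)^-1 ^+ 2 * N = (4 * N)^-1 by field; rewrite gt_eqF.
  rewrite invf_plt ?posrE ?mulr_gt0 ?exprn_gt0// -div1r.
  by apply: lt_le_trans Ny _; rewrite ler_peMl ?ler1n// ltW.
have dN1 : dotv y.1 y.1 <= N by rewrite lerDl dotv_ge0.
have dN2 : dotv y.2 y.2 <= N by rewrite lerDr dotv_ge0.
by split=> i /=; [|rewrite mxE normrN]; exact: wsmall.
Qed.

(** If w pairs with y to 1/2, then the shifts by w and by y anticommute, so that
    2 <D_y f, g> = <D_y (f - D_{-w} f), g> + <D_y D_{-w} f, g - D_{-w} g>.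
    Such a w can be taken close to 0 when y is large, and then the right-hand
    side is small by the strong continuity of the shifts. *)
Lemma tfshift_vanish f g (e : R) : 0 < e -> exists N : R, forall y c,
  N < dotv y.1 y.1 + dotv y.2 y.2 -> sqn c = 1 -> `|ip (c *: tfshift y f) g| <= e.
Proof.
move=> e0; pose q := e / (1 + nrm f + nrm g).
have den : 0 < 1 + nrm f + nrm g by rewrite -addrA ltr_pwDl ?addr_ge0 ?nrm_ge0.
have q0 : 0 < q by rewrite divr_gt0.
have [r1 r10 h1] := tfshift_continuity f (exprn_gt0 2 q0).
have [r2 r20 h2] := tfshift_continuity g (exprn_gt0 2 q0).
pose r : R := Num.min r1 r2; have r0 : 0 < r by rewrite lt_min r10.
exists (1 / r ^+ 2) => y c Ny c1.
have [w [w1 w2] yw] := symp_dual r0 Ny.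
have sm (s : R) : r <= s -> small s (- w).
  by move=> rs; split=> i; rewrite mxE normrN; apply: lt_le_trans rs.
have f1 := h1 _ (sm r1 (_ : r <= r1)); have g1 := h2 _ (sm r2 (_ : r <= r2)).
have {}f1 : nrm (tfshift (- w) f - f) <= q.
  by rewrite -(ger0_norm (ltW q0)) -sqrtr_sqr ler_wsqrtr// f1// ge_min lexx.
have {}g1 : nrm (tfshift (- w) g - g) <= q.
  by rewrite -(ger0_norm (ltW q0)) -sqrtr_sqr ler_wsqrtr// g1// ge_min lexx orbT.
have Dn z k : nrm (tfshift z k) = nrm k by rewrite /nrm nsq_tfshift.
have cn k : nrm (c *: k) = nrm k by rewrite nrmZ normc_sqrt c1 sqrtr1 mul1r.
have E : ip (c *: tfshift y f) g =
    - ip (c *: tfshift y (tfshift (- w) f)) (tfshift (- w) g).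
  rewrite -ip_tfshiftl tfshiftZ -[in LHS](tfshiftKN w f) tfshift_commute yw.
  rewrite (_ : 2 * pi * 2^-1 = pi); last by field.
  have -> : expi pi = -1 :> R[i] by apply: eqcP; rewrite /= ?cospi ?sinpi ?oppr0.
  by rewrite scaleN1r scalerN ipNl.
have E2 : 2 * ip (c *: tfshift y f) g =
    - ip (c *: tfshift y (tfshift (- w) f - f)) g
    - ip (c *: tfshift y (tfshift (- w) f)) (tfshift (- w) g - g).
  rewrite [in LHS]mulr2n mulrDl mul1r {2}E tfshiftD scalerDr ipDl ipDr.
  rewrite -(scaleN1r f) tfshiftZ scaleN1r scalerN ipNl ipNr; ring.
have b1 : `|ip (c *: tfshift y (tfshift (- w) f - f)) g| <= q * nrm g.
  by apply: le_trans (CS _ _) _; rewrite cn Dn ler_wpM2r ?nrm_ge0.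
have b2 : `|ip (c *: tfshift y (tfshift (- w) f)) (tfshift (- w) g - g)| <= nrm f * q.
  by apply: le_trans (CS _ _) _; rewrite cn !Dn ler_wpM2l ?nrm_ge0.
have qe : q * (1 + nrm f + nrm g) = e by rewrite /q divfK// gt_eqF.
have := le_trans (ler_normB _ _) (lerD b1 b2).
rewrite -[X in `|X|]addrC => bb.
have : `|2 * ip (c *: tfshift y f) g| <= q * nrm g + nrm f * q.
  rewrite E2; apply: le_trans (ler_normB _ _) _.
  by rewrite normrN lerD.
rewrite normrM ger0_norm//.
have := normr_ge0 (ip (c *: tfshift y f) g); lra.
Qed.

End shifts.


(** * Integrals of products of functions of one variable *)

Section cint_product.
Context {d1 d2} {T1 : measurableType d1} {T2 : measurableType d2} {R : realType}.
Variables (m1 : {sigma_finite_measure set T1 -> \bar R})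
          (m2 : {sigma_finite_measure set T2 -> \bar R}).

Lemma cint_prod12 (F : T1 * T2 -> R[i]) : cintegrable (m1 \x m2)%E F ->
  cint (m1 \x m2)%E F = cint m1 (fun x => cint m2 (fun y => F (x, y))).
Proof.
move=> [F1 F2].
have key (u : T1 * T2 -> R) : (m1 \x m2)%E.-integrable setT (fun z => (u z)%:E) ->
    \int[(m1 \x m2)%E]_z u z = \int[m1]_x (\int[m2]_y u (x, y)).
  move=> ui; rewrite /Rintegral -(integral12_prod_meas1 ui); congr fine.
  apply: ae_eq_integral => //.
  - exact: (measurable_fubini_F ui).
  - apply/measurable_EFinP; apply: measurableT_comp; first exact: fine_measurable.
    exact: (measurable_fubini_F ui).
  - apply: filterS (ae_integrable1 ui) => x xi _.
    by rewrite fineK//; exact: integrable_fin_num.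
by apply: eqcP; rewrite /= key.
Qed.

Lemma cint_prodM (f : T1 -> R[i]) (g : T2 -> R[i]) :
  cintegrable m1 f -> cintegrable m2 g ->
  cintegrable (m1 \x m2)%E (fun z => f z.1 * g z.2) /\
  cint (m1 \x m2)%E (fun z => f z.1 * g z.2) = cint m1 f * cint m2 g.
Proof.
move=> fi gi; have mf := cintegrable_cmeas fi; have mg := cintegrable_cmeas gi.
have mfg : cmeas (fun z : T1 * T2 => f z.1 * g z.2).
  by apply: cmeasM; [apply: cmeas_comp mf _ | apply: cmeas_comp mg _].
have fgi : cintegrable (m1 \x m2)%E (fun z => f z.1 * g z.2).
  apply/cintegrableP => //; rewrite fubini_tonelli1//; last 2 first.
  - exact/measurable_EFinP/measurable_normc.
  - by move=> z; rewrite lee_fin normc_ge0.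
  rewrite /fubini_F /=.
  under eq_integral do under eq_integral do rewrite normcM EFinM.
  under eq_integral => x _.
    rewrite ge0_integralZl_EFin ?normc_ge0//; last 2 first.
    - by move=> y _; rewrite lee_fin normc_ge0.
    - exact/measurable_EFinP/measurable_normc.
    over.
  have goo := (cintegrableP _ mg).1 gi; have foo := (cintegrableP _ mf).1 fi.
  rewrite ge0_integralZr//; last 3 first.
  - exact/measurable_EFinP/measurable_normc.
  - by move=> x _; rewrite lee_fin normc_ge0.
  - by apply: integral_ge0 => y _; rewrite lee_fin normc_ge0.
  rewrite lte_mul_pinfty// ?ge0_fin_numE//; apply: integral_ge0 => x _;
    by rewrite lee_fin normc_ge0.
split=> //; rewrite cint_prod12//=.
under eq_cint do rewrite cintZ//.
by under eq_cint do rewrite mulrC; rewrite cintZ// mulrC.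
Qed.

End cint_product.

Lemma cmeas_prod d (T : measurableType d) (R : realType) (I : Type) (s : seq I)
    (F : I -> T -> R[i]) :
  (forall i, cmeas (F i)) -> cmeas (fun x => \prod_(i <- s) F i x).
Proof.
move=> mF; elim: s => [|i s IHs].
  by under eq_fun do rewrite big_nil; exact: cmeas_cst.
by under eq_fun do rewrite big_cons; exact: cmeasM.
Qed.

(** Induction on n, the measure on n.+1 coordinates being the image under cons_rV
    of the product of the measures on the first one and on the others. *)
Lemma cint_rV_prod (R : realType) n (G : 'I_n -> R -> R[i]) :
  (forall i, cintegrable lebesgue_measure (G i)) ->
  cintegrable (lebesgue_rV R n) (fun x => \prod_(i < n) G i (x ord0 i)) /\
  cint (lebesgue_rV R n) (fun x => \prod_(i < n) G i (x ord0 i)) =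
  \prod_(i < n) cint lebesgue_measure (G i).
Proof.
elim: n G => [|n IHn] G Gi.
  have E : (fun x : 'rV[R]_0 => \prod_(i < 0) G i (x ord0 i)) = fun=> 1.
    by apply/funext => x; rewrite big_ord0.
  rewrite E big_ord0; split.
    split => /=; apply/integrableP; split; try exact: measurable_cst;
    by rewrite integral_cst//= ?normr1 ?normr0 ?mul0e ?ltry// diracT mul1e ltry.
  have T0 : lebesgue_rV R 0 setT = 1%E by rewrite /= diracT.
  have T1 : fine (lebesgue_rV R 0 setT) = 1 by rewrite T0.
  apply: eqcP.
    apply: etrans (etrans (congr1 ( *%R 1) T1) (mulr1 1)).
    exact: (@Rintegral_cst _ _ _ (lebesgue_rV R 0) setT measurableT 1).
  apply: etrans (mul0r _).
  exact: (@Rintegral_cst _ _ _ (lebesgue_rV R 0) setT measurableT 0).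
pose F (x : 'rV[R]_n.+1) := \prod_(i < n.+1) G i (x ord0 i).
have [ci cE] := IHn (fun i => G (lift ord0 i)) (fun i => Gi (lift ord0 i)).
have [pi_ pE] := cint_prodM (Gi ord0) ci.
have FE z : F (cons_rV z) = G ord0 z.1 * \prod_(i < n) G (lift ord0 i) (z.2 ord0 i).
  rewrite /F big_ord_recl; have := cons_rVK z; rewrite /uncons_rV; case: z => x v /= [-> E].
  congr (_ * _); apply: eq_bigr => i _; congr (G _ _).
  by rewrite -[in RHS]E mxE.
have mF : cmeas F.
  apply: cmeas_prod => i; apply: (cmeas_comp (cintegrable_cmeas (Gi i))).
  exact: measurable_rV_coord.
have Fi : cintegrable (lebesgue_rV R n.+1) F.
  apply/cintegrableP => //.
  have := (cintegrableP _ (cintegrable_cmeas pi_)).1 pi_.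
  under eq_integral do rewrite -FE.
  rewrite -(@ge0_integral_pushforward _ _ _ _ _ _ (@measurable_cons_rV R n) _ setT
    (fun x => (normc (F x))%:E))//.
  - exact/measurable_EFinP/measurable_normc.
  - by move=> x _; rewrite lee_fin normc_ge0.
split=> //; rewrite big_ord_recl -cE -pE.
have := @cint_comp _ _ _ _ R (lebesgue_measure \x lebesgue_rV R n)%E
   (lebesgue_rV R n.+1) (@cons_rV R n) 1 (@measurable_cons_rV R n) ler01 F _ Fi.
move=> /(_ _)[|_]; first by move=> A mA; rewrite mul1e.
rewrite (_ : 1%:C%C = 1)// mul1r => <-.
by apply: eq_cint => z; rewrite FE.
Qed.


(** * The Fourier transform of exp(-|x|) *)

Section laplace.
Context {R : realType}.
Local Notation leb := (@lebesgue_measure R).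
Implicit Types c x : R.

Definition laplace x : R := expR (- `|x|).

Lemma continuous_laplace : continuous laplace.
Proof.
move=> x; apply: continuous_comp; last exact: continuous_expR.
by apply: cvgN; exact: norm_continuous.
Qed.

Lemma laplace_gt0 x : 0 < laplace x. Proof. exact: expR_gt0. Qed.

Lemma continuous_cosM c : continuous (fun x => cos (c * x)).
Proof.
move=> x; apply: continuous_comp; last exact: continuous_cos.
by apply: continuousM; [exact: cst_continuous|].
Qed.

(** Adding 1 to the cosine keeps the integrand nonnegative, so that its improper
    integral is given by an explicit primitive. *)
Lemma integral_laplace_cos1 c : (\int[leb]_x (laplace x * (1 + cos (c * x)))%:E =
  (2 + 2 / (1 + c ^+ 2))%:E)%E.
Proof.
have cos1 x : 0 <= 1 + cos x by have := cos_geN1 x; lra.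
have c0 : 1 + c ^+ 2 != 0 by rewrite gt_eqF// ltr_pwDl ?sqr_ge0.
rewrite ge0_symfun_integralT; last 3 first.
- by move=> x; rewrite mulr_ge0 ?cos1// ltW// laplace_gt0.
- move=> x; apply: continuousM; first exact: continuous_laplace.
  by apply: cvgD; [exact: cvg_cst|exact: continuous_cosM].
- by move=> x /=; rewrite /laplace normrN mulrN cosN.
rewrite (_ : [set x | _] = `[0, +oo[%classic); last first.
  by apply/seteqP; split => x/=; rewrite in_itv/= andbT.
pose F x : R := expR (- x) * ((c * sin (c * x) - cos (c * x)) / (1 + c ^+ 2) - 1).
transitivity (2%:E * \int[leb]_(x in `[0%R, +oo[) (expR (- x) * (1 + cos (c * x)))%:E)%E.
  congr (_ * _)%E; apply: eq_integral => x; rewrite inE/= in_itv/= andbT => x0.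
  by rewrite /laplace ger0_norm.
have dF x : is_derive x 1 F (expR (- x) * (1 + cos (c * x))).
  rewrite /F; apply: is_derive_eq.
  by rewrite /GRing.scale /=; field.
rewrite (@ge0_continuous_FTC2y _ _ F 0 0).
- rewrite /F oppr0 expR0 mulr0 sin0 cos0 -EFinB -EFinM; congr EFin.
  by field.
- by move=> x x0; rewrite mulr_ge0 ?expR_ge0.
- apply: continuous_subspaceT => x; apply: cvgM.
    apply: continuous_comp; last exact: continuous_expR.
    exact: opp_continuous.
  by apply: cvgD; [exact: cvg_cst|exact: continuous_cosM].
- pose K : R := (`|c| + 1) / (1 + c ^+ 2) + 1.
  have c1 : 0 < 1 + c ^+ 2 by rewrite ltr_pwDl ?sqr_ge0.
  have K0 : 0 < K.
    by rewrite ltr_wpDl// divr_ge0// (ltW c1).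
  have gK x : `|(c * sin (c * x) - cos (c * x)) / (1 + c ^+ 2) - 1| <= K.
    apply: le_trans (ler_normB _ _) _; rewrite normr1 lerD2r normrM.
    rewrite normfV (gtr0_norm c1) ler_pM2r ?invr_gt0//.
    apply: le_trans (ler_normB _ _) _; rewrite normrM; apply: lerD.
      by rewrite ler_piMr// ler_norml sin_geN1 sin_le1.
    by rewrite ler_norml cos_geN1 cos_le1.
  have /cvgrPdist_le h := @cvgr_expR R.
  apply/cvgrPdist_le => e e0; have := h _ (divr_gt0 e0 K0); apply: filterS => x.
  rewrite !sub0r !normrN /F normrM ler_pdivlMr// => hx; apply: le_trans hx.
  by rewrite ler_wpM2l.
- by move=> x _; exact: ex_derive.
- apply: cvg_at_right_filter; apply: differentiable_continuous.
  by apply/derivable1_diffP; exact: ex_derive.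
- by move=> x _; rewrite derive1E; exact: derive_val.
Qed.

Lemma measurable_opp1 : measurable_fun setT (-%R : R -> R).
Proof. by apply: continuous_measurable_fun; exact: opp_continuous. Qed.

Lemma lebesgue_opp (A : set (measurableTypeR R)) : measurable A -> leb (-%R @^-1` A) = leb A.
Proof.
move=> mA.
have mo : @measurable_fun _ _ (measurableTypeR R) (measurableTypeR R) setT -%R.
  exact: measurable_opp1.
pose f : {mfun (measurableTypeR R) >-> (measurableTypeR R)} :=
  HB.pack (-%R : R -> R) (isMeasurableFun.Build _ _ _ _ _ mo).
apply/esym; apply: (@lebesgue_measure_unique R (pushforward leb f)) => //.
move=> _ [[a b] _ <-]; rewrite /= /pushforward.
have -> : -%R @^-1` `]a, b]%classic = `[- b, - a[%classic :> set R.
  by apply/seteqP; split=> x /=; rewrite !in_itv/= lerNl ltrNr andbC.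
by rewrite !lebesgue_measure_itv/= !lte_fin ltrN2 -!EFinB opprK addrC.
Qed.

Lemma cintegrable_laplace_expi c :
  cintegrable leb (fun x => (laplace x)%:C%C * expi (c * x)).
Proof.
have lapi : leb.-integrable setT (fun x => (2 * laplace x)%:E).
  have := integral_laplace_cos1 0.
  under eq_integral do rewrite mul0r cos0 mulrC.
  move=> h; apply/integrableP; split.
    apply/measurable_EFinP; apply: measurable_funM => //.
    apply: continuous_measurable_fun; exact: continuous_laplace.
  under eq_integral do rewrite gee0_abs ?lee_fin ?mulr_ge0 ?(ltW (laplace_gt0 _))//.
  by rewrite h ltry.
apply: (le_cintegrable _ lapi).
  apply: cmeasM; last by apply: cmeas_expi; exact: measurable_funM.
  split=> /=; last exact: measurable_cst.
  apply: continuous_measurable_fun; exact: continuous_laplace.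
move=> x; rewrite normcM normc_expi mulr1 normc_sqrt /sqn /= expr0n addr0.
by rewrite sqrtr_sqr ger0_norm ?(ltW (laplace_gt0 _))//; have := laplace_gt0 x; lra.
Qed.

Lemma cint_laplace_expi c :
  cint leb (fun x => (laplace x)%:C%C * expi (c * x)) = (2 / (1 + c ^+ 2))%:C%C.
Proof.
have ci := cintegrable_laplace_expi.
have [|_ E] := @cint_comp _ _ (measurableTypeR R) (measurableTypeR R) R leb leb
    -%R 1 measurable_opp1 ler01 _ _ (ci c).
  by move=> A mA; rewrite mul1e; exact: lebesgue_opp mA.
have {E} : cint leb (fun x => (laplace x)%:C%C * expi (c * x)) =
    conjc (cint leb (fun x => (laplace x)%:C%C * expi (c * x))).
  rewrite -cintJ//; rewrite (_ : 1%:C%C = 1)// mul1r in E; rewrite -E.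
  apply: eq_cint => x; rewrite /laplace normrN mulrN /expi cosN sinN.
  by apply: eqcP; rewrite ?cReJ ?cImJ ?cReM ?cImM /=; ring.
set K := cint _ _ => KE; apply: eqcP.
  have h (a : R) : \int[leb]_x (laplace x * cos (a * x)) =
      Re (cint leb (fun x => (laplace x)%:C%C * expi (a * x))).
    by apply: eq_Rintegral => x _; rewrite cReM /= mul0r subr0.
  have hi (a : R) : leb.-integrable setT (fun x => (laplace x * cos (a * x))%:E).
    have [+ _] := ci a; apply: eq_integrable => // x _.
    by rewrite cReM /= mul0r subr0.
  have := integral_laplace_cos1 c => /(congr1 fine).
  rewrite -/(Rintegral leb setT (fun x => laplace x * (1 + cos (c * x)))) /=.
  under eq_Rintegral do rewrite mulrDr mulr1.
  have i0 : leb.-integrable setT (EFin \o laplace).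
    by have := hi 0; apply: eq_integrable => // x _; rewrite /= mul0r cos0 mulr1.
  rewrite (RintegralD measurableT i0 (hi c)).
  rewrite h -/K => e1.
  have := integral_laplace_cos1 0 => /(congr1 fine).
  rewrite -/(Rintegral leb setT (fun x => laplace x * (1 + cos (0 * x)))) /=.
  under eq_Rintegral do rewrite mulrDr mulr1 mul0r cos0 mulr1.
  rewrite (RintegralD measurableT i0 i0) expr0n addr0 divr1.
  by move: e1; set J := Rintegral _ _ _; set X := 2 / _ => /=; lra.
by move/(congr1 (fun a => Im a)) : KE; rewrite cImJ /=; lra.
Qed.

End laplace.


(** * The Plancherel identity *)

Section measurable_rV_maps.
Context {d0} {T : measurableType d0} {R : realType} {d : nat}.
Local Notation V := 'rV[R]_d.
Implicit Types f g : T -> V.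

Lemma measurable_rVD f g : measurable_fun setT f -> measurable_fun setT g ->
  measurable_fun setT (fun x => f x + g x).
Proof.
move=> /measurable_fun_rVP mf /measurable_fun_rVP mg; apply/measurable_fun_rVP => i.
by under eq_fun do rewrite mxE; exact: measurable_funD.
Qed.

Lemma measurable_rVZ a f : measurable_fun setT f -> measurable_fun setT (fun x => a *: f x).
Proof.
move=> /measurable_fun_rVP mf; apply/measurable_fun_rVP => i.
by under eq_fun do rewrite mxE; exact: measurable_funM.
Qed.

Lemma measurable_rVB f g : measurable_fun setT f -> measurable_fun setT g ->
  measurable_fun setT (fun x => f x - g x).
Proof.
move=> mf mg; apply: measurable_rVD => //.
by under eq_fun do rewrite -scaleN1r; exact: measurable_rVZ.
Qed.

Lemma measurable_dotv2 f g : measurable_fun setT f -> measurable_fun setT g ->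
  measurable_fun setT (fun x => dotv (f x) (g x)).
Proof.
move=> /measurable_fun_rVP mf /measurable_fun_rVP mg.
by apply: measurable_sum => i; exact: measurable_funM.
Qed.

Lemma cmeas_real (f : T -> R) : measurable_fun setT f -> cmeas (fun x => (f x)%:C%C).
Proof. by move=> mf; split. Qed.

End measurable_rV_maps.

Lemma normc_real (R : realType) (a : R) : normc a%:C%C = `|a|.
Proof. by rewrite normc_sqrt /sqn /= expr0n addr0 sqrtr_sqr. Qed.

Lemma expi_sum (R : realType) (I : Type) (s : seq I) (h : I -> R) :
  \prod_(i <- s) expi (h i) = expi (\sum_(i <- s) h i).
Proof.
elim: s => [|i s IHs]; first by rewrite !big_nil expi0.
by rewrite !big_cons IHs expiD.
Qed.

Lemma cint_fubini_bound d1 d2 (T1 : measurableType d1) (T2 : measurableType d2)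
    (R : realType) (m1 : {sigma_finite_measure set T1 -> \bar R})
    (m2 : {sigma_finite_measure set T2 -> \bar R}) (F : T1 * T2 -> R[i])
    (a : T1 -> R) (b : T2 -> R) :
  cmeas F -> m1.-integrable setT (fun x => (a x)%:E) ->
  m2.-integrable setT (fun y => (b y)%:E) -> (forall x, 0 <= a x) -> (forall y, 0 <= b y) ->
  (forall x y, normc (F (x, y)) <= a x * b y) ->
  cint m1 (fun x => cint m2 (fun y => F (x, y))) =
  cint m2 (fun y => cint m1 (fun x => F (x, y))).
Proof.
move=> mF ai bi a0 b0 Fab; apply: cint_fubini => //.
have mb := measurable_int _ bi; have ma := measurable_int _ ai.
have b00 : (0 <= \int[m2]_y (b y)%:E)%E by apply: integral_ge0 => y _; rewrite lee_fin.
apply: (@le_lt_trans _ _ (\int[m1]_x ((a x)%:E * \int[m2]_y (b y)%:E))%E).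
  apply: ge0_le_integral => //.
  - by move=> x _; apply: integral_ge0 => y _; rewrite lee_fin normc_ge0.
  - apply: (@measurable_fun_fubini_tonelli_F _ _ T1 T2 R m2 (fun z => (normc (F z))%:E)) => //.
      exact/measurable_EFinP/measurable_normc.
    by move=> z; rewrite lee_fin normc_ge0.
  - under eq_fun do rewrite muleC -(fineK (integrable_fin_num measurableT bi)).
    exact: measurable_funeM.
  - move=> x _; rewrite -ge0_integralZl_EFin//; last by move=> y _; rewrite lee_fin.
    apply: ge0_le_integral => //.
    + by move=> y _; rewrite lee_fin normc_ge0.
    + apply/measurable_EFinP.
      have mFx : cmeas (fun y => F (x, y)) by apply: (cmeas_comp mF); exact: measurable_pair1.
      exact: measurable_normc.
    + exact: measurable_funeM.
    + by move=> y _; rewrite -EFinM lee_fin.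
rewrite ge0_integralZr//; last by move=> x _; rewrite lee_fin.
by rewrite lte_mul_pinfty//; [apply: integral_ge0 => x _; rewrite lee_fin| |]; rewrite ?integrable_lty// integrable_fin_num.
Qed.

Section plancherel.
Context {R : realType} {d : nat}.
Local Notation lam := (lebesgue_rV R d).
Local Notation V := 'rV[R]_d.
Local Notation leb := (@lebesgue_measure R).
Implicit Types (s t : V).

(** A product weight with exponential decay and its Fourier transform, a product
    of Poisson kernels.  Both are positive and integrable, which is all that a
    summation method for the Fourier inversion requires. *)
Definition laplace_rV (x : V) : R := \prod_(i < d) laplace (x ord0 i).

Definition poisson1 (x : R) : R := 2 / (1 + (2 * pi * x) ^+ 2).

Definition poisson_rV s : R := \prod_(i < d) poisson1 (s ord0 i).

Lemma poisson1_gt0 (x : R) : 0 < poisson1 x.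
Proof. by rewrite divr_gt0// ltr_pwDl ?sqr_ge0. Qed.

Lemma poisson_rV_gt0 s : 0 < poisson_rV s.
Proof. by apply: prodr_gt0 => i _; exact: poisson1_gt0. Qed.

Lemma laplace_rV_gt0 (x : V) : 0 < laplace_rV x.
Proof. by apply: prodr_gt0 => i _; exact: laplace_gt0. Qed.

Lemma laplace_rV_kernel s :
  cintegrable lam (fun x => (laplace_rV x)%:C%C * expi (- (2 * pi * dotv x s))) /\
  cint lam (fun x => (laplace_rV x)%:C%C * expi (- (2 * pi * dotv x s))) = (poisson_rV s)%:C%C.
Proof.
pose G (i : 'I_d) (x : R) : R[i] := (laplace x)%:C%C * expi (- (2 * pi * s ord0 i) * x).
have [Gi GE] := cint_rV_prod (fun i => cintegrable_laplace_expi (- (2 * pi * s ord0 i))).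
have E : (fun x : V => \prod_(i < d) G i (x ord0 i)) =
    (fun x => (laplace_rV x)%:C%C * expi (- (2 * pi * dotv x s))).
  apply/funext => x; rewrite /G big_split/= expi_sum /laplace_rV rmorph_prod.
  congr (_ * expi _); rewrite /dotv mulr_sumr -sumrN; apply: eq_bigr => i _; ring.
rewrite -E; split=> //; rewrite GE /poisson_rV rmorph_prod; apply: eq_bigr => i _.
by rewrite cint_laplace_expi sqrrN.
Qed.

Lemma measurable_poisson1 : measurable_fun setT poisson1.
Proof.
apply: continuous_measurable_fun => x; apply: cvgM; first exact: cvg_cst.
apply: cvgV; first by rewrite gt_eqF// ltr_pwDl ?sqr_ge0.
apply: cvgD; first exact: cvg_cst.
by apply: cvgM; (apply: cvgM; [exact: cvg_cst|exact: cvg_id]).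
Qed.

Lemma cintegrable_poisson1 : cintegrable leb (fun x => (poisson1 x)%:C%C).
Proof.
have onei : leb.-integrable setT (fun x => (2 * (oneDsqr x)^-1)%:E).
  have mo : measurable_fun setT (fun x : R => (oneDsqr x)^-1).
    by apply: continuous_measurable_fun; exact: continuous_oneDsqrV.
  apply/integrableP; split; first by apply/measurable_EFinP; exact: measurable_funM.
  have o0 (x : R) : 0 <= (oneDsqr x)^-1 by rewrite invr_ge0 addr_ge0 ?sqr_ge0.
  under eq_integral do rewrite gee0_abs ?lee_fin ?mulr_ge0// EFinM.
  rewrite ge0_integralZl_EFin//; last exact/measurable_EFinP.
  rewrite ge0_symfun_integralT//; last 2 first.
  - exact: continuous_oneDsqrV.
  - by move=> x /=; rewrite /oneDsqr sqrrN.
  rewrite (_ : [set x | _] = `[0, +oo[%classic); last first.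
    by apply/seteqP; split => x/=; rewrite in_itv/= andbT.
  by rewrite integral0y_oneDsqr -!EFinM ltry.
apply: (le_cintegrable _ onei); first by apply: cmeas_real; exact: measurable_poisson1.
move=> x; rewrite normc_real ger0_norm ?(ltW (poisson1_gt0 x))//.
have h : 1 <= 2 * pi :> R by have := pi_ge2 R; lra.
have h2 : 1 + x ^+ 2 <= 1 + (2 * pi * x) ^+ 2.
  rewrite lerD2l exprMn ler_peMl ?sqr_ge0// expr2.
  by rewrite -[leLHS]mulr1 ler_pM.
rewrite /poisson1 /oneDsqr ler_pM2l// lef_pV2// posrE ltr_pwDl// sqr_ge0//.
Qed.

Lemma integrable_poisson_rV : lam.-integrable setT (fun x => (poisson_rV x)%:E).
Proof.
have [h _] := @cint_rV_prod R d (fun _ x => (poisson1 x)%:C%C) (fun=> cintegrable_poisson1).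
have [+ _] := h; apply: eq_integrable => // x _.
by rewrite -rmorph_prod.
Qed.

Definition poisson_mass : R := \int[lam]_x poisson_rV x.

Lemma poisson_mass_gt0 : 0 < poisson_mass.
Proof.
have [_ h] := @cint_rV_prod R d (fun _ x => (poisson1 x)%:C%C) (fun=> cintegrable_poisson1).
have -> : poisson_mass = Re (cint lam (fun x => \prod_(i < d) (poisson1 (x ord0 i))%:C%C)).
  by apply: eq_Rintegral => x _; rewrite -rmorph_prod.
pose m := \int[leb]_x poisson1 x.
have c1 : cint leb (fun x => (poisson1 x)%:C%C) = m%:C%C.
  by apply: eqcP => //=; rewrite /Rintegral integral0.
rewrite h c1 prodr_const card_ord -rmorphXn/= exprn_gt0//.
have [pi1 _] := cintegrable_poisson1; rewrite /= in pi1.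
have -> : m = \int[leb]_x poisson1 x by [].
have l01 : leb (`[0, 1]%classic : set R) = 1%E.
  by rewrite lebesgue_measure_itv/= lte_fin ltr01 -EFinB subr0.
have I01 : (\int[leb]_x (\1_(`[0, 1]%classic : set R) x)%:E = 1)%E.
  by rewrite integral_indic// setIT; exact: l01.
have i01 : leb.-integrable setT (fun x => (poisson1 1 * \1_(`[0, 1]%classic : set R) x)%:E).
  under eq_fun do rewrite EFinM; apply: integrableZl => //.
  apply/integrableP; split; first exact/measurable_EFinP/measurable_indic.
  under eq_integral do rewrite gee0_abs ?lee_fin//.
  by rewrite I01 ltry.
apply: (@lt_le_trans _ _ (\int[leb]_x (poisson1 1 * \1_(`[0, 1]%classic : set R) x))).
  rewrite /Rintegral; under eq_integral do rewrite EFinM.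
  rewrite ge0_integralZl_EFin//; last 2 first.
  - exact/measurable_EFinP/measurable_indic.
  - exact/ltW/poisson1_gt0.
  rewrite I01 mule1.
  exact: poisson1_gt0.
apply: le_Rintegral => // x _; rewrite indicE.
case: (boolP (x \in _)) => [|_]; last by rewrite mulr0 ltW// poisson1_gt0.
rewrite inE/= in_itv/= mulr1 => /andP[x0 x1].
rewrite /poisson1 ler_pM2l// lef_pV2 ?posrE ?ltr_pwDl ?sqr_ge0//.
rewrite lerD2l ler_sqr ?nnegrE ?mulr_ge0 ?pi_ge0// ler_wpM2l// mulr_ge0 ?pi_ge0//.
Qed.

End plancherel.


Lemma conjcM (R : realType) (a b : R[i]) : conjc (a * b) = conjc a * conjc b.
Proof. by case: a b => [? ?] [? ?]; apply: eqcP => /=; ring. Qed.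

Section plancherel_identity.
Context {R : realType} {d : nat}.
Local Notation lam := (lebesgue_rV R d).
Local Notation V := 'rV[R]_d.
Local Notation H := (L2T lam).
Local Notation shift s := (tfshift (s, 0)).
Implicit Types (s t x : V) (w : V -> R[i]).

Definition fourier w (x : V) : R[i] :=
  cint lam (fun t => expi (- (2 * pi * dotv x t)) * w t).

Lemma cmeas_fourier_integrand w : cmeas w ->
  cmeas (fun z : V * V => expi (- (2 * pi * dotv z.1 z.2)) * w z.2).
Proof.
move=> mw; apply: cmeasM; last exact: (cmeas_comp mw).
apply: cmeas_expi; apply: measurableT_comp => //; apply: measurable_funM => //.
exact: measurable_dotv2.
Qed.

Lemma cmeas_fourier w : cmeas w -> cmeas (fourier w).
Proof. by move=> mw; exact: (cmeas_cint lam (cmeas_fourier_integrand mw)). Qed.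

Lemma cintegrable_modulation w (h : V -> R) : measurable_fun setT h ->
  cintegrable lam w -> cintegrable lam (fun t => expi (h t) * w t).
Proof.
move=> mh wi; apply: le_cintegrable (cintegrable_normc wi) _.
  by apply: cmeasM; [exact: cmeas_expi|exact: cintegrable_cmeas wi].
by move=> t; rewrite normcM normc_expi mul1r.
Qed.

Lemma cintegrable_fourier w x : cintegrable lam w ->
  cintegrable lam (fun t => expi (- (2 * pi * dotv x t)) * w t).
Proof.
apply: cintegrable_modulation; apply: measurableT_comp => //.
by apply: measurable_funM => //; exact: measurable_dotv.
Qed.

Lemma normc_fourier_le w x : cintegrable lam w ->
  normc (fourier w x) <= \int[lam]_t normc (w t).
Proof.
move=> wi; apply: le_trans (normc_cint_le (cintegrable_fourier x wi)) _.
rewrite le_eqVlt; apply/orP; left; apply/eqP; apply: eq_Rintegral => t _.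
by rewrite normcM normc_expi mul1r.
Qed.

Lemma affine_meas (a : R) (b : V) : measurable_fun setT (fun x : V => a *: x + b).
Proof. exact: measurable_affine. Qed.

Lemma cint_affine (a : R) (b : V) w : a != 0 -> cintegrable lam w ->
  cintegrable lam (fun x => w (a *: x + b)) /\
  cint lam (fun x => w (a *: x + b)) = (`|a| ^- d)%:C%C * cint lam w.
Proof.
move=> a0 wi; have k0 : 0 <= `|a| ^- d by rewrite invr_ge0 exprn_ge0.
apply: (cint_comp (affine_meas a b) k0) => // A mA.
exact: lebesgue_affine.
Qed.

Lemma ge0_integral_affine (a : R) (b : V) (g : V -> \bar R) : a != 0 ->
  measurable_fun setT g -> (forall x, 0 <= g x)%E ->
  (\int[lam]_x g (a *: x + b)%R = (`|a| ^- d)%:E * \int[lam]_x g x)%E.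
Proof.
move=> a0 mg g0; have k0 : 0 <= `|a| ^- d by rewrite invr_ge0 exprn_ge0.
have := ge0_integral_mscale lam measurableT (NngNum k0) mg (fun x _ => g0 x) => /= <-.
rewrite [LHS](_ : _ = \int[pushforward lam (fun x : V => (a *: x + b)%R)]_x g x)%E; last first.
  by rewrite (ge0_integral_pushforward (affine_meas a b))// => y _; exact: g0.
apply: eq_measure_integral => [|? A mA _]; first exact: affine_meas.
by rewrite [LHS](lebesgue_affine b a0 mA).
Qed.

Lemma laplace_rV_dilated_kernel (e : R) s : 0 < e ->
  cintegrable lam (fun x => (laplace_rV (e *: x))%:C%C * expi (- (2 * pi * dotv x s))) /\
  cint lam (fun x => (laplace_rV (e *: x))%:C%C * expi (- (2 * pi * dotv x s))) =
  (e ^- d * poisson_rV (e^-1 *: s))%:C%C.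
Proof.
move=> e0; have [h1 h2] := laplace_rV_kernel (e^-1 *: s).
have [] := cint_affine 0 (negbT (gt_eqF e0)) h1; rewrite h2.
have E : (fun x : V => (laplace_rV (e *: x + 0))%:C%C *
      expi (- (2 * pi * dotv (e *: x + 0) (e^-1 *: s)))) =
    (fun x => (laplace_rV (e *: x))%:C%C * expi (- (2 * pi * dotv x s))).
  apply/funext => x; rewrite addr0 dotvZl dotvZr mulVKf ?gt_eqF//.
by rewrite E gtr0_norm// -rmorphM.
Qed.

Definition dilated_energy (W : H) (e : R) : R :=
  \int[lam]_r (poisson_rV r * ip W (shift (e *: r) W)).

(** Damping the Fourier side by the dilated weight turns the energy into an
    average of the autocorrelation of W against the Poisson kernel. *)
Lemma damped_energy (W : H) (e : R) : 0 < e -> cintegrable lam W ->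
  \int[lam]_x (laplace_rV (e *: x) * sqn (fourier W x)) = dilated_energy W e.
Proof.
move=> e0 Wi; have mW := l2_cmeas W; have mfW := cmeas_fourier mW.
pose g (x : V) : R := laplace_rV (e *: x).
have g0 x : 0 <= g x by apply/ltW/laplace_rV_gt0.
have gi : lam.-integrable setT (fun x => (g x)%:E).
  have [h _] := laplace_rV_dilated_kernel 0 e0; have := cintegrable_normc h.
  apply: eq_integrable => // x _; rewrite normcM normc_expi mulr1 normc_real.
  by rewrite ger0_norm; last exact: g0.
have mg : measurable_fun setT g by apply/measurable_EFinP; exact: measurable_int gi.
pose M := \int[lam]_t normc (W t).
have M0 : 0 <= M by apply: Rintegral_ge0 => t _; exact: normc_ge0.
have nWi := cintegrable_normc Wi.
pose X x := fourier W x.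
pose E x t : R[i] := expi (- (2 * pi * dotv x t)).
have mE : cmeas (fun z : V * V => E z.1 z.2).
  apply: cmeas_expi; apply: measurableT_comp => //; apply: measurable_funM => //.
  exact: measurable_dotv2.
have gMi : lam.-integrable setT (fun x => (g x * M)%:E).
  by under eq_fun do rewrite EFinM muleC; exact: integrableZl.
pose K s := (e ^- d * poisson_rV (e^-1 *: s))%:C%C : R[i].
have step1 : \int[lam]_x (g x * sqn (X x)) =
    Re (cint lam (fun x => cint lam (fun t => (g x)%:C%C * conjc (X x) * (E x t * W t)))).
  apply: eq_Rintegral => x _; rewrite cintZ; last exact: cintegrable_fourier.
  by rewrite -/(fourier W x) -/(X x) /sqn; case: (X x) => a b /=; ring.
rewrite step1.
pose F1 (z : V * V) := (g z.1)%:C%C * conjc (X z.1) * (E z.1 z.2 * W z.2).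
have mF1 : cmeas F1.
  apply: cmeasM; last by apply: cmeasM => //; exact: (cmeas_comp mW).
  apply: (@cmeas_comp _ _ _ _ _ (fun x => (g x)%:C%C * conjc (X x))) => //.
  by apply: cmeasM; [exact: cmeas_real|exact: cmeasJ].
have bF1 x t : normc (F1 (x, t)) <= (g x * M) * normc (W t).
  rewrite -[F1 _]/((g x)%:C%C * conjc (X x) * (E x t * W t)).
  rewrite !normcM normc_real normc_conj normc_expi mul1r (ger0_norm (g0 x)).
  by apply: ler_wpM2r; [exact: normc_ge0|apply: ler_wpM2l => //; exact: normc_fourier_le].
have gM0 x : 0 <= g x * M by exact: mulr_ge0.
have swap1 := cint_fubini_bound mF1 gMi nWi gM0 (fun t => normc_ge0 _) bF1.
transitivity (Re (cint lam (fun t => cint lam (fun x => F1 (x, t))))).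
  exact: (congr1 (fun c => Re c) swap1).
clear swap1 bF1.
have step2 t : cint lam (fun x => F1 (x, t)) =
    cint lam (fun r => (poisson_rV r)%:C%C * (W t * conjc (W (t - e *: r)))).
  have Kt : cint lam (fun x => F1 (x, t)) = cint lam (fun t' => W t * conjc (W t') * K (t - t')).
    pose F2 (z : V * V) := (g z.1)%:C%C * E z.1 t * W t * conjc (E z.1 z.2 * W z.2).
    transitivity (cint lam (fun x => cint lam (fun t' => F2 (x, t')))).
      apply: eq_cint => x.
      rewrite -[RHS]/(cint lam (fun t' => (g x)%:C%C * E x t * W t * conjc (E x t' * W t'))).
      rewrite -[LHS]/((g x)%:C%C * conjc (X x) * (E x t * W t)).
      rewrite cintZ; last by apply: cintegrableJ; exact: cintegrable_fourier.
      rewrite cintJ; last exact: cintegrable_fourier.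
      by rewrite -/(fourier W x) -/(X x); ring.
    have mF2 : cmeas F2.
      apply: cmeasM; last by apply: cmeasJ; apply: cmeasM => //; exact: (cmeas_comp mW).
      apply: (@cmeas_comp _ _ _ _ _ (fun x => (g x)%:C%C * E x t * W t)) => //.
      apply: cmeasM; last exact: cmeas_cst.
      apply: cmeasM; first exact: cmeas_real.
      apply: cmeas_expi; apply: measurableT_comp => //; apply: measurable_funM => //.
      by apply: measurable_dotv2.
    have gWi : lam.-integrable setT (fun x => (g x * normc (W t))%:E).
      by under eq_fun do rewrite EFinM muleC; exact: integrableZl.
    have gW0 x : 0 <= g x * normc (W t) by rewrite mulr_ge0// normc_ge0.
    have bF2 x t' : normc (F2 (x, t')) <= g x * normc (W t) * normc (W t').
      rewrite -[F2 _]/((g x)%:C%C * E x t * W t * conjc (E x t' * W t')).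
      by rewrite !normcM normc_real normc_conj normcM !normc_expi mulr1 mul1r ger0_norm.
    apply: etrans (cint_fubini_bound mF2 gWi nWi gW0 (fun t => normc_ge0 _) bF2) _.
    apply: eq_cint => t'; rewrite -[K _](laplace_rV_dilated_kernel (t - t') e0).2.
    rewrite -cintZ; last by case: (laplace_rV_dilated_kernel (t - t') e0).
    apply: eq_cint => x.
    have -> : expi (- (2 * pi * dotv x (t - t'))) = E x t * conjc (E x t').
      by rewrite /E conj_expi -expiD; congr expi; rewrite dotvDr dotvNr; ring.
    rewrite -[LHS]/((g x)%:C%C * E x t * W t * conjc (E x t' * W t')).
    by rewrite conjcM /g; ring.
  have eN0 : - e != 0 by rewrite oppr_eq0 gt_eqF.
  have mK : measurable_fun setT (fun s => e ^- d * poisson_rV (e^-1 *: s)).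
    apply: measurable_funM => //.
    apply: (measurableT_comp (f := @poisson_rV R d)).
      by apply/measurable_EFinP; exact: measurable_int integrable_poisson_rV.
    exact: measurable_rVZ.
  have fi : cintegrable lam (fun t' => W t * conjc (W t') * K (t - t')).
    apply: (@le_cintegrable _ _ _ _ _ (fun t' => (normc (W t) * (e ^- d * 2 ^+ d)) * normc (W t'))).
    - apply: cmeasM; first by apply: cmeasM; [exact: cmeas_cst|exact: cmeasJ].
      apply: cmeas_real; apply: (measurableT_comp mK).
      by apply: measurable_rVB => //; exact: measurable_cst.
    - by under eq_fun do rewrite EFinM; exact: integrableZl.
    - move=> t'; rewrite !normcM normc_conj normc_real ger0_norm; last first.
        by rewrite mulr_ge0 ?invr_ge0 ?exprn_ge0 ?(ltW e0) ?(ltW (poisson_rV_gt0 _)).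
      rewrite [leRHS]mulrAC ler_wpM2l ?mulr_ge0 ?normc_ge0//.
      rewrite ler_wpM2l ?invr_ge0 ?exprn_ge0 ?(ltW e0)//.
      have -> : 2 ^+ d = \prod_(i < d) 2 :> R by rewrite prodr_const card_ord.
      apply: ler_prod => i _; rewrite (ltW (poisson1_gt0 _))/= /poisson1.
      by rewrite ler_pdivrMr ?ltr_pwDl ?sqr_ge0// ler_peMr// lerDl sqr_ge0.
  have [] := cint_affine t eN0 fi; rewrite normrN gtr0_norm// -Kt.
  have ed0 : (e ^- d)%:C%C != 0 :> R[i].
    by rewrite (inj_eq (@complexI R)) invr_eq0 expf_neq0// gt_eqF.
  pose q r := (poisson_rV r)%:C%C * (W t * conjc (W (t - e *: r))).
  have -> : (fun x => W t * conjc (W (- e *: x + t)) * K (t - (- e *: x + t))) =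
      (fun x => (e ^- d)%:C%C * q x).
    apply/funext => r; rewrite /K /q scaleNr [- _ + t]addrC opprB addrCA subrr addr0.
    by rewrite scalerA mulVf ?gt_eqF// scale1r rmorphM; ring.
  move=> qi; rewrite cintZ; first by move/(mulfI ed0).
  have := cintegrableZ ((e ^- d)%:C%C)^-1 qi.
  by under eq_fun do rewrite mulrA mulVf// mul1r.
under eq_cint do rewrite step2.
have mF3 : cmeas (fun z : V * V => (poisson_rV z.2)%:C%C * (W z.1 * conjc (W (z.1 - e *: z.2)))).
  apply: cmeasM.
    apply: cmeas_real; apply: (measurableT_comp (f := @poisson_rV R d)) => //.
    by apply/measurable_EFinP; exact: measurable_int integrable_poisson_rV.
  apply: cmeasM; first exact: (cmeas_comp mW).
  apply: cmeasJ; apply: (cmeas_comp mW); apply: measurable_rVB => //.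
  exact: measurable_rVZ.
have shiftE r t : shift (e *: r) W t = W (t - e *: r).
  by rewrite tfshiftE /= dotv0l mulr0 expi0 mul1r.
have F3oo : (\int[lam]_t \int[lam]_r
    (normc ((poisson_rV r)%:C%C * (W t * conjc (W (t - e *: r)))))%:E < +oo)%E.
  rewrite (@fubini_tonelli _ _ _ _ _ lam lam (fun z => (normc ((poisson_rV z.2)%:C%C *
     (W z.1 * conjc (W (z.1 - e *: z.2)))))%:E)); last 2 first.
  - exact/measurable_EFinP/measurable_normc.
  - by move=> z; rewrite lee_fin normc_ge0.
  apply: (@le_lt_trans _ _ (\int[lam]_r ((2 * nsq W)%:E * (poisson_rV r)%:E))%E); last first.
    exact/integrable_lty/integrableZl/integrable_poisson_rV.
  apply: ge0_le_integral => //.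
  - by move=> r _; apply: integral_ge0 => t _; rewrite lee_fin normc_ge0.
  - apply: (@measurable_fun_fubini_tonelli_G _ _ _ _ _ lam (fun z => (normc ((poisson_rV z.2)%:C%C *
      (W z.1 * conjc (W (z.1 - e *: z.2)))))%:E)).
      exact/measurable_EFinP/measurable_normc.
    by move=> z; rewrite lee_fin normc_ge0.
  - by apply: measurable_funeM; exact: measurable_int integrable_poisson_rV.
  - move=> r _; have p0 := ltW (poisson_rV_gt0 r).
    apply: (@le_trans _ _ (\int[lam]_t ((poisson_rV r)%:E *
       ((sqn (W t))%:E + (sqn (shift (e *: r) W t))%:E)))%E).
      apply: ge0_le_integral => //.
      + by move=> t _; rewrite lee_fin normc_ge0.
      + apply/measurable_EFinP; apply: measurable_normc.
        by apply: (cmeas_comp mF3); exact: measurable_pair2.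
      + apply: measurable_funeM; apply: emeasurable_funD; apply: measurable_sqnE => //.
        exact: l2_cmeas.
      + move=> t _; rewrite -EFinD -EFinM lee_fin !normcM normc_real normc_conj ger0_norm//.
        rewrite ler_wpM2l// shiftE !sqnE.
        have := sqr_ge0 (normc (W t) - normc (W (t - e *: r))).
        have := sqr_ge0 (normc (W t) + normc (W (t - e *: r))).
        by move: (normc _) (normc _) => a b; nra.
    rewrite ge0_integralZl_EFin//; last 2 first.
    + by move=> t _; rewrite -EFinD lee_fin addr_ge0// sqn_ge0.
    + by apply: emeasurable_funD; apply: measurable_sqnE => //; exact: l2_cmeas.
    rewrite muleC lee_wpmul2r ?lee_fin//.
    rewrite ge0_integralD//; last 4 first.
    + by move=> t _; rewrite lee_fin sqn_ge0.
    + exact: measurable_sqnE.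
    + by move=> t _; rewrite lee_fin sqn_ge0.
    + by apply: measurable_sqnE; exact: l2_cmeas.
    by rewrite -!EFin_nsq nsq_tfshift -EFinD lee_fin mulr2n mulrDl mul1r.
transitivity (Re (cint lam (fun r => cint lam (fun t =>
    (poisson_rV r)%:C%C * (W t * conjc (W (t - e *: r))))))).
  exact: (congr1 (fun c => Re c) (cint_fubini mF3 F3oo)).
apply: eq_Rintegral => r _.
rewrite cintZ; last first.
  have := cintegrable_l2 W (shift (e *: r) W).
  by under eq_fun do rewrite shiftE.
rewrite cReM /= mul0r subr0; congr (_ * _); apply: eq_Rintegral => t _.
by rewrite -shiftE -reJE.
Qed.

End plancherel_identity.


Section plancherel_theorem.
Context {R : realType} {d : nat}.
Local Notation lam := (lebesgue_rV R d).
Local Notation V := 'rV[R]_d.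
Local Notation H := (L2T lam).
Local Notation shift s := (tfshift (s, 0)).
Implicit Types (s t x : V) (w : V -> R[i]).

Lemma measurable_autocorrelation (W : H) (e : R) :
  measurable_fun setT (fun r : V => ip W (shift (e *: r) W)).
Proof.
have mW := l2_cmeas W.
have mF : cmeas (fun z : V * V => W z.2 * conjc (W (z.2 - e *: z.1))).
  apply: cmeasM; first exact: (cmeas_comp mW).
  apply: cmeasJ; apply: (cmeas_comp mW); apply: measurable_rVB => //.
  exact: measurable_rVZ.
have [+ _] := cmeas_cint lam mF; apply: eq_measurable_fun => r _.
apply: eq_Rintegral => t _; rewrite reJE tfshiftE.
by rewrite -[(r, t).2]/t -[(r, t).1]/r /= dotv0l mulr0 expi0 mul1r.
Qed.

Lemma autocorrelation_cvg (W : H) r :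
  (fun n : nat => ip W (shift (n.+1%:R^-1 *: r) W)) @ \oo --> nsq W.
Proof.
apply/cvgrPdist_le => e e0; pose q := (e / (1 + nrm W)) ^+ 2.
have den : 0 < 1 + nrm W by rewrite ltr_pwDl ?nrm_ge0.
have q0 : 0 < q by rewrite exprn_gt0// divr_gt0.
have [s s0 hs] := tfshift_continuity W q0.
pose M : R := 1 + \sum_i `|r ord0 i|.
have M0 : 0 < M by rewrite ltr_pwDl// sumr_ge0.
near=> n.
have nM : n.+1%:R^-1 * M < s.
  rewrite mulrC ltr_pdivrMr// mulrC -ltr_pdivrMr//.
  apply: (@lt_le_trans _ _ n%:R); last by rewrite ler_nat.
  near: n; exact: nbhs_infty_gtr.
have : nsq (shift (n.+1%:R^-1 *: r) W - W) <= q.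
  apply: hs; split => i /=; last by rewrite mxE normr0.
  rewrite mxE normrM ger0_norm ?invr_ge0//; apply: le_lt_trans nM.
  rewrite ler_wpM2l ?invr_ge0// /M (bigD1 i)//= addrCA lerDl addr_ge0//.
  by rewrite sumr_ge0.
move=> hq; have {}hq : nrm (shift (n.+1%:R^-1 *: r) W - W) <= e / (1 + nrm W).
  rewrite -(ger0_norm (ltW (divr_gt0 e0 den))) -sqrtr_sqr.
  exact: ler_wsqrtr.
have -> : nsq W - ip W (shift (n.+1%:R^-1 *: r) W) = - ip W (shift (n.+1%:R^-1 *: r) W - W).
  by rewrite ipDr ipNr opprD opprK addrC.
rewrite normrN; apply: le_trans (CS _ _) _.
apply: le_trans (ler_wpM2l (nrm_ge0 _) hq) _.
rewrite mulrCA ler_piMr ?(ltW e0)// ler_pdivrMr// mul1r lerDr//.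
Unshelve. all: by end_near. Qed.

Lemma dilated_energy_cvg (W : H) :
  (fun n : nat => (dilated_energy W n.+1%:R^-1)%:E) @ \oo --> (@poisson_mass R d * nsq W)%:E.
Proof.
have pi_ := @integrable_poisson_rV R d.
have mp := measurable_int _ pi_.
pose f (n : nat) (r : V) := (poisson_rV r * ip W (shift (n.+1%:R^-1 *: r) W))%:E.
have bf n r : (`|f n r| <= (nsq W)%:E * (poisson_rV r)%:E)%E.
  rewrite /f -EFinM lee_fin normrM (ger0_norm (ltW (poisson_rV_gt0 r))) mulrC.
  rewrite ler_wpM2r ?(ltW (poisson_rV_gt0 r))//; apply: le_trans (CS _ _) _.
  by rewrite /nrm nsq_tfshift -expr2 sqr_sqrtr ?nsq_ge0.
have mf n : measurable_fun setT (f n).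
  apply/measurable_EFinP; apply: measurable_funM; first exact/measurable_EFinP.
  exact: measurable_autocorrelation.
have gi : lam.-integrable setT (fun r => (nsq W)%:E * (poisson_rV r)%:E)%E by exact: integrableZl.
have fi n : lam.-integrable setT (f n).
  apply: le_integrable gi => // r _; apply: le_trans (bf n r) _.
  by rewrite lee_abs.
have -> : (fun n : nat => (dilated_energy W n.+1%:R^-1)%:E) =
    (fun n => \int[lam]_r f n r)%E.
  apply/funext => n; rewrite /dilated_energy /Rintegral fineK//.
  exact: integrable_fin_num (fi n).
have -> : (@poisson_mass R d * nsq W)%:E = (\int[lam]_r (poisson_rV r * nsq W)%:E)%E.
  under eq_integral do rewrite EFinM.
  rewrite integralZr// EFinM /poisson_mass /Rintegral fineK//.
  exact: integrable_fin_num pi_.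
apply: (@dominated_cvg _ _ _ lam _ measurableT f _ (fun r => (nsq W)%:E * (poisson_rV r)%:E)%E) => //.
move=> r _; apply: cvg_EFin; first by near=> n.
by apply: cvgM; [exact: cvg_cst|exact: autocorrelation_cvg].
Unshelve. all: by end_near. Qed.

Lemma laplace_rV_dilation_cvg x :
  (fun n : nat => laplace_rV (n.+1%:R^-1 *: x)) @ \oo --> (1 : R).
Proof.
have E1 : 1 = \prod_(i < d) (1 : R) by rewrite big1.
rewrite [X in _ --> X]E1.
have e0 : (fun n : nat => (n.+1%:R^-1 : R)) @ \oo --> (0 : R) by exact: cvg_harmonic.
apply: (@cvg_comp _ _ _ _ (fun e : R => laplace_rV (e *: x)) _ _ _ e0).
apply: (@cvg_bigprod R 'I_d _ (fun i (e : R) => laplace ((e *: x) ord0 i))) => i.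
have E2 : 1 = laplace ((0 *: x) ord0 i) by rewrite /laplace mxE mul0r normr0 oppr0 expR0.
rewrite [X in _ --> X]E2 /laplace; under eq_fun do rewrite mxE; rewrite mxE.
apply: (@cvg_comp _ _ _ (fun e : R => - `|e * x ord0 i|) expR); last exact: continuous_expR.
by apply: cvgN; apply: cvg_norm; apply: cvgM; [exact: cvg_id|exact: cvg_cst].
Qed.

(** The damping is removed by letting its scale tend to 0: on the Fourier side the
    weights increase to 1 and monotone convergence applies, while the
    autocorrelation is continuous at 0 and dominated by nsq W.  The constant is
    the total mass of the Poisson kernel. *)
Theorem plancherel (W : H) : cintegrable lam W ->
  (\int[lam]_x (sqn (fourier W x))%:E = (@poisson_mass R d * nsq W)%:E)%E.
Proof.
move=> Wi; pose g (n : nat) (x : V) := (laplace_rV (n.+1%:R^-1 *: x) * sqn (fourier W x))%:E.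
have mfW := cmeas_fourier (l2_cmeas W).
have ml (e : R) : 0 < e -> lam.-integrable setT (fun x : V => (laplace_rV (e *: x))%:E).
  move=> e0; have [h _] := laplace_rV_dilated_kernel (0 : V) e0; have := cintegrable_normc h.
  apply: eq_integrable => // x _; rewrite normcM normc_expi mulr1 normc_real.
  by rewrite ger0_norm// ltW// laplace_rV_gt0.
have n0 n : 0 < n.+1%:R^-1 :> R by rewrite invr_gt0.
have mg n : measurable_fun setT (g n).
  apply/measurable_EFinP; apply: measurable_funM; last exact: measurable_sqn.
  by apply/measurable_EFinP; exact: measurable_int (ml _ (n0 n)).
have g0 n x : (0 <= g n x)%E.
  by rewrite lee_fin mulr_ge0 ?sqn_ge0// ltW// laplace_rV_gt0.
have gi n : lam.-integrable setT (g n).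
  pose M := \int[lam]_t normc (W t).
  have Mi : lam.-integrable setT (fun x : V => ((M ^+ 2)%:E * (laplace_rV (n.+1%:R^-1 *: x))%:E)%E).
    exact: integrableZl (ml _ (n0 n)).
  apply: le_integrable Mi => // x _; rewrite gee0_abs//.
  rewrite /g -EFinM lee_fin mulrC; apply: le_trans (ler_norm _).
  rewrite ler_wpM2r ?(ltW (laplace_rV_gt0 _))// sqnE lerXn2r ?nnegrE ?normc_ge0//.
    by apply: Rintegral_ge0 => t _; exact: normc_ge0.
  exact: normc_fourier_le.
have ig n : (\int[lam]_x g n x = (dilated_energy W n.+1%:R^-1)%:E)%E.
  rewrite -damped_energy// /Rintegral fineK//.
  exact: integrable_fin_num (gi n).
have ndg x : {homo g^~ x : n m / (n <= m)%N >-> (n <= m)%E}.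
  move=> n m nm; rewrite lee_fin ler_wpM2r ?sqn_ge0//; apply: ler_prod => i _.
  rewrite (ltW (laplace_gt0 _))/= /laplace ler_expR lerN2 !mxE !normrM ler_wpM2r//.
  by rewrite !ger0_norm ?invr_ge0// lef_pV2 ?posrE// ler_nat ltnS.
have gc x : (fun n => g n x) @ \oo --> (sqn (fourier W x))%:E.
  apply: cvg_EFin; first by near=> n.
  rewrite -[X in _ --> X]mul1r; apply: cvgM; last exact: cvg_cst.
  exact: laplace_rV_dilation_cvg.
have := @cvg_monotone_convergence _ _ _ lam _ measurableT g mg (fun n x _ => g0 n x) (fun x _ => ndg x).
have -> : (\int[lam]_x limn (g^~ x) = \int[lam]_x (sqn (fourier W x))%:E)%E.
  by apply: eq_integral => x _; apply/cvg_lim => //; exact: gc.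
under eq_fun do rewrite ig.
by move=> h; rewrite -(cvg_lim _ h)//; apply/cvg_lim => //; exact: dilated_energy_cvg.
Unshelve. all: by end_near. Qed.

End plancherel_theorem.


(** * Convolutions *)

Section convolution.
Context {R : realType} {d : nat}.
Local Notation lam := (lebesgue_rV R d).
Local Notation V := 'rV[R]_d.
Local Notation H := (L2T lam).
Implicit Types (s t x : V) (u v w : V -> R[i]).

Lemma ge0_integral_translate (g : V -> \bar R) t : measurable_fun setT g ->
  (forall x, 0 <= g x)%E -> (\int[lam]_s g (s - t)%R = \int[lam]_s g s)%E.
Proof.
exact: (ge0_integral_preserving (shift_measurable t) (@shift_preserving R d t)).
Qed.

Lemma cint_translate w t : cintegrable lam w ->
  cintegrable lam (fun s => w (s - t)) /\ cint lam (fun s => w (s - t)) = cint lam w.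
Proof.
move=> wi; have E A : measurable A -> lam ((fun s : V => s - t) @^-1` A) = (1%:E * lam A)%E.
  by move=> mA; rewrite mul1e; exact: shift_preserving.
by have [? ->] := cint_comp (shift_measurable t) ler01 E wi; rewrite mul1r.
Qed.

Definition conv u v s : R[i] := cint lam (fun t => u (s - t) * v t).

Lemma cmeas_conv_integrand u v : cmeas u -> cmeas v ->
  cmeas (fun z : V * V => u (z.1 - z.2) * v z.2).
Proof.
move=> mu mv; apply: cmeasM; last exact: (cmeas_comp mv).
by apply: (cmeas_comp mu); apply: measurable_rVB.
Qed.

Lemma conv_abs_lty u v : cintegrable lam u -> cintegrable lam v ->
  (\int[lam]_s \int[lam]_t (normc (u (s - t) * v t))%:E < +oo)%E.
Proof.
move=> ui vi; have mu := cintegrable_cmeas ui; have mv := cintegrable_cmeas vi.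
have mF := cmeas_conv_integrand mu mv.
pose G (z : V * V) := (normc (u (z.1 - z.2) * v z.2))%:E.
rewrite (@fubini_tonelli _ _ _ _ _ lam lam G); last 2 first.
- exact/measurable_EFinP/measurable_normc.
- by move=> z; rewrite lee_fin normc_ge0.
have mnu : measurable_fun setT (fun s => (normc (u s))%:E).
  exact/measurable_EFinP/measurable_normc.
have mnv : measurable_fun setT (fun s => (normc (v s))%:E).
  exact/measurable_EFinP/measurable_normc.
have nu0 s : (0 <= (normc (u s))%:E)%E by rewrite lee_fin normc_ge0.
have nv0 s : (0 <= (normc (v s))%:E)%E by rewrite lee_fin normc_ge0.
have -> : (\int[lam]_t \int[lam]_s G (s, t) =
    \int[lam]_t ((normc (v t))%:E * \int[lam]_s (normc (u s))%:E))%E.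
  apply: eq_integral => t _.
  rewrite -(ge0_integral_translate t mnu nu0) -ge0_integralZl//; last first.
    exact: (measurableT_comp mnu (shift_measurable t)).
  by apply: eq_integral => s _; rewrite /G /= normcM EFinM muleC.
have Uoo := integrable_lty measurableT (cintegrable_normc ui).
have Voo := integrable_lty measurableT (cintegrable_normc vi).
rewrite ge0_integralZr//; last exact: integral_ge0.
have U0 : (0 <= \int[lam]_s (normc (u s))%:E)%E by exact: integral_ge0.
have V0 : (0 <= \int[lam]_s (normc (v s))%:E)%E by exact: integral_ge0.
by apply: lte_mul_pinfty => //; rewrite ge0_fin_numE.
Qed.

Lemma cmeas_conv u v : cmeas u -> cmeas v -> cmeas (conv u v).
Proof. by move=> mu mv; exact: (cmeas_cint lam (cmeas_conv_integrand mu mv)). Qed.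

Lemma normc_cint_le_ereal w : cintegrable lam w ->
  ((normc (cint lam w))%:E <= \int[lam]_x (normc (w x))%:E)%E.
Proof.
move=> wi; apply: (@le_trans _ _ (\int[lam]_x normc (w x))%:E%E).
  by rewrite lee_fin normc_cint_le.
by rewrite /Rintegral fineK//; exact: integrable_fin_num (cintegrable_normc wi).
Qed.

Variables u v : V -> R[i].
Hypothesis ui : cintegrable lam u.
Hypothesis vi : cintegrable lam v.
Hypothesis uvi : forall s, cintegrable lam (fun t => u (s - t) * v t).
Let mu := cintegrable_cmeas ui.
Let mv := cintegrable_cmeas vi.

Lemma cintegrable_conv : cintegrable lam (conv u v).
Proof.
have mF := cmeas_conv_integrand mu mv.
apply/cintegrableP; first exact: cmeas_conv.
apply: le_lt_trans (conv_abs_lty ui vi); apply: ge0_le_integral => //.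
- by move=> s _; rewrite lee_fin normc_ge0.
- exact/measurable_EFinP/measurable_normc/cmeas_conv.
- apply: (@measurable_fun_fubini_tonelli_F _ _ V V R lam
    (fun z => (normc (u (z.1 - z.2) * v z.2))%:E)) => //.
    exact/measurable_EFinP/measurable_normc.
  by move=> z; rewrite lee_fin normc_ge0.
- by move=> s _; exact: normc_cint_le_ereal.
Qed.

Lemma fourier_conv x : fourier (conv u v) x = fourier u x * fourier v x.
Proof.
pose E t : R[i] := expi (- (2 * pi * dotv x t)).
have mE : cmeas E.
  by apply: cmeas_expi; apply: measurableT_comp => //; apply: measurable_funM => //; exact: measurable_dotv.
pose F (z : V * V) := E z.1 * (u (z.1 - z.2) * v z.2).
have mF : cmeas F.
  apply: cmeasM; first exact: (cmeas_comp mE).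
  exact: cmeas_conv_integrand.
have nF s t : normc (F (s, t)) = normc (u (s - t) * v t).
  by rewrite -[F _]/(E s * (u (s - t) * v t)) normcM normc_expi mul1r.
have Foo : (\int[lam]_s \int[lam]_t (normc (F (s, t)))%:E < +oo)%E.
  under eq_integral do under eq_integral do rewrite nF.
  exact: conv_abs_lty.
have swap := cint_fubini mF Foo.
transitivity (cint lam (fun s => cint lam (fun t => F (s, t)))).
  apply: eq_cint => s; rewrite /conv -[RHS]/(cint lam (fun t => E s * (u (s - t) * v t))).
  by rewrite cintZ.
rewrite swap.
transitivity (cint lam (fun t => fourier u x * (E t * v t))); last first.
  exact: (cintZ (fourier u x) (cintegrable_fourier x vi)).
apply: eq_cint => t.
rewrite -[LHS]/(cint lam (fun s => E s * (u (s - t) * v t))).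
have ti := cintegrable_fourier x ui.
have [ti1 t1E] := cint_translate t ti.
rewrite [RHS]mulrC -[fourier u x]t1E -cintZ; last exact: ti1.
apply: eq_cint => s; rewrite [RHS]mulrACA -expiD [v t * _]mulrC.
by congr (_ * _); rewrite /E; congr expi; rewrite dotvDr dotvNr; ring.
Qed.

(** A bounded convolution of integrable functions is square-integrable, so that the
    Plancherel identity applies to it. *)
Lemma conv_plancherel (M : R) : (forall s, normc (conv u v s) <= M) ->
  (\int[lam]_x (sqn (fourier u x) * sqn (fourier v x))%:E =
   (@poisson_mass R d)%:E * \int[lam]_s (sqn (conv u v s))%:E)%E.
Proof.
move=> cM; have ci := cintegrable_conv.
have cL : conv u v \in sqintegrable lam.
  apply/sqintegrableP; split; first exact: cmeas_conv.
  apply: (@le_lt_trans _ _ (\int[lam]_s (M%:E * (normc (conv u v s))%:E))%E); last first.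
    by apply: integrable_lty => //; apply: integrableZl => //; exact: cintegrable_normc.
  have mn : measurable_fun setT (fun s => (normc (conv u v s))%:E).
    exact/measurable_EFinP/measurable_normc/cmeas_conv.
  apply: ge0_le_integral => //.
  - by move=> s _; rewrite lee_fin sqn_ge0.
  - exact/measurable_sqnE/cmeas_conv.
  - exact: measurable_funeM.
  - by move=> s _; rewrite -EFinM lee_fin sqnE expr2 ler_wpM2r ?normc_ge0.
have := @plancherel R d (MkL2 cL) ci.
rewrite EFinM EFin_nsq => <-; apply: eq_integral => x _ /=.
by rewrite fourier_conv sqnM.
Qed.

End convolution.


(** * The vanishing estimate *)

Section boxes.
Context {R : realType} {d : nat}.
Local Notation lam := (lebesgue_rV R d).
Local Notation V := 'rV[R]_d.
Local Notation H := (L2T lam).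

Definition box (r : R) : set V := [set x | forall i, `|x ord0 i| <= r].

Lemma boxE r : box r = [set x : V | forall i, `[- r, r]%classic (x ord0 i)].
Proof.
apply/seteqP; split=> x h i; have := h i; rewrite /= in_itv/= ler_norml; exact.
Qed.

Lemma measurable_box r : measurable (box r).
Proof.
by rewrite boxE; apply: (@measurable_rV_box R d (fun=> `[- r, r]%classic)) => i; exact: measurable_itv.
Qed.

Lemma lebesgue_box r : 0 < r -> lam (box r) = ((2 * r) ^+ d)%:E.
Proof.
move=> r0; rewrite boxE; apply: etrans (@lebesgue_rV_box R d (fun=> `[- r, r]%classic) _) _.
  by move=> i; exact: measurable_itv.
rewrite lebesgue_measure_itv/= lte_fin (lt_trans _ r0) ?oppr_lt0//.
rewrite prodEFin prodr_const card_ord; congr ((_ ^+ _)%:E); ring.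
Qed.

Lemma lebesgue_box_lty r : 0 < r -> (lam (box r) < +oo)%E.
Proof. by move=> r0; rewrite lebesgue_box// ltry. Qed.

Lemma sqintegrableJ (w : V -> R[i]) : w \in sqintegrable lam ->
  (fun t => conjc (w t)) \in sqintegrable lam.
Proof.
move=> /sqintegrableP[mw woo]; apply/sqintegrableP; split; first exact: cmeasJ.
by under eq_integral do rewrite sqn_conj.
Qed.

Lemma sqn_indM (a : R[i]) (A : set V) t : sqn (a * (\1_A t)%:C%C) = sqn a * \1_A t.
Proof.
by have := sqn_cind a A t; rewrite /cind.
Qed.

Lemma sqintegrable_cut (w : V -> R[i]) (A : set V) : w \in sqintegrable lam ->
  measurable A -> (fun t => w t * (\1_A t)%:C%C) \in sqintegrable lam.
Proof.
move=> /sqintegrableP[mw woo] mA.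
have mwA : cmeas (fun t => w t * (\1_A t)%:C%C).
  by apply: cmeasM => //; apply: cmeas_real; exact: measurable_indic.
apply/sqintegrableP; split => //; apply: le_lt_trans woo; apply: ge0_le_integral => //.
- by move=> t _; rewrite lee_fin sqn_ge0.
- exact: measurable_sqnE.
- exact: measurable_sqnE.
- move=> t _; rewrite lee_fin sqn_indM indicE ler_piMr ?sqn_ge0//.
  by case: (t \in A).
Qed.

Lemma cintegrable_cut (w : V -> R[i]) (A : set V) : w \in sqintegrable lam ->
  measurable A -> (lam A < +oo)%E -> cintegrable lam (fun t => w t * (\1_A t)%:C%C).
Proof.
move=> wL mA Aoo; have wAL := sqintegrable_cut wL mA.
have [mwA _] := sqintegrableP _ _ wAL.
have wi := integrable_sqn (MkL2 wAL); rewrite /= in wi.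
have Ai : lam.-integrable setT (fun t => (\1_A t)%:E).
  apply/integrableP; split; first exact/measurable_EFinP/measurable_indic.
  under eq_integral do rewrite gee0_abs ?lee_fin//.
  by rewrite integral_indic// setIT.
apply: (@le_cintegrable _ _ _ lam _ (fun t => sqn (w t * (\1_A t)%:C%C) + \1_A t)) => //.
  by under eq_fun do rewrite EFinD; exact: integrableD.
move=> t; rewrite normcM normc_real sqn_indM indicE.
case: (t \in A); rewrite ?normr0 ?mulr0 ?addr0// normr1 !mulr1.
exact: normc_le_sqn1.
Qed.

(** On a small box the real parts of all characters of bounded frequency are at
    least 1/2. *)
Lemma box_fourier_lower (rho : R) : 0 < rho -> exists2 e : R, 0 < e &
  exists2 c : R, 0 < c & forall x : V, box rho x ->
    c <= sqn (fourier (fun t => (\1_(box e) t)%:C%C) x).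
Proof.
move=> rho0.
have [r r0 cosr] : exists2 r : R, 0 < r & forall x, `|x| < r -> 2^-1 <= cos x.
  have h2 : 0 < 2^-1 :> R by rewrite invr_gt0.
  have /cvgrPdist_le /(_ _ h2) := @continuous_cos R 0.
  rewrite cos0 => /nbhs_ballP[r /= r0 hr]; exists r => // x xr.
  have := hr x; rewrite /ball/= sub0r normrN => /(_ xr).
  by rewrite ler_norml => /andP[_]; lra.
pose K := 2 * pi * (rho *+ d) + 1.
have K0 : 0 < K by rewrite ltr_wpDl// mulr_ge0 ?mulr_ge0 ?pi_ge0// mulrn_wge0// ltW.
pose e := r / K; have e0 : 0 < e by rewrite divr_gt0.
exists e => //; pose m := (2 * e) ^+ d; have m0 : 0 < m by rewrite exprn_gt0// mulr_gt0.
exists ((2^-1 * m) ^+ 2); first by rewrite exprn_gt0// mulr_gt0// invr_gt0.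
move=> x bx.
have th t : box e t -> 2^-1 <= cos (- (2 * pi * dotv x t)).
  move=> bt; apply: cosr; rewrite normrN normrM ger0_norm ?mulr_ge0 ?pi_ge0//.
  rewrite dotvC; apply: (@le_lt_trans _ _ (2 * pi * (e * (rho *+ d)))).
    by apply: ler_wpM2l; [rewrite mulr_ge0 ?pi_ge0|exact: dotv_le].
  have -> : 2 * pi * (e * (rho *+ d)) = e * (K - 1) by rewrite /K addrK; ring.
  by rewrite mulrBr /e divfK ?gt_eqF// mulr1 ltrBlDr ltrDl.
have mb := measurable_box e; have boo := lebesgue_box_lty e0.
have onei : cintegrable lam (fun t => (\1_(box e) t)%:C%C).
  split => /=; last exact: integrable0.
  apply/integrableP; split; first exact/measurable_EFinP/measurable_indic.
  under eq_integral do rewrite gee0_abs ?lee_fin//.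
  by rewrite integral_indic// setIT.
have lb : 2^-1 * m <= Re (fourier (fun t => (\1_(box e) t)%:C%C) x).
  have [fi _] := cintegrable_fourier x onei.
  have [oi _] := onei; rewrite /= in oi.
  have -> : 2^-1 * m = \int[lam]_t (2^-1 * \1_(box e) t).
    rewrite RintegralZl// /Rintegral integral_indic// setIT.
    by rewrite -[X in fine X]/(lam (box e)) lebesgue_box.
  apply: le_Rintegral => //.
    exact: (integrableZl measurableT 2^-1 oi).
  move=> t _; rewrite cReM /= mulr0 subr0 indicE.
  case: (boolP (t \in box e)) => [|_]; last by rewrite !mulr0.
  by rewrite inE !mulr1; exact: th.
have lb0 : 0 <= 2^-1 * m by rewrite mulr_ge0 ?invr_ge0// ltW.
apply: (@le_trans _ _ (Re (fourier (fun t => (\1_(box e) t)%:C%C) x) ^+ 2)).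
  by rewrite lerXn2r// nnegrE// (le_trans lb0).
by rewrite /sqn lerDl sqr_ge0.
Qed.

End boxes.


Section vanishing.
Context {R : realType} {d : nat}.
Local Notation lam := (lebesgue_rV R d).
Local Notation V := 'rV[R]_d.
Local Notation H := (L2T lam).
Implicit Types (s t x y : V).

Lemma ip_iZr (f g : H) : ip f ((0 +i* 1)%C *: g) = Im (cint lam (fun t => f t * conjc (g t))).
Proof.
apply: eq_Rintegral => t _; rewrite l2ZE /reJ cImM cReM cImM cReJ cImJ /=; ring.
Qed.

(** The squared modulus of a complex coefficient in terms of the real inner
    product: the form in which the smallness of coefficients is used below. *)
Lemma sqn_cint_ip (f g : H) : sqn (cint lam (fun t => f t * conjc (g t))) =
  ip f g ^+ 2 + ip f ((0 +i* 1)%C *: g) ^+ 2.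
Proof.
rewrite ip_iZr /sqn; congr (_ ^+ 2 + _); apply: eq_Rintegral => t _.
by rewrite reJE.
Qed.

Lemma measurable_ip_refl (f g : H) : measurable_fun setT (fun z : V * V => ip (refl z f) g).
Proof.
have mf := l2_cmeas f; have mg := l2_cmeas g.
have mF : cmeas (fun w : (V * V) * V => expi (2 * pi * dotv (2 *: w.1.2) (w.2 - w.1.1)) *
    f (2 *: w.1.1 - w.2) * conjc (g w.2)).
  have m11 : measurable_fun setT (fun w : (V * V) * V => w.1.1).
    exact: (measurableT_comp measurable_fst).
  have m12 : measurable_fun setT (fun w : (V * V) * V => w.1.2).
    exact: (measurableT_comp measurable_snd).
  apply: cmeasM; last by apply: cmeasJ; exact: (cmeas_comp mg).
  apply: cmeasM; last first.
    by apply: (cmeas_comp mf); apply: measurable_rVB => //; exact: measurable_rVZ.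
  apply: cmeas_expi; apply: measurable_funM => //; apply: measurable_dotv2.
    exact: measurable_rVZ.
  by apply: measurable_rVB.
have [+ _] := cmeas_cint lam mF; apply: eq_measurable_fun => z _.
by apply: eq_Rintegral => t _; rewrite reJE reflE.
Qed.

Variable f : H.

(** The product whose Fourier transform at -2 xi is, for s = 2 x, the Wigner
    distribution at (x, xi), up to a constant and a phase. *)
Definition autoproduct s t : R[i] := f (s - t) * conjc (f t).

Lemma refl_half s t : refl (2^-1 *: s, 0) f t = f (s - t).
Proof. by rewrite reflE /= scaler0 dotv0l mulr0 expi0 mul1r scalerA divff// scale1r. Qed.

Lemma cintegrable_autoproduct s : cintegrable lam (autoproduct s).
Proof.
have := cintegrable_l2 (refl (2^-1 *: s, 0) f) f.
by under eq_fun do rewrite refl_half.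
Qed.

Lemma autoproduct_bound s : \int[lam]_t normc (autoproduct s t) <= 2 * nsq f.
Proof.
have fi := integrable_sqn f; have gi := integrable_sqn (refl (2^-1 *: s, 0) f).
have -> : 2 * nsq f = \int[lam]_t (sqn (refl (2^-1 *: s, 0) f t) + sqn (f t)).
  by rewrite RintegralD// -!nsqE nsq_refl mulr2n mulrDl mul1r.
apply: le_Rintegral => //.
- exact: cintegrable_normc (cintegrable_autoproduct s).
- by apply: (integrableD measurableT gi fi).
- move=> t _; rewrite refl_half normcM normc_conj !sqnE.
  have := sqr_ge0 (normc (f (s - t)) - normc (f t)).
  have := sqr_ge0 (normc (f (s - t)) + normc (f t)).
  by move: (normc _) (normc _) => a b; nra.
Qed.

(** Only the real part of the Fourier coefficient of autoproduct, rotated by a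
    phase, enters ip. *)
Lemma ip_refl_fourier x xi : ip (refl (x, xi) f) f ^+ 2 <=
  sqn (fourier (autoproduct (2 *: x)) (- (2 *: xi))).
Proof.
pose k : R[i] := expi (- (2 * pi * dotv (2 *: xi) x)).
have -> : ip (refl (x, xi) f) f = Re (k * fourier (autoproduct (2 *: x)) (- (2 *: xi))).
  rewrite -cintZ; last exact/cintegrable_fourier/cintegrable_autoproduct.
  apply: eq_Rintegral => t _; rewrite reJE reflE /k /autoproduct mulrA -expiD.
  rewrite !mulrA; congr (Re (expi _ * _ * _)).
  by rewrite !dotvE /=; ring.
rewrite -[leRHS]mul1r -[1](sqn_expi (- (2 * pi * dotv (2 *: xi) x))) -sqnM.
by rewrite /sqn lerDl sqr_ge0.
Qed.

Variables (e rad : R).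
Hypothesis e0 : 0 < e.
Hypothesis rad0 : 0 < rad.

Definition window : H := cindL2 1 (measurable_box e) (lebesgue_box_lty e0).

Lemma windowE t : window t = (\1_(box e) t)%:C%C.
Proof. by rewrite /= /cind mul1r. Qed.

Lemma box_even r t : box r (- t) = box r t.
Proof.
by apply/propext; split => h i; have := h i; rewrite mxE normrN.
Qed.

Lemma indic_box_sub r s t : (\1_(box r) (s - t) : R) = \1_(box r) (t - s).
Proof.
rewrite !indicE; congr (nat_of_bool _)%:R; apply/idP/idP; rewrite !inE -opprB box_even//.
Qed.

Let rad1 := 2 * rad + e.
Let rad10 : 0 < rad1. Proof. by rewrite addr_gt0// mulr_gt0. Qed.

(* For x in the box of radius rad and t within e of y, the point 2 x - t is
   within rad1 of - y. *)
Let near_neg y : set V := [set t | box rad1 (t + y)].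
Let near_pos y : set V := [set t | box e (t - y)].

Let mnear_neg y : measurable (near_neg y).
Proof.
have := shift_measurable (- y) measurableT (measurable_box rad1).
by rewrite setTI; congr measurable; apply/funext => t; rewrite /near_neg /= opprK.
Qed.

Let mnear_pos y : measurable (near_pos y).
Proof. by have := shift_measurable y measurableT (measurable_box e); rewrite setTI. Qed.

Let near_neg_mass y : lam (near_neg y) = lam (box rad1).
Proof.
rewrite -(shift_preserving (- y) (measurable_box rad1)); congr (lam _).
by apply/funext => t; rewrite /near_neg /= opprK.
Qed.

Let near_pos_mass y : lam (near_pos y) = lam (box e).
Proof. exact: (shift_preserving y (measurable_box e)). Qed.

Let u y t : R[i] := f t * (\1_(near_neg y) t)%:C%C.
Let v y t : R[i] := conjc (f t) * (\1_(near_pos y) t)%:C%C.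

Let uL y : u y \in sqintegrable lam.
Proof. exact: sqintegrable_cut (l2funP f) (mnear_neg y). Qed.

Let ui y : cintegrable lam (u y).
Proof.
apply: cintegrable_cut (l2funP f) (mnear_neg y) _.
by rewrite near_neg_mass lebesgue_box_lty.
Qed.

Let vi y : cintegrable lam (v y).
Proof.
apply: (cintegrable_cut (sqintegrableJ (l2funP f)) (mnear_pos y)).
by rewrite near_pos_mass lebesgue_box_lty.
Qed.

Let normc_uv_le y s t : normc (u y (s - t) * v y t) <= normc (autoproduct s t).
Proof.
rewrite /u /v /autoproduct !normcM !normc_real !indicE.
case: (_ \in _); case: (_ \in _); rewrite ?normr0 ?normr1 ?mulr0 ?mul0r ?mulr1 ?mulr_ge0 ?normc_ge0//.
Qed.

Let muv : cmeas (fun z : (V * V) * V => u z.1.2 (2 *: z.1.1 - z.2) * v z.1.2 z.2).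
Proof.
have mf := l2_cmeas f.
have mz1 : measurable_fun setT (fun z : (V * V) * V => 2 *: z.1.1 - z.2).
  apply: measurable_rVB => //; apply: measurable_rVZ.
  exact: (measurableT_comp measurable_fst).
have mz2 : measurable_fun setT (fun z : (V * V) * V => z.1.2).
  exact: (measurableT_comp measurable_snd).
have ind r : measurable_fun setT (\1_(box r) : V -> R).
  by apply: measurable_indic; exact: measurable_box.
apply: cmeasM; apply: cmeasM.
- exact: (cmeas_comp mf).
- apply: cmeas_real; have := ind rad1.
  move=> /measurableT_comp /(_ (measurable_rVD mz1 mz2)).
  by apply: eq_measurable_fun => z _; rewrite !indicE.
- by apply: cmeasJ; exact: (cmeas_comp mf).
- apply: cmeas_real; have := ind e.
  have mz3 : measurable_fun setT (fun z : (V * V) * V => z.2) by exact: measurable_snd.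
  move=> /measurableT_comp /(_ (measurable_rVB mz3 mz2)).
  by apply: eq_measurable_fun => z _; rewrite !indicE.
Qed.

Let uvi y s : cintegrable lam (fun t => u y (s - t) * v y t).
Proof.
apply: le_cintegrable (cintegrable_normc (cintegrable_autoproduct s)) (normc_uv_le y s).
have := cmeas_comp muv (measurable_pair1 (2^-1 *: s, y)).
by congr cmeas; apply/funext => t /=; rewrite scalerA divff// scale1r.
Qed.

Let conv_uv_bound y s : normc (conv (u y) (v y) s) <= 2 * nsq f.
Proof.
apply: le_trans (normc_cint_le (uvi y s)) _; apply: le_trans (autoproduct_bound s).
apply: le_Rintegral => //; try exact: cintegrable_normc (cintegrable_autoproduct s).
exact: cintegrable_normc (uvi y s).
Qed.

Local Notation chi := (fun t : V => (\1_(box e) t)%:C%C).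

Let chii : cintegrable lam chi.
Proof.
split => /=; last exact: integrable0.
apply/integrableP; split; first by apply/measurable_EFinP; apply: measurable_indic; exact: measurable_box.
under eq_integral do rewrite gee0_abs ?lee_fin//.
rewrite integral_indic//; last exact: measurable_box.
by rewrite setIT; exact: lebesgue_box_lty.
Qed.

Let chiF_le s y t : normc (chi (y - t) * autoproduct s t) <= normc (autoproduct s t).
Proof.
rewrite normcM normc_real indicE ger0_norm// ler_piMl ?normc_ge0//.
by case: (_ \in _).
Qed.

Let chiFi s y : cintegrable lam (fun t => chi (y - t) * autoproduct s t).
Proof.
apply: le_cintegrable (cintegrable_normc (cintegrable_autoproduct s)) (chiF_le s y).
apply: cmeasM; last exact: cintegrable_cmeas (cintegrable_autoproduct s).
apply: (cmeas_comp (cintegrable_cmeas chii)); by apply: measurable_rVB.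
Qed.

Let conv_chi_bound s y : normc (conv chi (autoproduct s) y) <= 2 * nsq f.
Proof.
apply: le_trans (normc_cint_le (chiFi s y)) _; apply: le_trans (autoproduct_bound s).
apply: le_Rintegral => //; try exact: cintegrable_normc (cintegrable_autoproduct s).
exact: cintegrable_normc (chiFi s y).
Qed.

(** Exchanging the roles of the point and of the translation parameter: a
    window on the second factor forces a window on the first one. *)
Let conv_exchange x y : box rad x ->
  conv chi (autoproduct (2 *: x)) y = conv (u y) (v y) (2 *: x).
Proof.
move=> bx; apply: eq_cint => t; rewrite indic_box_sub /autoproduct /u /v.
have -> : \1_(near_pos y) t = \1_(box e) (t - y) :> R by rewrite !indicE.
rewrite [in LHS]indicE [\1_(box e) _]indicE.
case: (boolP (t - y \in box e)) => [|_]; last by rewrite mul0r !mulr0.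
rewrite inE => bt.
rewrite indicE mem_set; first by rewrite !mulr1 mul1r.
move=> i; rewrite /near_neg /= !mxE.
have -> : 2 * x ord0 i - t ord0 i + y ord0 i = 2 * x ord0 i - (t ord0 i - y ord0 i) by ring.
apply: le_trans (ler_normB _ _) _; rewrite /rad1 normrM ger0_norm//.
have := bt i; have := bx i; rewrite !mxE => ? ?.
by rewrite lerD// ler_wpM2l.
Qed.

Variable (S c : R).
Hypothesis c0 : 0 < c.
Hypothesis chi_low : forall x, box (2 * rad) x -> c <= sqn (fourier chi x).
Hypothesis S_bound : forall z,
  ip f (tfshift z window) ^+ 2 + ip f ((0 +i* 1)%C *: tfshift z window) ^+ 2 <= S.

(** The Fourier transform of f cut off around y by the window is, up to a phase
    and a conjugation, the coefficient of f against a shift of the window. *)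
Let fourier_v_bound y x : sqn (fourier (v y) x) <= S.
Proof.
apply: le_trans (S_bound (y, - x)); rewrite -sqn_cint_ip -(sqn_conj (cint _ _)).
rewrite -cintJ; last exact: cintegrable_l2.
rewrite -[leRHS]mul1r -[1](sqn_expi (- (pi * dotv x y))) -sqnM -cintZ; last first.
  exact/cintegrableJ/cintegrable_l2.
rewrite le_eqVlt; apply/orP; left; apply/eqP; congr sqn; apply: eq_cint => t.
rewrite tfshiftE windowE /v conjcM conjcK /=.
have -> : \1_(near_pos y) t = \1_(box e) (t - y) :> R by rewrite !indicE.
have -> : expi (- (2 * pi * dotv x t)) =
    expi (- (pi * dotv x y)) * expi (2 * pi * dotv (- x) (t - 2^-1 *: y)).
  by rewrite -expiD; congr expi; rewrite !dotvE; field.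
ring.
Qed.

Let uH y : H := MkL2 (uL y).

(** First use of the Plancherel identity, for u and for u * v: the supremum of
    the Fourier transform of v comes out of the integral. *)
Let energy_conv_uv y :
  (\int[lam]_s (sqn (conv (u y) (v y) s))%:E <= S%:E * (nsq (uH y))%:E)%E.
Proof.
have m0 := @poisson_mass_gt0 R d.
rewrite -(@lee_pmul2l _ (@poisson_mass R d)%:E) ?lte_fin//.
rewrite -(conv_plancherel (ui y) (vi y) (uvi y) (conv_uv_bound y)).
have mu := cmeas_fourier (cintegrable_cmeas (ui y)).
have mv := cmeas_fourier (cintegrable_cmeas (vi y)).
have S0 : 0 <= S by apply: le_trans (S_bound 0); rewrite addr_ge0// sqr_ge0.
apply: (@le_trans _ _ (\int[lam]_x (S%:E * (sqn (fourier (u y) x))%:E))%E).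
  apply: ge0_le_integral => //.
  - by move=> x _; rewrite lee_fin mulr_ge0 ?sqn_ge0.
  - by apply/measurable_EFinP; apply: measurable_funM; exact: measurable_sqn.
  - by apply: measurable_funeM; exact: measurable_sqnE.
  - by move=> x _; rewrite -EFinM lee_fin mulrC ler_wpM2r ?sqn_ge0.
rewrite ge0_integralZl_EFin//; last 2 first.
- by move=> x _; rewrite lee_fin sqn_ge0.
- exact: measurable_sqnE.
by rewrite (@plancherel _ _ (uH y) (ui y)) EFinM muleCA.
Qed.

Let G (z : V * V) := (sqn (u z.1 z.2))%:E.

Let mG : measurable_fun setT G.
Proof.
apply: measurable_sqnE; apply: cmeasM; first exact: (cmeas_comp (l2_cmeas f)).
apply: cmeas_real; have m1 : measurable_fun setT (\1_(box rad1) : V -> R).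
  by apply: measurable_indic; exact: measurable_box.
have := measurableT_comp m1 (measurable_rVD (@measurable_snd _ _ V V) (@measurable_fst _ _ V V)).
by apply: eq_measurable_fun => z _; rewrite /= !indicE.
Qed.

Let mcut_energy : measurable_fun setT (fun y => (nsq (uH y))%:E).
Proof.
have G0 z : (0 <= G z)%E by rewrite lee_fin sqn_ge0.
have := @measurable_fun_fubini_tonelli_F _ _ V V R lam G mG G0.
by apply: eq_measurable_fun => y _; rewrite EFin_nsq.
Qed.

(** Every point t belongs to near_neg y for a set of y of constant measure. *)
Let total_cut_mass : (\int[lam]_y (nsq (uH y))%:E = (nsq f)%:E * lam (box rad1))%E.
Proof.
transitivity (\int[lam]_y \int[lam]_t G (y, t))%E.
  by apply: eq_integral => y _; rewrite EFin_nsq.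
rewrite (@fubini_tonelli _ _ _ _ _ lam lam G mG); last by move=> z; rewrite lee_fin sqn_ge0.
transitivity (\int[lam]_t ((sqn (f t))%:E * lam (box rad1)))%E.
  apply: eq_integral => t _.
  transitivity (\int[lam]_y ((sqn (f t))%:E * (\1_(near_neg t) y)%:E))%E.
    apply: eq_integral => y _; rewrite /G /= /u sqn_indM EFinM; congr (_ * _%:E)%E.
    by rewrite !indicE; congr (nat_of_bool _)%:R; apply/idP/idP; rewrite !inE /near_neg /= addrC.
  rewrite ge0_integralZl_EFin ?sqn_ge0//; last first.
    by apply/measurable_EFinP; apply: measurable_indic; exact: mnear_neg.
  by rewrite integral_indic// setIT; congr (_ * _)%E; exact: near_neg_mass.
rewrite ge0_integralZr ?EFin_nsq//; last by move=> t _; rewrite lee_fin sqn_ge0.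
by apply: measurable_sqnE; exact: l2_cmeas.
Qed.


(** Second use: the transform of the window is bounded below on the bounded
    frequencies, so it can be inserted in the integral over xi, where it turns
    autoproduct into its convolution with the window. *)
Let energy_xi x : box rad x ->
  (\int[lam]_xi (\1_(box rad) xi * ip (refl (x, xi) f) f ^+ 2)%:E <=
   (c^-1 * 2^-1 ^+ d * @poisson_mass R d)%:E *
   \int[lam]_y (sqn (conv (u y) (v y) (2 *: x)))%:E)%E.
Proof.
move=> bx; pose A := autoproduct (2 *: x).
have Ai := cintegrable_autoproduct (2 *: x).
have mA := cmeas_fourier (cintegrable_cmeas Ai).
have mchi := cmeas_fourier (cintegrable_cmeas chii).
pose g w : \bar R := (sqn (fourier chi w) * sqn (fourier A w))%:E.
have mg : measurable_fun setT g.
  by apply/measurable_EFinP; apply: measurable_funM; exact: measurable_sqn.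
have g0 w : (0 <= g w)%E by rewrite lee_fin mulr_ge0 ?sqn_ge0.
have n2 : - 2 != 0 :> R by rewrite oppr_eq0.
have E1 := ge0_integral_affine 0 n2 mg g0.
have E2 := conv_plancherel chii Ai (chiFi (2 *: x)) (conv_chi_bound (2 *: x)).
have E3 : (\int[lam]_y (sqn (conv (u y) (v y) (2 *: x)))%:E =
    \int[lam]_y (sqn (conv chi A y))%:E)%E.
  by apply: eq_integral => y _; rewrite conv_exchange.
rewrite E3 EFinM -muleA -E2 -[X in (_ * X)%E]/(\int[lam]_w g w)%E.
have -> : ((c^-1 * 2^-1 ^+ d)%:E * \int[lam]_w g w =
    \int[lam]_xi ((c^-1)%:E * g (- 2 *: xi + 0)%R))%E.
  have ci0 : 0 <= c^-1 by rewrite invr_ge0 ltW.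
  have mg2 := measurableT_comp mg (affine_meas (-2) (0 : V)).
  have Z := ge0_integralZl_EFin lam measurableT (fun xi _ => g0 (- 2 *: xi + 0)) mg2 ci0.
  apply: etrans (esym Z); rewrite E1 normrN (ger0_norm (ler0n _ 2)).
  by move: (\int[lam]_w g w)%E => I; rewrite exprVn EFinM muleA.
clear E1 E2 E3; apply: ge0_le_integral => //.
- by move=> xi _; rewrite lee_fin mulr_ge0 ?sqr_ge0.
- apply/measurable_EFinP; apply: measurable_funM.
    by apply: measurable_indic; exact: measurable_box.
  apply: measurable_funX; exact: (measurableT_comp (measurable_ip_refl f f) (measurable_pair1 x)).
- by apply: measurable_funeM; exact: (measurableT_comp mg (affine_meas (-2) 0)).
- move=> xi _; rewrite -EFinM lee_fin indicE.
  case: (boolP (xi \in _)) => [|_]; last first.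
    by rewrite mul0r !mulr_ge0 ?sqn_ge0 ?invr_ge0// ltW.
  rewrite inE mul1r addr0 scaleNr => bxi.
  apply: le_trans (ip_refl_fourier x xi) _; rewrite mulrA ler_peMl ?sqn_ge0//.
  rewrite mulrC ler_pdivlMr// mul1r; apply: chi_low => i.
  by rewrite !mxE normrN normrM ger0_norm// ler_wpM2l.
Qed.

(** The bound energy_xi is integrated in x, the order of the integrals in x and y
    is exchanged, and for each y the integral over x is that of energy_conv_uv,
    up to the scaling s = 2 x. *)
Lemma box_energy_le :
  (\int[lam]_x \int[lam]_xi (\1_(box rad) x * \1_(box rad) xi * ip (refl (x, xi) f) f ^+ 2)%:E <=
   (c^-1 * 2^-1 ^+ d * @poisson_mass R d * (2^-1 ^+ d * (2 * rad1) ^+ d) * S * nsq f)%:E)%E.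
Proof.
pose C1 := c^-1 * 2^-1 ^+ d * @poisson_mass R d.
have C10 : 0 <= C1.
  by rewrite !mulr_ge0 ?invr_ge0 ?exprn_ge0 ?(ltW c0) ?(ltW (@poisson_mass_gt0 R d)).
pose K (z : V * V) := (sqn (conv (u z.2) (v z.2) (2 *: z.1)))%:E.
have mK : measurable_fun setT K.
  apply: measurable_sqnE.
  exact: (cmeas_cint lam muv).
have K0 z : (0 <= K z)%E by rewrite lee_fin sqn_ge0.
apply: (@le_trans _ _ (\int[lam]_x (C1%:E * \int[lam]_y K (x, y)))%E).
  apply: ge0_le_integral => //.
  - by move=> x _; apply: integral_ge0 => xi _; rewrite lee_fin mulr_ge0 ?sqr_ge0// mulr_ge0.
  - apply: (@measurable_fun_fubini_tonelli_F _ _ V V R lam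
      (fun z => (\1_(box rad) z.1 * \1_(box rad) z.2 * ip (refl z f) f ^+ 2)%:E)).
      apply/measurable_EFinP; apply: measurable_funM; last first.
        by apply: measurable_funX; exact: measurable_ip_refl.
      have mb : measurable_fun setT (\1_(box rad) : V -> R).
        by apply: measurable_indic; exact: measurable_box.
      apply: measurable_funM; first exact: (measurableT_comp mb measurable_fst).
      exact: (measurableT_comp mb measurable_snd).
    by move=> z; rewrite lee_fin mulr_ge0 ?sqr_ge0// mulr_ge0.
  - by apply: measurable_funeM; exact: measurable_fun_fubini_tonelli_F.
  - move=> x _; have [bx|nbx] := pselect (box rad x).
      apply: le_trans (energy_xi bx); rewrite le_eqVlt; apply/orP; left; apply/eqP.
      by apply: eq_integral => xi _; rewrite [\1__ x]indicE mem_set// mul1r.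
    under eq_integral => xi _ do rewrite [\1__ x]indicE memNset// !mul0r.
    rewrite integral0 mule_ge0 ?lee_fin//; exact: integral_ge0.
rewrite ge0_integralZl_EFin//; last 2 first.
- by move=> x _; exact: integral_ge0.
- exact: measurable_fun_fubini_tonelli_F.
rewrite (@fubini_tonelli _ _ _ _ _ lam lam K mK)//.
have per_y y : (\int[lam]_x K (x, y) <= (2^-1 ^+ d * S)%:E * (nsq (uH y))%:E)%E.
  have mc : measurable_fun setT (fun s => (sqn (conv (u y) (v y) s))%:E).
    by apply: measurable_sqnE; apply: cmeas_conv; exact: cintegrable_cmeas.
  have c00 s : (0 <= (sqn (conv (u y) (v y) s))%:E)%E by rewrite lee_fin sqn_ge0.
  have n2 : 2 != 0 :> R by [].
  have := ge0_integral_affine 0 n2 mc c00; rewrite ger0_norm// -exprVn.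
  move=> E; rewrite (_ : (\int[lam]_x K (x, y) = (2^-1 ^+ d)%:E *
     \int[lam]_s (sqn (conv (u y) (v y) s))%:E)%E); last first.
    apply: etrans E; apply: eq_integral => x _.
    by rewrite [2 *: x + 0]addr0.
  rewrite EFinM -muleA; apply: lee_wpmul2l; last exact: energy_conv_uv.
  by rewrite lee_fin exprn_ge0// invr_ge0.
apply: (@le_trans _ _ (C1%:E * \int[lam]_y ((2^-1 ^+ d * S)%:E * (nsq (uH y))%:E))%E).
  apply: lee_wpmul2l; first by rewrite lee_fin.
  apply: ge0_le_integral => //.
  - by move=> y _; exact: integral_ge0.
  - exact: measurable_fun_fubini_tonelli_G.
  - apply: measurable_funeM; exact: mcut_energy.
rewrite ge0_integralZl_EFin//; last 2 first.
- by move=> y _; rewrite lee_fin nsq_ge0.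
- by rewrite mulr_ge0 ?exprn_ge0 ?invr_ge0// (le_trans _ (S_bound 0))// addr_ge0// sqr_ge0.
rewrite total_cut_mass lebesgue_box// -!EFinM lee_fin.
by rewrite le_eqVlt; apply/orP; left; apply/eqP; rewrite /C1; ring.
Qed.

End vanishing.

(** The window phi is the indicator of a box so small that its Fourier transform
    is bounded below at the frequencies that occur, as box_energy_le requires.
    Since S bounds squared moduli of coefficients, the estimate says that
    vanishing of f along all time-frequency shifts forces its Wigner
    distribution to vanish locally. *)
Lemma vanishing_estimate (R : realType) (d : nat) (rad : R) : 0 < rad ->
  exists phi : L2T (lebesgue_rV R d), exists2 C : R, 0 <= C &
  forall (f : L2T (lebesgue_rV R d)) (S : R),
  (forall z, ip f (tfshift z phi) ^+ 2 + ip f ((0 +i* 1)%C *: tfshift z phi) ^+ 2 <= S) ->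
  (\int[lebesgue_rV R d]_x \int[lebesgue_rV R d]_xi
     (\1_(box rad) x * \1_(box rad) xi * ip (refl (x, xi) f) f ^+ 2)%:E
   <= (C * S * nsq f)%:E)%E.
Proof.
move=> rad0; have rad20 : 0 < 2 * rad by rewrite mulr_gt0.
have [e e0 [c c0 hc]] := @box_fourier_lower R d _ rad20.
exists (window e0).
exists (c^-1 * 2^-1 ^+ d * @poisson_mass R d * (2^-1 ^+ d * (2 * (2 * rad + e)) ^+ d)).
  by rewrite !mulr_ge0 ?exprn_ge0 ?invr_ge0 ?(ltW c0) ?(ltW (@poisson_mass_gt0 R d))// mulr_ge0// addr_ge0 ?ltW.
move=> f S hS; exact: (box_energy_le rad0 c0 hc hS).
Qed.


(** * Norms of bounded functions supported in sets of finite measure *)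

Section Lp_norm.
Context {d} {T : measurableType d} {R : realType}.
Variable mu : {measure set T -> \bar R}.
Variable p : R.
Hypothesis p1 : 1 <= p.
Implicit Types F G : T -> R.

Let p0 : 0 < p. Proof. exact: lt_le_trans p1. Qed.

Definition Lpn F : \bar R := 'N[mu]_p%:E[EFin \o F]%E.

Lemma LpnE F : Lpn F = ((\int[mu]_x ((`|F x| `^ p)%:E)) `^ p^-1)%E.
Proof.
by rewrite /Lpn unlock; congr poweR.
Qed.

Lemma Lpn_ge0 F : (0 <= Lpn F)%E. Proof. exact: Lnorm_ge0. Qed.

Lemma measurable_powR_norm F : measurable_fun setT F ->
  measurable_fun setT (fun x => (`|F x| `^ p)%:E).
Proof.
move=> mF; apply/measurable_EFinP.
apply: (@measurableT_comp _ _ _ _ _ _ (@powR R ^~ p)) => //.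
exact: measurableT_comp.
Qed.

Lemma le_Lpn F G : measurable_fun setT F -> measurable_fun setT G ->
  (forall x, `|F x| <= `|G x|) -> (Lpn F <= Lpn G)%E.
Proof.
move=> mF mG FG; rewrite !LpnE; apply: gt0_ler_poweR.
- by rewrite invr_ge0 ltW.
- by rewrite in_itv/= leey andbT; apply: integral_ge0 => x _; rewrite lee_fin powR_ge0.
- by rewrite in_itv/= leey andbT; apply: integral_ge0 => x _; rewrite lee_fin powR_ge0.
apply: ge0_le_integral => //; try exact: measurable_powR_norm.
by move=> x _; rewrite lee_fin ge0_ler_powR ?nnegrE ?(ltW p0).
Qed.

Lemma LpnD F G : measurable_fun setT F -> measurable_fun setT G ->
  (Lpn (fun x => F x + G x)%R <= Lpn F + Lpn G)%E.
Proof. by move=> mF mG; exact: minkowski_EFin. Qed.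

Lemma LpnZ c F : measurable_fun setT F -> Lpn (fun x => c * F x)%R = (`|c|%:E * Lpn F)%E.
Proof.
move=> mF; rewrite !LpnE.
under eq_integral do rewrite normrM powRM// EFinM.
rewrite ge0_integralZl_EFin ?powR_ge0//; last exact: measurable_powR_norm.
rewrite poweRM ?lee_fin ?powR_ge0//; last first.
  by apply: integral_ge0 => x _; rewrite lee_fin powR_ge0.
by rewrite poweR_EFin -powRrM mulfV ?gt_eqF// powRr1.
Qed.

Lemma Lpn_le (e : R) F : 0 <= e ->
  (\int[mu]_x ((`|F x| `^ p)%:E) <= (e `^ p)%:E)%E -> (Lpn F <= e%:E)%E.
Proof.
move=> e0 h; have -> : e%:E = ((e `^ p)%:E `^ p^-1)%E.
  by rewrite poweR_EFin -powRrM mulfV ?gt_eqF// powRr1.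
rewrite LpnE; apply: gt0_ler_poweR => //.
- by rewrite invr_ge0 ltW.
- by rewrite in_itv/= leey andbT; apply: integral_ge0 => x _; rewrite lee_fin powR_ge0.
- by rewrite in_itv/= leey andbT lee_fin powR_ge0.
Qed.

Lemma Lpn_powR F : (Lpn F `^ p = \int[mu]_x ((`|F x| `^ p)%:E))%E.
Proof.
rewrite LpnE -poweRrM mulVf ?gt_eqF// poweRe1//.
by apply: integral_ge0 => x _; rewrite lee_fin powR_ge0.
Qed.

(** Below the threshold eta the power is at most eta `^ p; above it, x ^+ 2 is at
    least eta ^+ 2. *)
Lemma powR_le_quadratic (M eta x : R) : 0 < eta -> `|x| <= M ->
  `|x| `^ p <= eta `^ p + M `^ p * eta ^- 2 * x ^+ 2.
Proof.
move=> eta0 xM; have [xe|ex] := leP `|x| eta.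
  apply: le_trans (_ : _ <= eta `^ p) _; first by rewrite ge0_ler_powR ?nnegrE ?(ltW p0)// ltW.
  by rewrite lerDl mulr_ge0 ?sqr_ge0// mulr_ge0 ?powR_ge0// invr_ge0 exprn_ge0// ltW.
apply: (@le_trans _ _ (M `^ p)).
  by rewrite ge0_ler_powR ?nnegrE ?(ltW p0)// (le_trans _ xM).
apply: ler_wpDl; first exact: powR_ge0.
rewrite -mulrA ler_peMr ?powR_ge0// mulrC ler_pdivlMr ?exprn_gt0// mul1r.
by rewrite -(real_normK (num_real x)) lerXn2r ?nnegrE// ltW.
Qed.

(** Smallness in L^2 on K, and of the measure of the support outside K, controls
    all the norms of functions with a given bound and a given size of support. *)
Lemma Lpn_small (m M e : R) : 0 <= m -> 0 <= M -> 0 < e -> exists2 delta : R, 0 < delta &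
  forall (E K : set T) F, measurable E -> measurable K -> measurable_fun setT F ->
  (forall x, `|F x| <= M) -> (forall x, ~ E x -> F x = 0) -> (mu E <= m%:E)%E ->
  (mu (E `\` K) <= delta%:E)%E ->
  (\int[mu]_x ((\1_K x * F x ^+ 2)%:E) <= delta%:E)%E -> (Lpn F <= e%:E)%E.
Proof.
move=> m0 M0 e0.
have ep0 : 0 < e `^ p by exact: powR_gt0.
pose q := e `^ p / (3 * (m + 1)); have q0 : 0 < q by rewrite divr_gt0// mulr_gt0// ltr_wpDl.
pose eta := q `^ p^-1; have eta0 : 0 < eta by exact: powR_gt0.
have etap : eta `^ p = q by rewrite /eta -powRrM mulVf ?gt_eqF// powRr1// ltW.
have qm : q * m <= e `^ p / 3.
  rewrite /q mulrAC ler_pdivrMr ?mulr_gt0 ?ltr_wpDl//.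
  rewrite (_ : e `^ p / 3 * (3 * (m + 1)) = e `^ p * (m + 1)); last by field.
  by rewrite ler_wpM2l ?(ltW ep0)// lerDl.
pose A := M `^ p * eta ^- 2; pose B := M `^ p.
have A0 : 0 <= A by rewrite mulr_ge0 ?powR_ge0// invr_ge0 exprn_ge0// ltW.
have B0 : 0 <= B by exact: powR_ge0.
pose delta := e `^ p / (3 * (A + B + 1)).
have ab0 : 0 < A + B + 1 by rewrite ltr_wpDl// addr_ge0.
have delta0 : 0 < delta by rewrite divr_gt0// mulr_gt0.
have dA : A * delta + B * delta <= e `^ p / 3.
  rewrite -mulrDl /delta mulrCA ler_pM2l// ler_pdivrMr ?mulr_gt0//.
  rewrite (_ : 3^-1 * (3 * (A + B + 1)) = A + B + 1); last by field.
  by rewrite lerDl.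
exists delta => // E K F mE mK mF FM FE Em EK FK.
apply: Lpn_le; first exact: ltW.
have mind (X : set T) : measurable X -> measurable_fun setT (fun x => (\1_X x : R)%:E).
  by move=> mX; apply/measurable_EFinP; exact: measurable_indic.
have mEK := measurableD mE mK.
have mF2 : measurable_fun setT (fun x => (\1_K x * F x ^+ 2)%:E).
  apply/measurable_EFinP; apply: measurable_funM; last exact: measurable_funX.
  exact: measurable_indic.
apply: (@le_trans _ _ (\int[mu]_x (q%:E * (\1_E x)%:E + (A%:E * (\1_K x * F x ^+ 2)%:E +
    B%:E * (\1_(E `\` K) x)%:E)))%E).
  apply: ge0_le_integral => //.
  - exact: measurable_powR_norm.
  - apply: emeasurable_funD; first by apply: measurable_funeM; exact: mind.
    by apply: emeasurable_funD; apply: measurable_funeM => //; exact: mind.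
  - move=> x _; rewrite -!EFinM -!EFinD lee_fin !indicE.
    have [xE|xE] := pselect (E x); last first.
      rewrite (FE _ xE) normr0 powR0 ?gt_eqF// expr0n/= !mulr0 add0r.
      by rewrite addr_ge0// mulr_ge0// ltW.
    rewrite (mem_set xE).
    have [xK|xK] := pselect (K x).
      rewrite (mem_set xK) memNset; last by case.
      rewrite !mulr1 mulr0 addr0 mul1r -etap.
      exact: powR_le_quadratic.
    rewrite (memNset xK) mem_set// !mulr1 mul0r mulr0 add0r.
    apply: ler_wpDl; first exact: ltW.
    by rewrite ge0_ler_powR ?nnegrE ?(ltW p0)// (le_trans _ (FM x)).
have Z (k : R) (G : T -> \bar R) : 0 <= k -> measurable_fun setT G -> (forall x, 0 <= G x)%E ->
    (\int[mu]_x (k%:E * G x) = k%:E * \int[mu]_x G x)%E.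
  by move=> k0 mG G0; apply: ge0_integralZl_EFin => // x _.
have F0 x : (0 <= (\1_K x * F x ^+ 2)%:E)%E by rewrite lee_fin mulr_ge0// sqr_ge0.
rewrite ge0_integralD//; last 4 first.
- by move=> x _; rewrite -EFinM lee_fin mulr_ge0// ltW.
- by apply: measurable_funeM; exact: mind.
- by move=> x _; rewrite adde_ge0// mule_ge0// lee_fin.
- by apply: emeasurable_funD; apply: measurable_funeM => //; exact: mind.
rewrite ge0_integralD//; last 4 first.
- by move=> x _; rewrite mule_ge0// lee_fin.
- exact: measurable_funeM.
- by move=> x _; rewrite -EFinM lee_fin mulr_ge0.
- by apply: measurable_funeM; exact: mind.
rewrite !Z ?(ltW q0)//; try exact: mind.
rewrite !integral_indic// !setIT.
apply: (@le_trans _ _ (q * m + (A * delta + B * delta))%:E).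
  rewrite !EFinD !EFinM; apply: leeD; first by apply: lee_wpmul2l => //; rewrite lee_fin ltW.
  by apply: leeD; apply: lee_wpmul2l; rewrite ?lee_fin.
by rewrite lee_fin; move: qm dA ep0; move: (q * m) (A * delta + B * delta) => a b; lra.
Qed.

End Lp_norm.


(** * Translations of phase space *)

Lemma overlap_arith (R : realType) (e s a b a' b' eta : R) : 0 <= s -> 0 <= a -> 0 <= b ->
  0 <= b' -> b' <= b -> a - eta <= a' -> b - eta <= b' -> 0 <= eta ->
  2 * (s * (a + b) * eta) <= e -> 2 * (s * (a * b) - s * (a' * b')) <= e.
Proof.
move=> s0 a0 b0 b'0 b'b ha hb eta0 h; apply: le_trans h.
rewrite ler_pM2l// -mulrBr -mulrA ler_wpM2l//.
have -> : a * b - a' * b' = a * (b - b') + b' * (a - a') by ring.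
rewrite mulrDl lerD// ?ler_wpM2l//; first by lra.
by apply: (@le_trans _ _ (b' * eta)); [rewrite ler_wpM2l//; lra|rewrite ler_wpM2r].
Qed.

Section overlap.
Context {R : realType} {d : nat}.
Local Notation lam := (lebesgue_rV R d).
Local Notation V := 'rV[R]_d.

Definition overlap (A : set V) (a : V) : set V := A `&` [set t | A (t + a)].

Lemma measurable_translate (A : set V) a : measurable A -> measurable [set t | A (t + a)].
Proof.
move=> mA; have := shift_measurable (- a) measurableT mA.
by rewrite setTI; congr measurable; apply/funext => t; rewrite /= opprK.
Qed.

(** Continuity of the translations at an indicator, read as convergence of the
    measure of the overlap. *)
Lemma overlap_cvg (A : set V) (mA : measurable A) (Aoo : (lam A < +oo)%E) (e : R) : 0 < e ->
  exists2 r : R, 0 < r & forall a : V, (forall i, `|a ord0 i| < r) ->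
  fine (lam A) - e <= fine (lam (overlap A a)).
Proof.
move=> e0; pose F := cindL2 1 mA Aoo.
have [r r0 hr] := tfshift_continuity F e0; exists r => // a ar.
have sm : small r (- a, 0 : V).
  by split=> i /=; rewrite mxE ?normrN ?normr0.
have FE t : F t = (\1_A t)%:C%C by rewrite /= /cind mul1r.
have TE t : tfshift (- a, 0) F t = (\1_A (t + a))%:C%C.
  by rewrite tfshiftE /= dotv0l mulr0 expi0 mul1r opprK /cind mul1r.
have indI (X : set V) : measurable X -> \int[lam]_t (\1_X t : R) = fine (lam X).
  by move=> mX; rewrite /Rintegral integral_indic// setIT.
have nF : nsq F = fine (lam A).
  rewrite -indI// nsqE; apply: eq_Rintegral => t _; rewrite FE /sqn /= expr0n addr0 indicE.
  by case: (t \in A); rewrite ?expr0n ?expr1n.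
have iF : ip (tfshift (- a, 0) F) F = fine (lam (overlap A a)).
  rewrite -indI; last by apply: measurableI => //; exact: measurable_translate.
  apply: eq_Rintegral => t _; rewrite TE FE /reJ /= mulr0 addr0 mulrC /overlap indicI /=.
  by congr (_ * _); rewrite !indicE.
have := hr _ sm; rewrite nsqB nsq_tfshift iF nF.
have : 0 <= fine (lam (overlap A a)) by rewrite fine_ge0.
by move: (fine _) (fine _) => x y; lra.
Qed.

End overlap.

Section phase_translation.
Context {R : realType} {d : nat}.
Local Notation lam := (lebesgue_rV R d).
Local Notation Lam := (@lebesgue_phase R d).
Local Notation V := 'rV[R]_d.
Local Notation H2 := (L2T Lam).
Implicit Types (a : V * V).

Lemma ptrans_measurable a : measurable_fun setT (fun z : V * V => z + a).
Proof.
apply/measurable_fun_pairP; split.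
  by apply: measurable_rVD; [exact: measurable_fst|exact: measurable_cst].
by apply: measurable_rVD; [exact: measurable_snd|exact: measurable_cst].
Qed.

Lemma ge0_integral_ptrans a (G : V * V -> \bar R) : measurable_fun setT G ->
  (forall z, 0 <= G z)%E -> (\int[Lam]_z G (z + a)%R = \int[Lam]_z G z)%E.
Proof.
move=> mG G0.
have mGa : measurable_fun setT (fun z : V * V => G (z + a)) by exact: measurableT_comp mG (ptrans_measurable a).
have FT (K : V * V -> \bar R) : measurable_fun setT K -> (forall z, 0 <= K z)%E ->
    (\int[Lam]_z K z = \int[lam]_x \int[lam]_y K (x, y))%E.
  by move=> mK K0; exact: (@fubini_tonelli1 _ _ V V R lam lam K mK K0).
rewrite (FT (fun z => G (z + a)%R) mGa (fun z => G0 _)) (FT G mG G0).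
have mI := @measurable_fun_fubini_tonelli_F _ _ V V R lam G mG G0.
rewrite -[RHS](ge0_integral_translate (- a.1) mI); last by move=> x; exact: integral_ge0.
apply: eq_integral => x _.
have mGx : measurable_fun setT (fun y => G (x - - a.1, y)).
  by apply: (measurableT_comp mG); exact: measurable_pair1.
rewrite -[RHS](ge0_integral_translate (- a.2) mGx (fun y => G0 _)).
by apply: eq_integral => y _; rewrite !opprK.
Qed.

Lemma ptrans_preserving a (A : set (V * V)) : measurable A ->
  Lam ((fun z => z + a) @^-1` A) = Lam A.
Proof.
move=> mA; have mA' : measurable ((fun z : V * V => z + a) @^-1` A).
  by rewrite -[X in measurable X]setTI; exact: ptrans_measurable.
have I (X : set (V * V)) : measurable X -> (\int[Lam]_z (\1_X z)%:E = Lam X)%E.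
  by move=> mX; rewrite integral_indic// setIT.
apply: etrans (esym (I _ mA')) _; apply: etrans _ (I _ mA).
apply: (ge0_integral_ptrans a (G := fun z => (\1_A z)%:E)).
  exact/measurable_EFinP/measurable_indic.
by move=> z; rewrite lee_fin.
Qed.

Definition ptrans a (F : H2) : H2 := wcomp (ptrans_measurable a) (@ptrans_preserving a)
  (cmeas_cst 1) (fun=> etrans (congr1 _ (esym expi0)) (sqn_expi 0)) F.

Lemma ptransE a F z : ptrans a F z = F (z + a).
Proof. by rewrite /= mul1r. Qed.

(** The overlap of a rectangle with its translate is the product of the overlaps
    of its sides. *)
Lemma ptrans_rectangle (A B : set V) (mA : measurable A) (mB : measurable B) (c : R[i])
    (mAB : measurable (A `*` B)) (ABoo : (Lam (A `*` B) < +oo)%E) :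
  continuity_vectors small ptrans (cindL2 c mAB ABoo).
Proof.
move=> e e0.
have LE X Y : measurable X -> measurable Y -> Lam (X `*` Y) = (lam X * lam Y)%E.
  by move=> mX mY; rewrite /lebesgue_phase product_measure1E.
have nE : nsq (cindL2 c mAB ABoo) = sqn c * fine (Lam (A `*` B)).
  have -> : fine (Lam (A `*` B)) = \int[Lam]_x \1_(A `*` B) x.
    by rewrite /Rintegral integral_indic// setIT.
  rewrite nsqE -RintegralZl//.
    by apply: eq_Rintegral => z _; rewrite sqn_cind.
  apply/integrableP; split; first exact/measurable_EFinP/measurable_indic.
  under eq_integral do rewrite gee0_abs ?lee_fin//.
  by rewrite integral_indic// setIT.
have [z0|nz] := eqVneq (Lam (A `*` B)) 0%E.
  exists 1 => // a _; apply: le_trans (nsqD_le _ _) _.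
  by rewrite nsqN nsq_wcomp nE z0 /= mulr0 addr0 mulr0 ltW.
have Aoo : (lam A < +oo)%E.
  rewrite ltNge leye_eq; apply/negP => /eqP Ay; move: nz (ABoo); rewrite LE// Ay.
  have [->|B0] := eqVneq (lam B) 0%E; first by rewrite mule0 eqxx.
  by rewrite gt0_mulye ?ltxx// lt0e B0 measure_ge0.
have Boo : (lam B < +oo)%E.
  rewrite ltNge leye_eq; apply/negP => /eqP By; move: nz (ABoo); rewrite LE// By.
  have [->|A0] := eqVneq (lam A) 0%E; first by rewrite mul0e eqxx.
  by rewrite gt0_muley ?ltxx// lt0e A0 measure_ge0.
set al := fine (lam A); set be := fine (lam B).
have al0 : 0 <= al by rewrite fine_ge0. have be0 : 0 <= be by rewrite fine_ge0.
pose k := 2 * (sqn c * (al + be)) + 1.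
have k0 : 0 < k by rewrite ltr_wpDl// mulr_ge0// mulr_ge0 ?sqn_ge0// addr_ge0.
pose eta := e / k; have eta0 : 0 < eta by rewrite divr_gt0.
have [r1 r10 h1] := overlap_cvg mA Aoo eta0.
have [r2 r20 h2] := overlap_cvg mB Boo eta0.
exists (Num.min r1 r2) => [|a [a1 a2]]; first by rewrite lt_min r10.
have {}h1 : al - eta <= fine (lam (overlap A a.1)).
  by apply: h1 => i; apply: lt_le_trans (a1 i) _; rewrite ge_min lexx.
have {}h2 : be - eta <= fine (lam (overlap B a.2)).
  by apply: h2 => i; apply: lt_le_trans (a2 i) _; rewrite ge_min lexx orbT.
have mOA : measurable (overlap A a.1) by apply: measurableI => //; exact: measurable_translate.
have mOB : measurable (overlap B a.2) by apply: measurableI => //; exact: measurable_translate.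
have OA : (lam (overlap A a.1) <= lam A)%E by apply: le_measure; rewrite ?inE//; exact: subIsetl.
have OB : (lam (overlap B a.2) <= lam B)%E by apply: le_measure; rewrite ?inE//; exact: subIsetl.
have OAoo := le_lt_trans OA Aoo; have OBoo := le_lt_trans OB Boo.
pose a' := fine (lam (overlap A a.1)); pose b' := fine (lam (overlap B a.2)).
have nAB : fine (Lam (A `*` B)) = al * be by rewrite LE// fineM// ge0_fin_numE.
have LO : Lam (overlap A a.1 `*` overlap B a.2) = (a' * b')%:E.
  by rewrite LE// EFinM !fineK// ge0_fin_numE.
apply: le_trans (indicator_continuity (r := sqn c * (a' * b')) _ _) _.
- exact: nsq_wcomp.
- rewrite EFinM -LO.
  have mO := measurableX mOA mOB.
  have <- : (\int[Lam]_z (\1_(overlap A a.1 `*` overlap B a.2) z)%:E =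
      Lam (overlap A a.1 `*` overlap B a.2))%E.
    by rewrite integral_indic// setIT.
  rewrite -ge0_integralZl_EFin ?sqn_ge0//; last exact/measurable_EFinP/measurable_indic.
  rewrite [leRHS]integral_mkcond le_eqVlt; apply/orP; left; apply/eqP.
  apply: eq_integral => z _; rewrite patchE ptransE /= /cind !indicE.
  have [zAB|zAB] := boolP (z \in A `*` B); last first.
    rewrite memNset ?mule0// => -[[zA _] [zB _]]; move/negP: zAB; apply.
    by rewrite inE.
  move: zAB; rewrite inE => -[zA zB].
  have -> : (z \in overlap A a.1 `*` overlap B a.2) = (z + a \in A `*` B).
    by apply/idP/idP; rewrite !inE => -[]; [move=> [_ ?] [_ ?]|move=> ? ?]; split.
  rewrite /reJ cReM cImM /= /sqn; case: (_ \in _) => /=; congr EFin; ring.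
- rewrite nAB; apply: (overlap_arith _ al0 be0 _ _ h1 h2 (ltW eta0)) => //.
  + exact: sqn_ge0.
  + by rewrite fine_ge0.
  + by apply: fine_le => //; rewrite ge0_fin_numE.
  + rewrite mulrA mulrC /eta mulrAC ler_pdivrMr// ler_wpM2l ?(ltW e0)//.
    by rewrite /k lerDl.
Qed.

Lemma ptrans_continuity F : continuity_vectors small ptrans F.
Proof.
pose G : set (set (V * V)) := [set A `*` B | A in measurable & B in measurable].
move: F; apply: (@L2_dense _ _ _ Lam G (fun k => ocube k `*` ocube k)).
- exact: measurable_prod_measurableType.
- move=> _ _ [A mA [B mB <-]] [A' mA' [B' mB' <-]].
  exists (A `&` A'); first exact: measurableI.
  exists (B `&` B'); first exact: measurableI.
  by rewrite setXI.
- by move=> k; exists (ocube k); [exact: measurable_obox|exists (ocube k) => //; exact: measurable_obox].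
- apply/seteqP; split => // -[x y] _.
  have [k kx] := mem_ocube x; have [l ly] := mem_ocube y.
  have sub m n (t : V) : (m <= n)%N -> ocube m t -> ocube n t.
    move=> mn h i; have := h i; rewrite /= !in_itv/= => /andP[h1 h2].
    have mnR : m%:R <= n%:R :> R by rewrite ler_nat.
    by apply/andP; split; [apply: le_lt_trans h1; rewrite lerN2|apply: le_trans mnR].
  exists (maxn k l) => //; split; first exact: sub (leq_maxl _ _) kx.
  exact: sub (leq_maxr _ _) ly.
- move=> k; have mk : measurable (@ocube R d k) by exact: measurable_obox.
  apply: (@le_lt_trans _ _ (lam (ocube k) * lam (ocube k))%E).
    by rewrite le_eqVlt; apply/orP; left; apply/eqP; exact: product_measure1E.
  by rewrite lte_mul_pinfty// ?ge0_fin_numE// lebesgue_ocube_lty.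
- apply: continuity_vectors_closed.
  + by move=> r s z rs [h1 h2]; split=> i; [apply: lt_le_trans (h1 i) rs|apply: lt_le_trans (h2 i) rs].
  + by move=> *; exact: wcompD.
  + by move=> *; exact: wcompZ.
  + by move=> *; exact: nsq_wcomp.
- move=> c AB mAB ABoo [A mA [B mB E]]; subst AB; exact: ptrans_rectangle.
Qed.

End phase_translation.


(** * Weakly null sequences along an ultrafilter *)

Section weakly_null.
Context {R : realType} {d : nat}.
Local Notation lam := (lebesgue_rV R d).
Local Notation V := 'rV[R]_d.
Local Notation H := (L2T lam).
Variable U : set_system nat.
Context {UU : UltraFilter U}.
Implicit Types (g h : H) (k : nat -> H) (z : nat -> V * V).

Definition weakly_null k := forall h, (fun n => ip h (k n)) @ U --> (0 : R).

Lemma weakly_null_near k : weakly_null k -> forall h (e : R), 0 < e ->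
  \forall n \near U, `|ip h (k n)| <= e.
Proof.
move=> kw h e e0; have /cvgrPdist_le /(_ _ e0) := kw h.
by apply: filterS => n; rewrite sub0r normrN.
Qed.

Lemma ip_unimodular_le (c : R[i]) (f g : H) : sqn c = 1 ->
  `|ip (c *: f) g| <= `|ip f g| + `|ip ((0 +i* 1)%C *: f) g|.
Proof.
case: c => a b; rewrite /sqn /= => ab1.
have -> : (a +i* b)%C = a%:C%C + b%:C%C * (0 +i* 1)%C by apply: eqcP => /=; ring.
rewrite scalerDl -scalerA ipDl !ipZl; apply: le_trans (ler_normD _ _) _.
have le1 (x y : R) : x ^+ 2 + y ^+ 2 = 1 -> `|x| <= 1.
  move=> xy; rewrite -(ler_pXn2r (n := 2))// ?nnegrE// real_normK ?num_real// expr1n -xy.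
  by rewrite lerDl sqr_ge0.
rewrite !normrM; apply: lerD; rewrite ler_piMl//; first exact: le1 ab1.
by apply: (le1 b a); rewrite addrC.
Qed.

Lemma nrm_unimodular (c : R[i]) (f : H) : sqn c = 1 -> nrm (c *: f) = nrm f.
Proof. by move=> c1; rewrite nrmZ normc_sqrt c1 sqrtr1 mul1r. Qed.

Definition bounded_by (r : R) (w : V * V) :=
  (forall i, `|w.1 ord0 i| <= r) /\ (forall i, `|w.2 ord0 i| <= r).

(** The limit w exists by compactness; moving z n to w costs a phase and a shift
    by z n - w, which tends to the identity on g. *)
Lemma tfshift_subsequence z g (r : R) : (forall n, bounded_by r (z n)) ->
  exists w, exists2 c : nat -> R[i], (forall n, sqn (c n) = 1) &
  forall e : R, 0 < e -> \forall n \near U,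
    nrm (tfshift (z n) g - c n *: tfshift w g) <= e.
Proof.
move=> zr.
have /choice[w1 w1P] : forall i, exists l : R, (fun n => (z n).1 ord0 i) @ U --> l.
  by move=> i; apply: (@ultra_bounded_cvg _ _ _ _ r) => n; case: (zr n).
have /choice[w2 w2P] : forall i, exists l : R, (fun n => (z n).2 ord0 i) @ U --> l.
  by move=> i; apply: (@ultra_bounded_cvg _ _ _ _ r) => n; case: (zr n).
pose w : V * V := (\row_i w1 i, \row_i w2 i).
exists w; exists (fun n => conjc (expi (pi * symp w (z n - w)))).
  by move=> n; rewrite sqn_conj sqn_expi.
move=> e e0; have e20 := exprn_gt0 2 e0.
have [s s0 hs] := tfshift_continuity g e20.
have near1 : \forall n \near U, forall i, `|(z n).1 ord0 i - w1 i| < s.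
  apply: filter_forall => i; have /cvgrPdist_lt /(_ _ s0) := w1P i.
  by apply: filterS => n; rewrite distrC.
have near2 : \forall n \near U, forall i, `|(z n).2 ord0 i - w2 i| < s.
  apply: filter_forall => i; have /cvgrPdist_lt /(_ _ s0) := w2P i.
  by apply: filterS => n; rewrite distrC.
apply: filterS2 near1 near2 => n n1 n2.
have sm : small s (z n - w) by split=> i; rewrite !mxE.
have zE : tfshift (z n) g = conjc (expi (pi * symp w (z n - w))) *:
    tfshift w (tfshift (z n - w) g).
  rewrite tfshift_comp scalerA mulrC [w + (_ - _)]addrC subrK.
  by rewrite conj_expi -expiD subrr expi0 scale1r.
have -> : tfshift (z n) g - conjc (expi (pi * symp w (z n - w))) *: tfshift w g =
    conjc (expi (pi * symp w (z n - w))) *: tfshift w (tfshift (z n - w) g - g).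
  by rewrite zE -scalerBr -(scaleN1r g) tfshiftD tfshiftZ scaleN1r.
rewrite nrm_unimodular ?sqn_conj ?sqn_expi//.
rewrite /nrm nsq_tfshift -(ger0_norm (ltW e0)) -sqrtr_sqr ler_wsqrtr//.
exact: hs.
Qed.

(** A weakly null sequence is tested uniformly on the compact set of the bounded
    shifts of g. *)
Lemma bounded_shift_null z g k (c : nat -> R[i]) (r M : R) :
  (forall n, bounded_by r (z n)) -> (forall n, sqn (c n) = 1) ->
  (forall n, nsq (k n) <= M) -> weakly_null k ->
  forall e : R, 0 < e -> \forall n \near U, `|ip (c n *: tfshift (z n) g) (k n)| <= e.
Proof.
move=> zr c1 kM kw e e0; have [w [b b1 bP]] := tfshift_subsequence g zr.
have M1 : 0 < 1 + Num.sqrt M by rewrite ltr_pwDl// sqrtr_ge0.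
pose q := e / 3 / (1 + Num.sqrt M).
have e3 : 0 < e / 3 by rewrite divr_gt0.
have q0 : 0 < q by rewrite divr_gt0.
have n1 := bP _ q0.
have n2 := weakly_null_near kw (tfshift w g) e3.
have n3 := weakly_null_near kw ((0 +i* 1)%C *: tfshift w g) e3.
apply: filterS3 n1 n2 n3 => n n1 n2 n3.
have kn : nrm (k n) <= Num.sqrt M by rewrite ler_wsqrtr.
have -> : c n *: tfshift (z n) g = c n *: (tfshift (z n) g - b n *: tfshift w g) +
    (c n * b n) *: tfshift w g.
  by rewrite scalerBr scalerA subrK.
rewrite ipDl; apply: le_trans (ler_normD _ _) _.
have -> : e = e / 3 + (e / 3 + e / 3) by field.
apply: lerD; last first.
  apply: le_trans (ip_unimodular_le _ _ _) (lerD n2 n3).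
  by rewrite sqnM c1 b1 mulr1.
apply: le_trans (CS _ _) _; rewrite nrm_unimodular//.
apply: le_trans (ler_pM (nrm_ge0 _) (nrm_ge0 _) n1 kn) _.
by rewrite /q mulrAC ler_pdivrMr// ler_wpM2l ?(ltW e3)// lerDr.
Qed.

Definition escapes z := forall N : R, \forall n \near U,
  N < dotv (z n).1 (z n).1 + dotv (z n).2 (z n).2.

(** Failure to escape means that U contains the set where z n is bounded; off this
    set z n is replaced by 0. *)
Lemma not_escapes z : ~ escapes z -> exists2 r : R, 0 <= r & exists2 z' : nat -> V * V,
  (forall n, bounded_by r (z' n)) & \forall n \near U, z' n = z n.
Proof.
move=> /existsNP[N hN].
pose A := [set n | N < dotv (z n).1 (z n).1 + dotv (z n).2 (z n).2].
have [//|UA] := in_ultra_setVsetC A UU.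
exists (1 + `|N|); first by rewrite addr_ge0.
exists (fun n => if n \in A then 0 else z n); last first.
  by apply: filterS UA => n nA; rewrite memNset.
have le (x : V) i : dotv x x <= `|N| -> `|x ord0 i| <= 1 + `|N|.
  move=> xN; rewrite -(ler_pXn2r (n := 2))// ?nnegrE// ?addr_ge0//.
  rewrite real_normK ?num_real//.
  apply: le_trans (coord_sqr_le _ _) (le_trans xN _).
  by have := normr_ge0 N; move: `|N| => y; nra.
move=> n; case: ifPn => nA.
  by split=> i; rewrite mxE normr0 addr_ge0.
have {nA} : ~ A n by move=> An; move/negP: nA; apply; rewrite inE.
rewrite /A /= => /negP; rewrite -leNgt => zN.
have zN' := le_trans zN (ler_norm N).
by split=> i; apply: le; apply: le_trans zN'; rewrite ?lerDl ?lerDr dotv_ge0.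
Qed.

(** On a set of finite measure this is the convergence that matters for bounded
    functions: what lies outside a large bounded set has small measure. *)
Definition locally_null (B : nat -> V * V -> R) := forall r e : R, 0 <= r -> 0 < e ->
  \forall n \near U, forall w, bounded_by r w -> `|B n w| <= e.

(** If the convergence fails, then the points where it fails can be chosen to form
    a bounded sequence. *)
Lemma locally_nullP (B : nat -> V * V -> R) :
  (forall r z, (forall n, bounded_by r (z n)) ->
    forall e : R, 0 < e -> \forall n \near U, `|B n (z n)| <= e) -> locally_null B.
Proof.
move=> hB r e r0 e0; pose A := [set n | forall w, bounded_by r w -> `|B n w| <= e].
have [//|UA] := in_ultra_setVsetC A UU.
have /choice[z zP] : forall n, exists w, bounded_by r w /\ (~ A n -> e < `|B n w|).
  move=> n; have [An|nA] := pselect (A n).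
    by exists 0; split=> //; split=> i; rewrite mxE normr0.
  have := nA; rewrite /A /= => /existsNP[w /not_implyP[wr /negP]].
  by rewrite -ltNge => Bw; exists w; split.
have Bz := hB r z (fun n => (zP n).1) e e0.
have [n [/= nA Bn]] := @filter_ex _ U _ _ (filterI UA Bz).
by have := (zP n).2 nA; rewrite ltNge Bn.
Qed.

Lemma locally_null_refl g k (c : nat -> V * V -> R[i]) (M : R) :
  (forall n w, sqn (c n w) = 1) -> (forall n, nsq (k n) <= M) -> weakly_null k ->
  locally_null (fun n w => ip (c n w *: refl w g) (k n)).
Proof.
move=> c1 kM kw; apply: locally_nullP => r z zr.
apply: (@bounded_shift_null (fun n => 2%:R *: z n) (parity g) k (fun n => c n (z n)) (2 * r) M) => //.
by move=> n; split=> i; rewrite !mxE normrM ger0_norm// ler_wpM2l//; case: (zr n).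
Qed.

Lemma escaping_shift_null y g h (c : nat -> R[i]) : escapes y -> (forall n, sqn (c n) = 1) ->
  forall e : R, 0 < e -> \forall n \near U, `|ip (c n *: tfshift (y n) g) h| <= e.
Proof.
move=> yU c1 e e0; have [N hN] := tfshift_vanish g h e0.
by apply: filterS (yU N) => n yN; exact: hN.
Qed.

(** The reflections refl w are unitary images of g that stay in a compact set for
    bounded w, and the matrix coefficients vanish uniformly on compact sets. *)
Lemma locally_null_escaping y g h (c : nat -> V * V -> R[i]) : escapes y ->
  (forall n w, sqn (c n w) = 1) ->
  locally_null (fun n w => ip (c n w *: tfshift (y n) (refl w g)) h).
Proof.
move=> yU c1; apply: locally_nullP => r z zr e e0.
have z2 n : bounded_by (2 * r) (2%:R *: z n).
  by split=> i; rewrite !mxE normrM ger0_norm// ler_wpM2l//; case: (zr n).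
(* The points z n are replaced by their limit w. *)
have [w [b b1 bP]] := tfshift_subsequence (parity g) z2.
have h1 : 0 < 1 + nrm h by rewrite ltr_pwDl// nrm_ge0.
have e2 : 0 < e / 2 by rewrite divr_gt0.
have q0 : 0 < e / 2 / (1 + nrm h) by rewrite divr_gt0.
have cb1 n : sqn (c n (z n) * b n) = 1 by rewrite sqnM c1 b1 mulr1.
have n2 := escaping_shift_null (tfshift w (parity g)) h yU cb1 e2.
apply: filterS2 (bP _ q0) n2 => n n1 {}n2.
have -> : c n (z n) *: tfshift (y n) (refl (z n) g) =
    c n (z n) *: tfshift (y n) (refl (z n) g - b n *: tfshift w (parity g)) +
    (c n (z n) * b n) *: tfshift (y n) (tfshift w (parity g)).
  rewrite -(scaleN1r (b n *: _)) tfshiftD !tfshiftZ scaleN1r scalerBr scalerA.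
  by rewrite subrK.
rewrite ipDl; apply: le_trans (ler_normD _ _) _; rewrite [e]splitr; apply: lerD => //.
apply: le_trans (CS _ _) _; rewrite nrm_unimodular// /nrm nsq_tfshift -/(nrm _).
apply: le_trans (ler_wpM2r (nrm_ge0 _) n1) _.
by rewrite mulrAC ler_pdivrMr// ler_wpM2l ?(ltW e2)// lerDr.
Qed.

End weakly_null.


(** * The L^p norm over a set of finite measure of phase space *)

Section norm_on.
Context {R : realType} {d : nat}.
Local Notation lam := (lebesgue_rV R d).
Local Notation Lam := (@lebesgue_phase R d).
Local Notation V := 'rV[R]_d.
Local Notation H := (L2T lam).
Variables (Om : set (V * V)) (p : R).
Hypothesis mOm : measurable Om.
Hypothesis Omoo : (Lam Om < +oo)%E.
Hypothesis p1 : 1 <= p.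
Implicit Types u v : V * V -> R.

Definition bounded_measurable u := measurable_fun setT u /\ exists M, forall z, `|u z| <= M.

Definition cutoff u : V * V -> R := fun z => \1_Om z * u z.

Definition normOm u : R := fine (Lpn Lam p (cutoff u)).

Lemma measurable_cutoff u : measurable_fun setT u -> measurable_fun setT (cutoff u).
Proof. by move=> mu; apply: measurable_funM => //; exact: measurable_indic. Qed.

Lemma normr_cutoff_le u z : `|cutoff u z| <= `|u z|.
Proof. by rewrite normrM indicE ler_piMl//; case: (z \in Om); rewrite ?normr0 ?normr1. Qed.

Lemma Lpn_indic_lty : (Lpn Lam p \1_Om < +oo)%E.
Proof.
have p0 : 0 < p by exact: lt_le_trans p1.
rewrite LpnE; apply: poweR_lty; rewrite (_ : integral _ _ _ = Lam Om)//.
transitivity (\int[Lam]_z (\1_Om z)%:E)%E; last by rewrite integral_indic// setIT.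
apply: eq_integral => z _; rewrite indicE.
by case: (z \in Om); rewrite ?normr0 ?normr1 ?powR1// powR0// gt_eqF.
Qed.

Lemma normOmE u : bounded_measurable u -> (normOm u)%:E = Lpn Lam p (cutoff u).
Proof.
move=> [mu [M uM]]; rewrite /normOm fineK// ge0_fin_numE ?Lpn_ge0//.
have mI : measurable_fun setT (\1_Om : V * V -> R) by exact: measurable_indic.
apply: (@le_lt_trans _ _ (Lpn Lam p (fun z => M * \1_Om z))).
  apply: le_Lpn => //; [exact: measurable_cutoff|exact: measurable_funM|].
  move=> z; rewrite /cutoff mulrC !normrM ler_wpM2r//.
  exact: le_trans (uM z) (ler_norm M).
rewrite LpnZ// lte_mul_pinfty//; exact: Lpn_indic_lty.
Qed.

Lemma bounded_measurableD u v : bounded_measurable u -> bounded_measurable v ->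
  bounded_measurable (fun z => u z + v z).
Proof.
move=> [mu [M uM]] [mv [N vN]]; split; first exact: measurable_funD.
by exists (M + N) => z; apply: le_trans (ler_normD _ _) (lerD _ _).
Qed.

Lemma bounded_measurableZ c u : bounded_measurable u ->
  bounded_measurable (fun z => c * u z).
Proof.
move=> [mu [M uM]]; split; first exact: measurable_funM.
by exists (`|c| * M) => z; rewrite normrM ler_wpM2l.
Qed.

Lemma normOm_ge0 u : 0 <= normOm u.
Proof. by rewrite /normOm fine_ge0// Lpn_ge0. Qed.

Lemma normOmD u v : bounded_measurable u -> bounded_measurable v ->
  normOm (fun z => u z + v z) <= normOm u + normOm v.
Proof.
move=> gu gv; rewrite -lee_fin EFinD !normOmE//; last exact: bounded_measurableD.
rewrite (_ : cutoff _ = (fun z => cutoff u z + cutoff v z)); last first.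
  by apply/funext => z; rewrite /cutoff mulrDr.
by apply: LpnD => //; apply: measurable_cutoff; [case: gu|case: gv].
Qed.

Lemma normOmZ c u : bounded_measurable u -> normOm (fun z => c * u z) = `|c| * normOm u.
Proof.
move=> gu; apply: EFin_inj; rewrite EFinM !normOmE//; last exact: bounded_measurableZ.
rewrite (_ : cutoff _ = (fun z => c * cutoff u z)); last first.
  by apply/funext => z; rewrite /cutoff mulrCA.
by apply: LpnZ => //; apply: measurable_cutoff; case: gu.
Qed.

Lemma le_normOm u v : bounded_measurable u -> bounded_measurable v ->
  (forall z, `|u z| <= `|v z|) -> normOm u <= normOm v.
Proof.
move=> gu gv uv; rewrite -lee_fin !normOmE//; apply: le_Lpn => //.
- by apply: measurable_cutoff; case: gu.
- by apply: measurable_cutoff; case: gv.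
- by move=> z; rewrite !normrM ler_wpM2l.
Qed.

Lemma bounded_measurable_cst c : bounded_measurable (cst c).
Proof. by split; [exact: measurable_cst|exists `|c|]. Qed.

Lemma normOm_bound u (M : R) : bounded_measurable u -> (forall z, `|u z| <= M) ->
  normOm u <= M * normOm (cst 1).
Proof.
move=> gu uM; have M0 : 0 <= M by exact: le_trans (uM (0 : V * V)).
rewrite -[M in M * _](ger0_norm M0) -(normOmZ M (bounded_measurable_cst 1)).
apply: le_normOm => //; first exact/bounded_measurableZ/bounded_measurable_cst.
by move=> z; rewrite mulr1 (ger0_norm M0).
Qed.

Definition bbox (r : R) : set (V * V) := box r `*` box r.

Lemma measurable_bbox r : measurable (bbox r).
Proof. by apply: measurableX; exact: measurable_box. Qed.

(** Continuity from above: the sets Om minus the boxes decrease to the empty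
    set. *)
Lemma tail_small (e : R) : 0 < e -> exists2 r : R, 0 < r & (Lam (Om `\` bbox r) <= e%:E)%E.
Proof.
move=> e0; pose F (n : nat) := Om `\` bbox n.+1%:R.
have mF n : measurable (F n) by apply: measurableD => //; exact: measurable_bbox.
have F0 : \bigcap_n F n = set0.
  apply/seteqP; split => // z zF; have [k kx] := mem_ocube z.1; have [l ly] := mem_ocube z.2.
  have [_] := zF (maxn k l) I; apply; split=> i.
    have := kx i; rewrite /= in_itv/= => /andP[h1 h2].
    have mn : k%:R <= (maxn k l).+1%:R :> R by rewrite ler_nat leqW// leq_maxl.
    by rewrite ler_norml (le_trans h2 mn) andbT (le_trans _ (ltW h1))// lerN2.
  have := ly i; rewrite /= in_itv/= => /andP[h1 h2].
  have mn : l%:R <= (maxn k l).+1%:R :> R by rewrite ler_nat leqW// leq_maxr.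
  by rewrite ler_norml (le_trans h2 mn) andbT (le_trans _ (ltW h1))// lerN2.
have niF : nonincreasing_seq F.
  move=> m n mn; apply/subsetPset => z [zO zn]; split=> // zm; apply: zn.
  have mnR : m.+1%:R <= n.+1%:R :> R by rewrite ler_nat.
  by case: zm => z1 z2; split=> i; [apply: le_trans (z1 i) mnR|apply: le_trans (z2 i) mnR].
have F0oo : (Lam (F 0%N) < +oo)%E.
  by apply: le_lt_trans Omoo; apply: le_measure; rewrite ?inE//; exact: subDsetl.
have := nonincreasing_cvg_mu F0oo mF (bigcapT_measurable mF) niF.
rewrite F0 measure0 => /fine_cvgP[Ffin /cvgrPdist_le /(_ _ e0) Fe].
have [N _ HN] := filterI Ffin Fe.
have [NF] := HN N (leqnn N); rewrite /= sub0r normrN => Ne.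
exists N.+1%:R; first by rewrite ltr0n.
rewrite -[X in (X <= _)%E](fineK NF) lee_fin.
exact: le_trans (ler_norm _) Ne.
Qed.

Lemma normOm_small (M e : R) : 0 <= M -> 0 < e -> exists2 r : R, 0 < r &
  exists2 delta : R, 0 < delta & forall u, bounded_measurable u -> (forall z, `|u z| <= M) ->
  (\int[Lam]_z (\1_(bbox r) z * u z ^+ 2)%:E <= delta%:E)%E -> normOm u <= e.
Proof.
move=> M0 e0; pose m := fine (Lam Om).
have m0 : 0 <= m by rewrite fine_ge0.
have [delta delta0 hd] := Lpn_small Lam p1 m0 M0 e0.
have [r r0 hr] := tail_small delta0.
exists r => //; exists delta => // u gu uM ud; rewrite -lee_fin normOmE//.
have [mu _] := gu; have mb := measurable_bbox r.
apply: (hd Om (bbox r)) => //.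
- exact: measurable_cutoff.
- by move=> z; apply: le_trans (normr_cutoff_le _ _) (uM z).
- by move=> z nz; rewrite /cutoff indicE memNset// mul0r.
- by rewrite /m fineK// ge0_fin_numE.
- have mb1 : measurable_fun setT (\1_(bbox r) : V * V -> R) by exact: measurable_indic.
  apply: le_trans ud; apply: ge0_le_integral => //.
  + by move=> z _; rewrite lee_fin mulr_ge0 ?sqr_ge0.
  + apply/measurable_EFinP; apply: measurable_funM => //; apply: measurable_funX.
    exact: measurable_cutoff.
  + by apply/measurable_EFinP; apply: measurable_funM => //; exact: measurable_funX.
  + move=> z _; rewrite lee_fin ler_wpM2l//.
    by rewrite -(real_normK (num_real (cutoff u z))) -(real_normK (num_real (u z))) lerXn2r ?nnegrE// normr_cutoff_le.
Qed.

Lemma Lam_bbox r : 0 < r -> Lam (bbox r) = (((2 * r) ^+ d) ^+ 2)%:E.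
Proof.
move=> r0; have mb := @measurable_box R d r.
apply: etrans (product_measure1E lam lam mb mb) _.
by rewrite expr2 EFinM; congr (_ * _)%E; exact: lebesgue_box.
Qed.

Variable U : set_system nat.
Context {UU : UltraFilter U}.

Lemma normOm_locally_null (B : nat -> V * V -> R) (M : R) : locally_null U B ->
  (forall n, bounded_measurable (B n)) -> (forall n z, `|B n z| <= M) ->
  forall e : R, 0 < e -> \forall n \near U, normOm (B n) <= e.
Proof.
move=> Bnull gB BM e e0; have M0 : 0 <= M by exact: le_trans (BM 0%N 0).
have [r r0 [delta delta0 hd]] := normOm_small M0 e0.
pose m := ((2 * r) ^+ d) ^+ 2 + 1.
have m0 : 0 < m by rewrite ltr_wpDl// sqr_ge0.
have q0 : 0 < Num.sqrt (delta / m) by rewrite sqrtr_gt0 divr_gt0.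
apply: filterS (Bnull r _ (ltW r0) q0) => n hn; apply: hd => //.
have mb := measurable_bbox r.
have mb1 : measurable_fun setT (fun z => (\1_(bbox r) z : R)%:E).
  by apply/measurable_EFinP; exact: measurable_indic.
apply: (@le_trans _ _ (\int[Lam]_z ((delta / m)%:E * (\1_(bbox r) z)%:E))%E).
  apply: ge0_le_integral => //.
  - by move=> z _; rewrite lee_fin mulr_ge0 ?sqr_ge0.
  - apply/measurable_EFinP; apply: measurable_funM; first exact: measurable_indic.
    by apply: measurable_funX; case: (gB n).
  - exact: measurable_funeM.
  - move=> z _; rewrite -EFinM lee_fin indicE.
    case: (boolP (z \in bbox r)) => [|_]; last by rewrite mul0r mulr0.
    rewrite inE => zb; rewrite mul1r mulr1 -(real_normK (num_real (B n z))).
    rewrite -[leRHS]sqr_sqrtr ?(ltW (divr_gt0 _ _))// lerXn2r ?nnegrE ?(ltW q0)//.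
    exact: hn.
rewrite ge0_integralZl_EFin//; last by rewrite ltW// divr_gt0.
rewrite integral_indic// setIT.
rewrite (_ : _ * _ = (delta / m)%:E * (((2 * r) ^+ d) ^+ 2)%:E)%E; last first.
  by congr (_ * _)%E; exact: Lam_bbox.
rewrite -EFinM lee_fin mulrAC ler_pdivrMr// ler_wpM2l ?(ltW delta0)//.
by rewrite /m lerDl.
Qed.

End norm_on.


(** * Averaging a fast oscillation *)

Section periodic_integral.
Context {R : realType}.
Local Notation leb := (@lebesgue_measure R).
Local Notation T := (2 * pi : R).

Lemma measurable_shift1 (s : R) :
  @measurable_fun _ _ (measurableTypeR R) (measurableTypeR R) setT (fun x => x + s).
Proof. exact: measurable_funD. Qed.

Lemma lebesgue_shift1 (s : R) (A : set (measurableTypeR R)) : measurable A ->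
  leb ((fun x => x + s) @^-1` A) = leb A.
Proof.
move=> mA; have ms := measurable_shift1 s.
pose f : {mfun (measurableTypeR R) >-> (measurableTypeR R)} :=
  HB.pack (fun x : R => x + s) (isMeasurableFun.Build _ _ _ _ _ ms).
apply/esym; apply: (@lebesgue_measure_unique R (pushforward leb f)) => //.
move=> _ [[a b] _ <-]; rewrite /= /pushforward.
have -> : (fun x => x + s) @^-1` `]a, b]%classic = `]a - s, b - s]%classic :> set R.
  by apply/seteqP; split=> x /=; rewrite !in_itv/= ltrBlDr lerBrDr.
rewrite !lebesgue_measure_itv/= !lte_fin ltrD2r -!EFinB; congr (if _ then _%:E else _).
by ring.
Qed.

Lemma ge0_integral_shift1 (s : R) (G : R -> \bar R) :
  measurable_fun (setT : set (measurableTypeR R)) G -> (forall x, 0 <= G x)%E ->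
  (\int[leb]_x G (x + s)%R = \int[leb]_x G x)%E.
Proof. exact: (ge0_integral_preserving (measurable_shift1 s) (@lebesgue_shift1 s)). Qed.

Lemma measurable_indic1 (A : set (measurableTypeR R)) : measurable A ->
  measurable_fun (setT : set (measurableTypeR R)) (fun x => (\1_A x : R)%:E).
Proof. by move=> mA; apply/measurable_EFinP; exact: measurable_indic. Qed.

(** The shift is reduced modulo the period to some r in [0, T); the part of the
    shifted period that sticks out, from T to T + r, is translated back to
    [0, r). *)
Lemma ge0_integral_periodic (F : R -> \bar R) (s : R) :
  measurable_fun (setT : set (measurableTypeR R)) F ->
  (forall x, 0 <= F x)%E -> (forall x, F (x + T)%R = F x) ->
  (\int[leb]_x ((\1_(`[0%R, T[%classic : set R) x)%:E * F (x + s)%R) =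
   \int[leb]_x ((\1_(`[0%R, T[%classic : set R) x)%:E * F x))%E.
Proof.
move=> mF F0 FT; have T0 : 0 < T by rewrite mulr_gt0// pi_gt0.
have FN n x : F (x + n%:R * T) = F x.
  elim: n => [|n IH]; first by rewrite mul0r addr0.
  by rewrite -natr1 mulrDl mul1r addrA FT IH.
have FZ (k : int) x : F (x + k%:~R * T) = F x.
  case: k => n; first by rewrite -pmulrn FN.
  by rewrite NegzE mulrNz mulNr -[in RHS](subrK (n.+1%:R * T) x) FN.
pose k := Num.floor (s / T); pose r := s - k%:~R * T.
have [r0 rT] : 0 <= r /\ r < T.
  have /andP[h1 h2] := floor_itv (s / T).
  move: h1 h2; rewrite -/k ler_pdivlMr// ltr_pdivrMr// intrD mulr1z => h1 h2.
  by rewrite /r subr_ge0; split => //; rewrite ltrBlDl -[X in _ < _ + X]mul1r -mulrDl.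
have Fs x : F (x + s) = F (x + r).
  by rewrite -(FZ k (x + r)) /r -addrA subrK.
pose I (a b : R) x : \bar R := (\1_(`[a, b[%classic : set R) x)%:E.
have mI a b : measurable_fun (setT : set (measurableTypeR R)) (I a b).
  by apply: measurable_indic1; exact: measurable_itv.
have I0 a b x : (0 <= I a b x)%E by rewrite lee_fin.
have mIF a b : measurable_fun (setT : set (measurableTypeR R)) (fun x => I a b x * F x)%E.
  exact: emeasurable_funM.
have IF0 a b x : (0 <= I a b x * F x)%E by exact: mule_ge0.
have shiftI a b c x : I a b (x - c) = I (a + c) (b + c) x.
  rewrite /I !indicE; congr ((nat_of_bool _)%:R%:E); apply/idP/idP; rewrite !inE/= !in_itv/=.
    by rewrite lerBrDr ltrBlDr.
  by rewrite lerBrDr ltrBlDr.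
have splitI a b c x : a <= b -> b <= c -> (I a c x = I a b x + I b c x)%E.
  move=> ab bc; rewrite /I -EFinD !indicE; congr EFin.
  have [h|h] := ltP x b.
    rewrite (_ : (x \in `[b, c[%classic) = false) ?addr0; last first.
      by apply/negbTE/negP; rewrite inE/= in_itv/= leNgt h.
    congr ((nat_of_bool _)%:R); apply/idP/idP; rewrite !inE/= !in_itv/= => /andP[-> h2] //.
    exact: lt_le_trans h bc.
  rewrite (_ : (x \in `[a, b[%classic) = false) ?add0r; last first.
    by apply/negbTE/negP; rewrite inE/= in_itv/= => /andP[_]; rewrite ltNge h.
  congr ((nat_of_bool _)%:R); apply/idP/idP; rewrite !inE/= !in_itv/= => /andP[h1 ->].
    by rewrite h.
  by rewrite (le_trans ab h).
rewrite -[LHS]/(\int[leb]_x (I 0%R T x * F (x + s)%R))%E.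
rewrite -[RHS]/(\int[leb]_x (I 0%R T x * F x))%E.
have -> : (\int[leb]_x (I 0%R T x * F (x + s)%R) = \int[leb]_x (I r (T + r)%R x * F x))%E.
  rewrite -[RHS](ge0_integral_shift1 r (mIF _ _) (IF0 _ _)).
  apply: eq_integral => x _; rewrite Fs; congr (_ * _)%E.
  by have := shiftI 0 T r (x + r); rewrite add0r addrK.
have int2 a b c : a <= b -> b <= c -> (\int[leb]_x (I a c x * F x) =
    \int[leb]_x (I a b x * F x) + \int[leb]_x (I b c x * F x))%E.
  move=> ab bc; rewrite -ge0_integralD//.
  by apply: eq_integral => x _; rewrite (splitI a b c x ab bc) ge0_muleDl.
rewrite (int2 r T (T + r) (ltW rT)) ?lerDl// (int2 0 r T r0 (ltW rT)) addeC.
congr (_ + _)%E; rewrite -(ge0_integral_shift1 T (mIF _ _) (IF0 _ _)).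
apply: eq_integral => x _; rewrite FT; congr (_ * _)%E.
by have := shiftI 0 r T (x + T); rewrite add0r addrK [T + r]addrC => <-.
Qed.

End periodic_integral.



Section translation_small.
Context {R : realType} {d : nat}.
Local Notation lam := (lebesgue_rV R d).
Local Notation Lam := (@lebesgue_phase R d).
Local Notation V := 'rV[R]_d.
Variables (Om : set (V * V)) (p : R).
Hypothesis mOm : measurable Om.
Hypothesis Omoo : (Lam Om < +oo)%E.
Hypothesis p1 : 1 <= p.
Implicit Types u v : V * V -> R.

Lemma cutoff_L2 u : bounded_measurable u ->
  (fun z => (cutoff Om u z)%:C%C) \in sqintegrable Lam.
Proof.
move=> [mu [M uM]]; have mc := measurable_cutoff mOm mu.
apply/sqintegrableP; split; first exact: cmeas_real.
apply: (@le_lt_trans _ _ (\int[Lam]_z ((M ^+ 2)%:E * (\1_Om z)%:E))%E).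
  have mI : measurable_fun setT (fun z => (\1_Om z : R)%:E).
    by apply/measurable_EFinP; exact: measurable_indic.
  apply: ge0_le_integral => //.
  - by move=> z _; rewrite lee_fin sqn_ge0.
  - by apply: measurable_sqnE; exact: cmeas_real.
  - exact: measurable_funeM.
  - move=> z _; rewrite -EFinM lee_fin /sqn /= expr0n addr0 /cutoff indicE.
    case: (z \in Om); rewrite ?mul1r ?mul0r ?mulr1 ?mulr0 ?expr0n//.
    by rewrite -(real_normK (num_real (u z))) lerXn2r ?nnegrE// (le_trans _ (uM z)).
rewrite ge0_integralZl_EFin ?sqr_ge0//; last first.
  by apply/measurable_EFinP; exact: measurable_indic.
by rewrite integral_indic// setIT lte_mul_pinfty// lee_fin sqr_ge0.
Qed.

(** Strong continuity of the translations in L^2 gives continuity in L^p here,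
    the functions being bounded and supported in sets of bounded measure. *)
Lemma translation_small u (e : R) : bounded_measurable u -> 0 < e ->
  exists2 r : R, 0 < r & forall a : V * V, small r a ->
  (Lpn Lam p (fun z => cutoff Om u (z + a)%R - cutoff Om u z)%R <= e%:E)%E.
Proof.
move=> gu e0; have [mu [M uM]] := gu; have mc := measurable_cutoff mOm mu.
have M0 : 0 <= M by exact: le_trans (uM (0 : V * V)).
have m0 : 0 <= 2 * fine (Lam Om) by rewrite mulr_ge0// fine_ge0.
have [delta delta0 hd] := Lpn_small Lam p1 m0 (addr_ge0 M0 M0) e0.
pose F := MkL2 (cutoff_L2 gu).
have [r r0 hr] := ptrans_continuity F delta0.
exists r => // a ar.
have mca : measurable_fun setT (fun z : V * V => cutoff Om u (z + a)).
  exact: (measurableT_comp mc (ptrans_measurable a)).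
have mD : measurable_fun setT (fun z : V * V => cutoff Om u (z + a) - cutoff Om u z).
  exact: measurable_funB.
pose Oma := (fun z : V * V => z + a) @^-1` Om.
have mOma : measurable Oma by rewrite -[Oma]setTI; exact: (ptrans_measurable a).
have cM z : `|cutoff Om u z| <= M by exact: le_trans (normr_cutoff_le _ _ _) (uM z).
apply: (hd (Om `|` Oma) setT) => //.
- exact: measurableU.
- by move=> z; apply: le_trans (ler_normB _ _) (lerD _ _).
- move=> z nz; rewrite /cutoff !indicE !memNset ?mul0r ?subrr// => h; apply: nz.
    by left.
  by right.
- apply: le_trans (measureU2 _ _ _) _ => //.
  apply: (@le_trans _ _ (Lam Om + Lam Om)%E).
    by rewrite leeD2l// le_eqVlt; apply/orP; left; apply/eqP; exact: ptrans_preserving.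
  have Of : Lam Om = (fine (Lam Om))%:E by rewrite fineK// ge0_fin_numE.
  by rewrite [X in (X + X)%E]Of -EFinD lee_fin mulr2n mulrDl mul1r.
- by rewrite setDT measure0 lee_fin ltW.
- apply: le_trans (_ : _ <= (nsq (ptrans a F - F))%:E)%E _; last by rewrite lee_fin; exact: hr.
  rewrite EFin_nsq le_eqVlt; apply/orP; left; apply/eqP; apply: eq_integral => z _.
  rewrite indicT mul1r l2BE ptransE /sqn /= subrr expr0n addr0//.
Qed.

End translation_small.

Section phase_averaging.
Context {R : realType} {d : nat}.
Local Notation lam := (lebesgue_rV R d).
Local Notation Lam := (@lebesgue_phase R d).
Local Notation V := 'rV[R]_d.
Local Notation leb := (@lebesgue_measure R).
Variables (Om : set (V * V)) (p : R).
Hypothesis mOm : measurable Om.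
Hypothesis Omoo : (Lam Om < +oo)%E.
Hypothesis p1 : 1 <= p.
Variable U : set_system nat.
Context {UU : UltraFilter U}.
Variables (A B : V * V -> R) (M : R).
Hypothesis mA : measurable_fun setT A.
Hypothesis mB : measurable_fun setT B.
Hypothesis AM : forall z, `|A z| <= M.
Hypothesis BM : forall z, `|B z| <= M.

(** The real part of the complex function A - i B multiplied by the phase
    e^{i s}. *)
Definition oscillation (s : V * V -> R) (z : V * V) : R := cos (s z) * A z + sin (s z) * B z.

Let gA : bounded_measurable A. Proof. by split => //; exists M. Qed.
Let gB : bounded_measurable B. Proof. by split => //; exists M. Qed.

Lemma norm_cos_le1 (x : R) : `|cos x| <= 1.
Proof. by rewrite ler_norml cos_geN1 cos_le1. Qed.

Lemma norm_sin_le1 (x : R) : `|sin x| <= 1.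
Proof. by rewrite ler_norml sin_geN1 sin_le1. Qed.

Lemma measurable_cos : measurable_fun (setT : set R) (@cos R).
Proof. by apply: continuous_measurable_fun; exact: continuous_cos. Qed.

Lemma measurable_sin : measurable_fun (setT : set R) (@sin R).
Proof. by apply: continuous_measurable_fun; exact: continuous_sin. Qed.

Lemma bounded_measurable_oscillation s : measurable_fun setT s ->
  bounded_measurable (oscillation s).
Proof.
move=> ms; split; last first.
  exists (M + M) => z; apply: le_trans (ler_normD _ _) (lerD _ _); rewrite normrM.
    by apply: le_trans (AM z); rewrite ler_piMl// norm_cos_le1.
  by apply: le_trans (BM z); rewrite ler_piMl// norm_sin_le1.
apply: measurable_funD; apply: measurable_funM => //.
  exact: (measurableT_comp measurable_cos).
exact: (measurableT_comp measurable_sin).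
Qed.

Let Nt (t : R) := normOm Om p (oscillation (fun=> t)).

Let gosc (t : R) : bounded_measurable (oscillation (fun=> t)).
Proof. by apply: bounded_measurable_oscillation; exact: measurable_cst. Qed.

(** Continuity of the norm in the constant phase, so that a best phase exists. *)
Let Nt_lip s t : `|Nt s - Nt t| <=
  (`|cos s - cos t| * M + `|sin s - sin t| * M) * normOm Om p (cst 1).
Proof.
have key s' t' : Nt s' <= Nt t' + (`|cos s' - cos t'| * M + `|sin s' - sin t'| * M) * normOm Om p (cst 1).
  pose D z := (cos s' - cos t') * A z + (sin s' - sin t') * B z.
  have gD : bounded_measurable D.
    by apply: bounded_measurableD; exact: bounded_measurableZ.
  have -> : Nt s' = normOm Om p (fun z => oscillation (fun=> t') z + D z).
    by congr (normOm _ _ _); apply/funext => z; rewrite /oscillation /D; ring.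
  apply: le_trans (normOmD mOm Omoo p1 (gosc t') gD) _; rewrite lerD2l.
  apply: (normOm_bound mOm Omoo p1 gD) => z.
  by apply: le_trans (ler_normD _ _) (lerD _ _); rewrite normrM ler_wpM2l.
rewrite ler_norml; apply/andP; split.
  by rewrite lerNl opprB lerBlDl (le_trans (key t s))// (distrC (cos t)) (distrC (sin t)).
by rewrite lerBlDl.
Qed.

Let Nt_continuous : continuous Nt.
Proof.
move=> t; apply/cvgrPdist_le => e e0.
have M0 : 0 <= M by exact: le_trans (AM (0 : V * V)).
have k0 : 0 < (M + M) * normOm Om p (cst 1) + 1.
  by rewrite ltr_wpDl// mulr_ge0 ?normOm_ge0// addr_ge0.
have q0 : 0 < e / ((M + M) * normOm Om p (cst 1) + 1) by rewrite divr_gt0.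
have /cvgrPdist_le /(_ _ q0) hc := @continuous_cos R t.
have /cvgrPdist_le /(_ _ q0) hs := @continuous_sin R t.
near=> s.
have c1 : `|cos t - cos s| <= e / ((M + M) * normOm Om p (cst 1) + 1) by near: s.
have s1 : `|sin t - sin s| <= e / ((M + M) * normOm Om p (cst 1) + 1) by near: s.
apply: le_trans (Nt_lip t s) _.
set q := e / _ in c1 s1 *.
apply: (@le_trans _ _ (q * ((M + M) * normOm Om p (cst 1)))).
  rewrite mulrA ler_wpM2r ?normOm_ge0// mulrDr lerD// ler_wpM2r//.
rewrite /q mulrAC ler_pdivrMr// ler_wpM2l ?(ltW e0)// lerDl//.
Unshelve. all: by end_near. Qed.

Local Notation T := (2 * pi : R).
Local Notation IT := (fun t => (\1_(`[0%R, T[%classic : set R) t : R)%:E).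

Let Phi (s : V * V -> R) (t : R) z : \bar R :=
  (`|cutoff Om (oscillation (fun w => s w + t)) z| `^ p)%:E.

Let mPhi s : measurable_fun setT s ->
  measurable_fun (setT : set (measurableTypeR R * (V * V))) (fun w => IT w.1 * Phi s w.1 w.2)%E.
Proof.
move=> ms; have m1 : measurable_fun (setT : set (measurableTypeR R * (V * V))) (fun w => w.1 : R).
  exact: measurable_fst.
have m2 : measurable_fun (setT : set (measurableTypeR R * (V * V))) (fun w => w.2).
  exact: measurable_snd.
have mst : measurable_fun (setT : set (measurableTypeR R * (V * V))) (fun w => s w.2 + w.1).
  by apply: measurable_funD => //; exact: (measurableT_comp ms m2).
apply: emeasurable_funM.
  have := @measurable_indic1 R `[0%R, T[%classic (measurable_itv _).
  by move=> /measurableT_comp; apply; exact: m1.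
apply/measurable_EFinP; apply: (@measurableT_comp _ _ _ _ _ _ (@powR R ^~ p)) => //.
apply: measurableT_comp => //; apply: measurable_funM.
  by apply: (measurableT_comp (f := \1_Om : V * V -> R)) => //; exact: measurable_indic.
apply: measurable_funD; apply: measurable_funM.
- exact: (measurableT_comp measurable_cos).
- exact: (measurableT_comp mA).
- exact: (measurableT_comp measurable_sin).
- exact: (measurableT_comp mB).
Qed.

Let Phi_ge0 s t z : (0 <= IT t * Phi s t z)%E.
Proof. by rewrite mule_ge0// lee_fin powR_ge0. Qed.

Let average_swap s : measurable_fun setT s ->
  (\int[leb]_t \int[Lam]_z (IT t * Phi s t z) = \int[Lam]_z \int[leb]_t (IT t * Phi s t z))%E.
Proof.
move=> ms; exact: (@fubini_tonelli _ _ (measurableTypeR R) (V * V)%type R leb Lam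
  (fun w => IT w.1 * Phi s w.1 w.2)%E (mPhi ms) (fun w => Phi_ge0 s w.1 w.2)).
Qed.

(** At each point z the average over t is taken along a full period of the
    phase, so that its origin s z can be moved to 0. *)
Let average_phase s : measurable_fun setT s ->
  (\int[leb]_t \int[Lam]_z (IT t * Phi s t z) =
   \int[leb]_t \int[Lam]_z (IT t * Phi (fun=> 0%R) t z))%E.
Proof.
move=> ms; apply: etrans (average_swap ms) _.
have mc : measurable_fun setT (fun _ : V * V => 0 : R) by exact: measurable_cst.
have E0 := average_swap mc; transitivity (\int[Lam]_z \int[leb]_t (IT t * Phi (fun=> 0%R) t z))%E;
  last exact: esym E0.
apply: eq_integral => z _.
have PhiE t : Phi s t z = Phi (fun=> 0) (t + s z) z.
  by rewrite /Phi /cutoff /oscillation !add0r (addrC t).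
under eq_integral do rewrite PhiE.
apply: (ge0_integral_periodic (F := fun t => Phi (fun=> 0) t z)).
- apply/measurable_EFinP; apply: (@measurableT_comp _ _ _ _ _ _ (@powR R ^~ p)) => //.
  have mt : measurable_fun (setT : set (measurableTypeR R)) (fun t : R => 0 + t) by exact: measurable_funD.
  apply: measurableT_comp => //; apply: measurable_funM => //.
  apply: measurable_funD; apply: measurable_funM => //.
    exact: (measurableT_comp measurable_cos).
  exact: (measurableT_comp measurable_sin).
- by move=> t; rewrite lee_fin powR_ge0.
- move=> t; rewrite /Phi /cutoff /oscillation !add0r.
  by rewrite (_ : T = pi *+ 2) ?cosD2pi ?sinD2pi// mulrC mulr_natr.
Qed.

(** Comparison of the p-th powers: a lower bound valid for all shifts of the phase
    s bounds their average, which is also that of the constant phases. *)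
Let average_le (s : V * V -> R) (m K : R) : measurable_fun setT s -> 0 <= m ->
  (forall t, t \in `[0%R, T[ -> Nt t <= K) ->
  (forall t, t \in `[0%R, T[ -> (m%:E <= Lpn Lam p (cutoff Om (oscillation (fun z => (s z + t)%R))))%E) ->
  m <= K.
Proof.
move=> ms m0 NK hm; have p0 : 0 < p by exact: lt_le_trans p1.
have K0 : 0 <= K.
  apply: le_trans (normOm_ge0 _ _ _) (NK 0 _).
  by rewrite in_itv/= lexx mulr_gt0// pi_gt0.
have T0 : 0 < T by rewrite mulr_gt0// pi_gt0.
have mI := @measurable_indic1 R `[0%R, T[%classic (measurable_itv _).
have intI : (\int[leb]_t IT t = T%:E)%E.
  rewrite integral_indic// setIT.
  by apply: etrans (lebesgue_measure_itv _) _; rewrite /= lte_fin T0 oppr0 adde0.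
have pull (s' : V * V -> R) t : measurable_fun setT s' ->
    (\int[Lam]_z (IT t * Phi s' t z) = IT t * \int[Lam]_z Phi s' t z)%E.
  move=> ms'; rewrite ge0_integralZl_EFin//.
    by move=> z _; rewrite lee_fin powR_ge0.
  apply: measurable_powR_norm; apply: measurable_cutoff => //.
  by have [] := @bounded_measurable_oscillation (fun z => s' z + t) (measurable_funD ms' (measurable_cst _)).
have lower : ((m `^ p * T)%:E <= \int[leb]_t \int[Lam]_z (IT t * Phi s t z))%E.
  rewrite EFinM -intI -ge0_integralZl_EFin ?powR_ge0//.
  apply: ge0_le_integral => //.
  - by move=> t _; rewrite mule_ge0// lee_fin powR_ge0.
  - exact: measurable_funeM.
  - exact: (@measurable_fun_fubini_tonelli_F _ _ (measurableTypeR R) (V * V)%type R Lam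
      (fun w => IT w.1 * Phi s w.1 w.2)%E (mPhi ms) (fun w => Phi_ge0 s w.1 w.2)).
  - move=> t _; rewrite pull// muleC; have [tT|tT] := boolP (t \in `[0%R, T[); last first.
      by rewrite indicE memNset ?mul0e//=; exact/negP.
    rewrite lee_wpmul2l ?lee_fin// -Lpn_powR// -poweR_EFin.
    apply: gt0_ler_poweR; rewrite ?in_itv/= ?leey ?andbT ?lee_fin ?Lpn_ge0//; first exact: ltW.
    exact: hm.
pose s0 : V * V -> R := fun=> 0.
have ms0 : measurable_fun setT s0 by exact: measurable_cst.
have upper : (\int[leb]_t \int[Lam]_z (IT t * Phi s0 t z) <= (K `^ p * T)%:E)%E.
  rewrite [leRHS]EFinM -intI -ge0_integralZl_EFin ?powR_ge0//.
  apply: ge0_le_integral => //.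
  - by move=> t _; apply: integral_ge0 => z _; exact: Phi_ge0.
  - exact: (@measurable_fun_fubini_tonelli_F _ _ (measurableTypeR R) (V * V)%type R Lam
      (fun w => IT w.1 * Phi s0 w.1 w.2)%E (mPhi ms0) (fun w => Phi_ge0 s0 w.1 w.2)).
  - exact: measurable_funeM.
  - move=> t _; rewrite pull; last exact: ms0.
    rewrite muleC; have [tT|tT] := boolP (t \in `[0%R, T[); last first.
      by rewrite indicE memNset ?mule0//=; exact/negP.
    rewrite lee_wpmul2r ?lee_fin// -Lpn_powR// -poweR_EFin.
    apply: gt0_ler_poweR; rewrite ?in_itv/= ?leey ?andbT ?lee_fin ?Lpn_ge0//; first exact: ltW.
    rewrite -(normOmE mOm Omoo p1); last first.
      by apply: bounded_measurable_oscillation; exact: (measurable_funD ms0 (measurable_cst t)).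
    rewrite lee_fin; apply: le_trans (NK t tT); rewrite le_eqVlt; apply/orP; left; apply/eqP.
    by congr (normOm _ _ (oscillation _)); apply/funext => z; rewrite /s0 add0r.
have := le_trans lower (le_trans _ upper).
rewrite lee_fin ler_pM2r// => h.
rewrite leNgt; apply/negP => Km.
have : K `^ p < m `^ p by apply: gt0_ltr_powR; rewrite ?nnegrE.
rewrite ltNge => /negP; apply; apply: h.
by rewrite le_eqVlt; apply/orP; left; apply/eqP; exact: average_phase.
Qed.

Variable y : nat -> V * V.
Hypothesis yU : escapes U y.

(** A translation by a suitable multiple of the vector w dual to y n adds t to
    the linear phase; y n being large, w is small, and A and B hardly change.  So
    the lower bound c holds approximately for the phase s + t as well, for
    every t in [0, 2 pi), and averaging over t replaces s by a constant. *)
Lemma phase_averaging (c : R) :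
  (forall e : R, 0 < e -> \forall n \near U,
    c - e <= normOm Om p (oscillation (fun z => 4 * pi * symp (y n) z))) ->
  exists theta, c <= normOm Om p (oscillation (fun=> theta)).
Proof.
move=> hc; have T0 : 0 <= T by rewrite mulr_ge0// pi_ge0.
have [th _ hth] := EVT_max T0 (continuous_subspaceT Nt_continuous).
exists th; apply/ler_addgt0Pr => e e0.
have e3 : 0 < e / 3 by rewrite divr_gt0.
have [r1 r10 h1] := translation_small mOm Omoo p1 gA e3.
have [r2 r20 h2] := translation_small mOm Omoo p1 gB e3.
pose r : R := Num.min r1 r2; have r0 : 0 < r by rewrite lt_min r10.
have [n [cn yn]] := @filter_ex _ U _ _ (filterI (hc _ e3) (yU (1 / r ^+ 2))).
have [w [w1 w2] yw] := symp_dual r0 yn.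
set s := fun z => 4 * pi * symp (y n) z in cn.
have ms : measurable_fun setT s.
  apply: measurable_funM => //; apply: measurable_funB.
    by apply: measurable_dotv2 => //; exact: measurable_fst.
  by apply: measurable_dotv2 => //; exact: measurable_snd.
have [c0|c0] := leP (c - e / 3 - (e / 3 + e / 3)) 0.
  have := normOm_ge0 Om p (oscillation (fun=> th)).
  by move: c0; rewrite /Nt; lra.
suff : c - e / 3 - (e / 3 + e / 3) <= normOm Om p (oscillation (fun=> th)) by lra.
apply: (average_le ms (ltW c0)) => t.
  by rewrite !in_itv/= => /andP[t0 tT]; apply: hth; rewrite in_itv/= t0 ltW.
rewrite in_itv/= => /andP[t0 tT].
(* The phase is 4 pi symp, and w pairs with y n to 1/2: hence the factor 2 pi. *)
pose a := (t / (2 * pi)) *: w.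
have tau1 : `|t / (2 * pi)| <= 1.
  by rewrite ger0_norm ?divr_ge0// ler_pdivrMr ?mul1r ?ltW// (le_lt_trans t0).
have sa z : s (z + a) = s z + t.
  rewrite /s /a.
  have -> : symp (y n) (z + (t / (2 * pi)) *: w) = symp (y n) z + t / (2 * pi) * symp (y n) w.
    by rewrite /symp /= !dotvE; ring.
  rewrite yw; have key (P q S : R) : P != 0 -> 4 * P * (S + q / (2 * P) * 2^-1) = 4 * P * S + q.
    by move=> P0; field.
  by apply: key; rewrite gt_eqF// pi_gt0.
have ar q : r <= q -> small q a.
  move=> rq; split=> i; rewrite mxE normrM; apply: lt_le_trans rq.
    by apply: le_lt_trans (w1 i); rewrite ler_piMl.
  by apply: le_lt_trans (w2 i); rewrite ler_piMl.
have {}h1 : (Lpn Lam p (fun z => cutoff Om A (z + a) - cutoff Om A z)%R <= (e / 3)%:E)%E.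
  by apply: h1; apply: ar; rewrite ge_min lexx.
have {}h2 : (Lpn Lam p (fun z => cutoff Om B (z + a) - cutoff Om B z)%R <= (e / 3)%:E)%E.
  by apply: h2; apply: ar; rewrite ge_min lexx orbT.
have mst : measurable_fun setT (fun z => s z + t) by exact: measurable_funD.
have gs := bounded_measurable_oscillation ms.
have gst := bounded_measurable_oscillation mst.
have mcs := measurable_cutoff mOm gs.1; have mcst := measurable_cutoff mOm gst.1.
have mtr (u : V * V -> R) : measurable_fun setT u -> measurable_fun setT (fun z : V * V => u (z + a)).
  by move=> mu; exact: (measurableT_comp mu (ptrans_measurable a)).
have mDA : measurable_fun setT (fun z : V * V => cutoff Om A (z + a) - cutoff Om A z).
  by apply: measurable_funB; [apply: mtr|]; exact: measurable_cutoff.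
have mDB : measurable_fun setT (fun z : V * V => cutoff Om B (z + a) - cutoff Om B z).
  by apply: measurable_funB; [apply: mtr|]; exact: measurable_cutoff.
have mcos : measurable_fun setT (fun z => cos (s z + t)) by exact: (measurableT_comp measurable_cos).
have msin : measurable_fun setT (fun z => sin (s z + t)) by exact: (measurableT_comp measurable_sin).
pose DA z := cos (s z + t) * (cutoff Om A (z + a) - cutoff Om A z).
pose DB z := sin (s z + t) * (cutoff Om B (z + a) - cutoff Om B z).
have mDA' : measurable_fun setT DA by exact: measurable_funM.
have mDB' : measurable_fun setT DB by exact: measurable_funM.
have lA : (Lpn Lam p DA <= (e / 3)%:E)%E.
  apply: le_trans h1; apply: le_Lpn => // z; rewrite normrM.
  by rewrite ler_piMl// norm_cos_le1.
have lB : (Lpn Lam p DB <= (e / 3)%:E)%E.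
  apply: le_trans h2; apply: le_Lpn => // z; rewrite normrM.
  by rewrite ler_piMl// norm_sin_le1.
(* The cutoff is translated along with A and B: DA and DB bound the effect of
   the translation on all but the phase. *)
have E z : cutoff Om (oscillation s) (z + a) =
    cutoff Om (oscillation (fun w => s w + t)) z + (DA z + DB z).
  by rewrite /cutoff /oscillation /DA /DB /cutoff sa; ring.
have main : ((c - e / 3)%:E <= Lpn Lam p (cutoff Om (oscillation (fun w => (s w + t)%R))) +
    ((e / 3)%:E + (e / 3)%:E))%E.
  apply: (@le_trans _ _ (Lpn Lam p (cutoff Om (oscillation s)))).
    by rewrite -(normOmE mOm Omoo p1 gs) lee_fin.
  have -> : Lpn Lam p (cutoff Om (oscillation s)) =
      Lpn Lam p (fun z => cutoff Om (oscillation s) (z + a)).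
    rewrite !LpnE; apply: (congr1 (fun x => x `^ p^-1)%E); apply/esym.
    apply: (ge0_integral_ptrans a (G := fun z => (`|cutoff Om (oscillation s) z| `^ p)%:E)).
      exact: measurable_powR_norm.
    by move=> z; rewrite lee_fin powR_ge0.
  have -> : (fun z => cutoff Om (oscillation s) (z + a)) =
      (fun z => cutoff Om (oscillation (fun w => s w + t)) z + (DA z + DB z)).
    by apply/funext => z; exact: E.
  apply: le_trans (LpnD _ p1 mcst (measurable_funD mDA' mDB')) _.
  rewrite leeD2l//; apply: le_trans (LpnD _ p1 mDA' mDB') _.
  exact: leeD.
by rewrite EFinB EFinD leeBlDr.
Qed.

End phase_averaging.


(** * Existence of a maximizer *)

Section wigner_form.
Context {R : realType} {d : nat}.
Local Notation lam := (lebesgue_rV R d).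
Local Notation V := 'rV[R]_d.
Local Notation H := (L2T lam).
Implicit Types f g h : H.

Definition wform f : V * V -> R := fun z => ip (refl z f) f.

Lemma ip_refl_sym z f g : ip (refl z f) g = ip (refl z g) f.
Proof. by rewrite ip_refl ipC. Qed.

Lemma ip_refl_le z f g : `|ip (refl z f) g| <= nrm f * nrm g.
Proof. by apply: le_trans (CS _ _) _; rewrite /nrm nsq_refl. Qed.

Lemma bounded_measurable_refl f g : bounded_measurable (fun z => ip (refl z f) g).
Proof.
by split; [exact: measurable_ip_refl|exists (nrm f * nrm g) => z; exact: ip_refl_le].
Qed.

Lemma wformD f g z : wform (f + g) z = wform f z + (2 * ip (refl z f) g + wform g z).
Proof.
rewrite /wform reflD !ipDl !ipDr (ip_refl_sym z g f); ring.
Qed.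

Lemma wformZ c f z : wform (c *: f) z = sqn c * wform f z.
Proof.
rewrite /wform reflZ ipZJ scalerA (_ : conjc c * c = (sqn c)%:C%C) ?ipZr//.
by case: c => a b; apply: eqcP; rewrite /sqn /=; ring.
Qed.

Lemma ip_expi t f g : ip (expi t *: f) g =
  cos t * ip f g + sin t * ip ((0 +i* 1)%C *: f) g.
Proof.
have -> : expi t = (cos t)%:C%C + (sin t)%:C%C * (0 +i* 1)%C.
  by rewrite /expi; apply: eqcP => /=; ring.
by rewrite scalerDl -scalerA ipDl !ipZl.
Qed.

Lemma unit_vector : exists f : H, nsq f = 1.
Proof.
pose F : H := cindL2 1 (measurable_box 1) (lebesgue_box_lty ltr01).
have F0 : 0 < nsq F.
  rewrite -lte_fin EFin_nsq; have mb := @measurable_box R d 1.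
  rewrite (_ : integral _ _ _ = (((2 * 1) ^+ d : R)%:E)); first by rewrite lte_fin exprn_gt0// mulr_gt0.
  transitivity (\int[lam]_t (\1_(box 1) t)%:E)%E.
    by apply: eq_integral => t _; rewrite /= sqn_cind /sqn /= expr1n expr0n addr0 mul1r.
  by rewrite integral_indic// setIT; exact: lebesgue_box.
exists ((nrm F)^-1%:C%C *: F); rewrite nsqZ /sqn /= expr0n addr0 exprVn sqr_nrm mulVf//.
by rewrite gt_eqF.
Qed.

Lemma nsq0_ip f : nsq f = 0 -> forall h, ip h f = 0.
Proof.
move=> f0 h; apply/eqP; rewrite -normr_le0; apply: le_trans (CS _ _) _.
by rewrite [nrm f]/nrm f0 sqrtr0 mulr0.
Qed.

End wigner_form.

Section maximizer.
Context {R : realType} {d : nat}.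
Local Notation lam := (lebesgue_rV R d).
Local Notation Lam := (@lebesgue_phase R d).
Local Notation V := 'rV[R]_d.
Local Notation H := (L2T lam).
Implicit Types f g h : H.
Variables (Om : set (V * V)) (p : R).
Hypothesis mOm : measurable Om.
Hypothesis Omoo : (Lam Om < +oo)%E.
Hypothesis p1 : 1 <= p.
Local Notation N := (normOm Om p).

Definition quotients : set R := [set N (wform f) | f in [set f : H | nsq f = 1]].

Definition best_quotient : R := sup quotients.

Local Notation L := best_quotient.

Lemma bounded_measurable_wform f : bounded_measurable (wform f).
Proof. exact: bounded_measurable_refl. Qed.

Lemma has_sup_quotients : has_sup quotients.
Proof.
split; first by have [f f1] := @unit_vector R d; exists (N (wform f)), f.
exists (N (cst 1)) => _ [f f1 <-]; rewrite -[leRHS]mul1r.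
apply: normOm_bound => // [|z]; first exact: bounded_measurable_wform.
by apply: le_trans (ip_refl_le _ _ _) _; rewrite -expr2 sqr_nrm f1.
Qed.

Lemma best_quotient_ge f : N (wform f) <= L * nsq f.
Proof.
have := nsq_ge0 f; rewrite le_eqVlt => /predU1P[f0|f0].
  rewrite -f0 mulr0 -[leRHS](mul0r (N (cst 1))).
  apply: normOm_bound => // [|z]; first exact: bounded_measurable_wform.
  by apply: le_trans (ip_refl_le _ _ _) _; rewrite -expr2 sqr_nrm f0.
pose c : R[i] := (nrm f)^-1%:C%C; pose u := c *: f.
have sc : sqn c = (nsq f)^-1 by rewrite /sqn /= expr0n addr0 exprVn sqr_nrm.
have u1 : nsq u = 1 by rewrite nsqZ sc mulVf// gt_eqF.
have : N (wform u) <= L by apply: sup_ubound; [case: has_sup_quotients|exists u].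
have -> : wform u = (fun z => (nsq f)^-1 * wform f z).
  by apply/funext => z; rewrite wformZ sc.
rewrite normOmZ//; last exact: bounded_measurable_wform.
by rewrite gtr0_norm ?invr_gt0// ler_pdivrMl// mulrC.
Qed.

Lemma maximizing_sequence : exists f : nat -> H, (forall n, nsq (f n) = 1) /\
  forall n, L - n.+1%:R^-1 <= N (wform (f n)).
Proof.
have /choice[f fP] : forall n, exists f : H, nsq f = 1 /\ L - n.+1%:R^-1 <= N (wform f).
  move=> n; have n0 : 0 < n.+1%:R^-1 :> R by rewrite invr_gt0.
  have [_ [f f1 <-] h] := sup_adherent n0 has_sup_quotients.
  by exists f; split=> //; exact: ltW.
by exists f; split=> n; case: (fP n).
Qed.

Variable U : set_system nat.
Context {UU : UltraFilter U}.

Lemma locally_nullD (B C : nat -> V * V -> R) : locally_null U B -> locally_null U C ->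
  locally_null U (fun n z => B n z + C n z).
Proof.
move=> hB hC r e r0 e0; have e2 : 0 < e / 2 by rewrite divr_gt0.
apply: filterS2 (hB r _ r0 e2) (hC r _ r0 e2) => n h1 h2 w wr.
by rewrite [e]splitr; apply: le_trans (ler_normD _ _) (lerD (h1 w wr) (h2 w wr)).
Qed.

Lemma locally_null_double (B : nat -> V * V -> R) : locally_null U B ->
  locally_null U (fun n z => 2 * B n z).
Proof.
move=> hB; have := locally_nullD hB hB; congr locally_null.
by apply/funext => n; apply/funext => z; rewrite mulr2n mulrDl mul1r.
Qed.

(** First case: a nonzero weak limit is itself a maximizer, since the remainder
    cannot do better than L times its own mass. *)
Lemma weak_limit_maximizes (f : nat -> H) g : (forall n, nsq (f n) = 1) ->
  (forall e : R, 0 < e -> \forall n \near U, L - e <= N (wform (f n))) -> 0 <= L ->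
  (forall h, (fun n => ip h (f n)) @ U --> ip h g) -> L * nsq g <= N (wform g).
Proof.
move=> f1 fL L0 fg; pose r n := f n - g.
have rw : weakly_null U r.
  move=> h; rewrite -(subrr (ip h g)); under eq_fun do rewrite ipDr ipNr.
  by apply: cvgB; [exact: fg|exact: cvg_cst].
pose Mr := 2 * (1 + nsq g).
have rM n : nsq (r n) <= Mr by apply: le_trans (nsqD_le _ _) _; rewrite nsqN f1.
have cross : locally_null U (fun n z => ip (refl z g) (r n)).
  have := @locally_null_refl R d U UU g r (fun _ _ => 1) Mr _ rM rw.
  under eq_fun do under eq_fun do rewrite scale1r.
  by apply=> n w; rewrite /sqn /= expr1n expr0n addr0.
have crossN := normOm_locally_null mOm Omoo p1 cross
  (fun n => bounded_measurable_refl g (r n)) (M := nrm g * Num.sqrt Mr) _.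
have {}crossN e : 0 < e -> \forall n \near U, N (fun z => ip (refl z g) (r n)) <= e.
  apply: crossN => n z; apply: le_trans (ip_refl_le _ _ _) _.
  by rewrite ler_wpM2l ?nrm_ge0// ler_wsqrtr.
apply/ler_addgt0Pr => e e0; pose q := e / (3 + 2 * L).
have k0 : 0 < 3 + 2 * L by rewrite ltr_pwDl// mulr_ge0.
have q0 : 0 < q by rewrite divr_gt0.
have qe : q * (3 + 2 * L) = e by rewrite /q divfK// gt_eqF.
have /cvgrPdist_le /(_ _ q0) ng := fg g.
have [n [[n1 n2] n3]] := @filter_ex _ U _ _ (filterI (filterI (fL _ q0) (crossN _ q0)) ng).
have nr : nsq (r n) <= 1 - nsq g + 2 * q.
  move: n3; rewrite -/(nsq g) nsqB f1 (ipC (f n)) ler_norml => /andP[_]; lra.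
have : N (wform (f n)) <= N (wform g) + (2 * q + L * (1 - nsq g + 2 * q)).
  have -> : wform (f n) = (fun z => wform g z + (2 * ip (refl z g) (r n) + wform (r n) z)).
    by apply/funext => z; rewrite -wformD /r addrC subrK.
  have gw := bounded_measurable_wform; have gc := bounded_measurable_refl g (r n).
  have g2 := bounded_measurableZ 2 gc.
  apply: le_trans (normOmD mOm Omoo p1 (gw _) (bounded_measurableD g2 (gw _))) _.
  rewrite lerD2l; apply: le_trans (normOmD mOm Omoo p1 g2 (gw _)) _; apply: lerD.
    by rewrite normOmZ// ger0_norm// ler_wpM2l.
  by apply: le_trans (best_quotient_ge _) _; rewrite ler_wpM2l.
move: n1 qe; move: (N (wform (f n))) (N (wform g)) (nsq g) => x y s.
by move=> *; nra.
Qed.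

(** Second case: by the vanishing estimate, a weakly null maximizing sequence
    keeps some mass along shifts, which must then escape to infinity. *)
Lemma escaping_profile (f : nat -> H) : (forall n, nsq (f n) = 1) -> 0 < L ->
  (forall e : R, 0 < e -> \forall n \near U, L - e <= N (wform (f n))) ->
  weakly_null U f ->
  exists phi z, exists2 delta : R, 0 < delta & escapes U z /\ \forall n \near U,
  delta <= ip (f n) (tfshift (z n) phi) ^+ 2 + ip (f n) ((0 +i* 1)%C *: tfshift (z n) phi) ^+ 2.
Proof.
move=> f1 L0 fL fw; have L2 : 0 < L / 3 by rewrite divr_gt0.
have [r r0 [eps eps0 hr]] := normOm_small mOm Omoo p1 ler01 L2.
have [phi [C C0 hC]] := @vanishing_estimate R d r r0.
have C1 : 0 < C + 1 by rewrite ltr_wpDl.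
pose delta := eps / (C + 1); have delta0 : 0 < delta by rewrite divr_gt0.
pose S n z := ip (f n) (tfshift z phi) ^+ 2 + ip (f n) ((0 +i* 1)%C *: tfshift z phi) ^+ 2.
have /choice[z zP] : forall n, exists z, L - L / 3 <= N (wform (f n)) -> delta <= S n z.
  move=> n; have [[z hz]|nz] := pselect (exists z, delta <= S n z); first by exists z.
  exists 0 => Ln; exfalso.
  have Sd z : S n z <= delta.
    by rewrite leNgt; apply/negP => /ltW h; apply: nz; exists z.
  have : N (wform (f n)) <= L / 3.
    apply: hr; [exact: bounded_measurable_wform| |].
      by move=> z; apply: le_trans (ip_refl_le _ _ _) _; rewrite -expr2 sqr_nrm f1.
    pose G (z : V * V) := (\1_(bbox r) z * wform (f n) z ^+ 2)%:E.
    have mG : measurable_fun setT G.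
      apply/measurable_EFinP; apply: measurable_funM.
        by apply: measurable_indic; exact: measurable_bbox.
      by apply: measurable_funX; exact: measurable_ip_refl.
    have G0 z : (0 <= G z)%E by rewrite lee_fin mulr_ge0 ?sqr_ge0.
    have FT : (\int[Lam]_z G z = \int[lam]_x \int[lam]_xi G (x, xi))%E.
      exact: (@fubini_tonelli1 _ _ V V R lam lam G mG G0).
    rewrite [leLHS]FT; have := hC (f n) delta Sd; rewrite f1 mulr1.
    have -> : (\int[lam]_x \int[lam]_xi (\1_(box r) x * \1_(box r) xi * ip (refl (x, xi) (f n)) (f n) ^+ 2)%:E =
        \int[lam]_x \int[lam]_xi G (x, xi))%E.
      apply: eq_integral => x _; apply: eq_integral => xi _.
      rewrite /G /bbox /wform !indicE in_setX/=; congr (_ * _)%:E.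
      by case: (x \in _); case: (xi \in _); rewrite ?mulr1 ?mulr0 ?mul0r.
    move=> h; apply: le_trans h _; rewrite lee_fin /delta mulrCA ler_piMr ?(ltW eps0)//.
    by rewrite ler_pdivrMr// mul1r lerDl.
  by move: Ln L0; move: (N (wform (f n))) => x; lra.
exists phi, z, delta => //.
have near_delta : \forall n \near U, delta <= S n (z n).
  by apply: filterS (fL _ L2) => n; exact: zP.
split=> //; apply: contrapT => /not_escapes[q q0 [z' z'q zz']].
have e0 : 0 < Num.sqrt delta / 2 by rewrite divr_gt0// sqrtr_gt0.
have one1 : sqn (1 : R[i]) = 1 by rewrite /sqn /= expr1n expr0n addr0.
have i1 : sqn ((0 +i* 1)%C : R[i]) = 1 by rewrite /sqn /= expr1n expr0n add0r.
have f1' n : nsq (f n) <= 1 by rewrite f1.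
have b1 := bounded_shift_null phi z'q (fun=> one1) f1' fw e0.
have b2 := bounded_shift_null phi z'q (fun=> i1) f1' fw e0.
have [n [[n1 n2] [n3 n4]]] := @filter_ex _ U _ _ (filterI (filterI near_delta zz') (filterI (b1 UU) (b2 UU))).
move: n1; rewrite /S -n2 leNgt => /negP; apply.
have dE : delta = 4 * (Num.sqrt delta / 2) ^+ 2.
  by rewrite exprMn sqr_sqrtr ?(ltW delta0)//; field.
have sq (x : R) : `|x| <= Num.sqrt delta / 2 -> x ^+ 2 <= (Num.sqrt delta / 2) ^+ 2.
  by move=> h; rewrite -(real_normK (num_real x)) lerXn2r ?nnegrE ?(ltW e0).
rewrite scale1r in n3.
have := sq _ n3; have := sq _ n4; rewrite !(ipC (f n)) [X in _ < X]dE.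
by have := exprn_gt0 2 e0; move: (_ ^+ 2) (_ ^+ 2) (_ ^+ 2) => a b c; lra.
Qed.

End maximizer.


Lemma remainder_arith (R : realType) (x y t u v q : R) :
  `|x| <= q -> `|u - y| <= q -> `|v - t| <= q ->
  1 + (u + v + 2 * x) - 2 * (y + t) <= 1 - u - v + 6 * q.
Proof. by rewrite !ler_norml => /andP[_ ?] /andP[_ ?] /andP[_ ?]; lra. Qed.

Lemma interaction_arith (R : realType) (l x y s t q e : R) :
  l - q <= x -> q * (2 + 6 * l) = e -> x <= 2 * y + (q + l * (1 - s - t + 6 * q)) ->
  l * (s + t) - e <= 2 * y.
Proof. by move=> *; nra. Qed.

Lemma parallelogram_arith (R : realType) (l n s a b : R) :
  l * n <= 2 * s -> 4 * s <= a + b -> l * (2 * n) <= a + b.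
Proof. by move=> *; lra. Qed.

Section two_profiles.
Context {R : realType} {d : nat}.
Local Notation lam := (lebesgue_rV R d).
Local Notation Lam := (@lebesgue_phase R d).
Local Notation V := 'rV[R]_d.
Local Notation H := (L2T lam).
Implicit Types f g h : H.
Variable U : set_system nat.
Context {UU : UltraFilter U}.

Lemma escapesN (z : nat -> V * V) : escapes U z -> escapes U (fun n => - z n).
Proof.
by move=> zU N; apply: filterS (zU N) => n; rewrite /= !dotvNl !dotvNr !opprK.
Qed.

Lemma escapes2 (z : nat -> V * V) : escapes U z -> escapes U (fun n => 2%:R *: z n).
Proof.
move=> zU N; apply: filterS (zU `|N|) => n; rewrite /= !dotvZl !dotvZr.
have := ler_norm N; have := normr_ge0 N.
by move: (dotv _ _) (dotv _ _) => a b; lra.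
Qed.

(** Reflecting D_z g gives D_{-z} of a reflection of g, so that its product with
    D_z g is a matrix coefficient of the shift by -2 z. *)
Lemma locally_null_diagonal (z : nat -> V * V) g : escapes U z ->
  locally_null U (fun n w => wform (tfshift (z n) g) w).
Proof.
move=> zU.
have c1 (n : nat) (w : V * V) : sqn (expi (4 * pi * symp (z n) w)) = 1 by exact: sqn_expi.
have := @locally_null_escaping R d U UU _ g g _ (escapes2 (escapesN zU)) c1.
congr locally_null; apply/funext => n; apply/funext => w.
rewrite /wform refl_tfshift -[in RHS](opprK (z n)) -ip_tfshiftl opprK.
by rewrite tfshiftZ tfshift2.
Qed.

(** Moving the shift from one factor to the other: the reflection of D_z g tests
    r through D_z r, with the opposite sign. *)
Lemma locally_null_cross (z : nat -> V * V) g (r : nat -> H) (M : R) :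
  (forall n, nsq (r n) <= M) -> weakly_null U (fun n => tfshift (z n) (r n)) ->
  locally_null U (fun n w => ip (refl w (tfshift (z n) g)) (r n)).
Proof.
move=> rM rw.
have c1 (n : nat) (w : V * V) : sqn (expi (4 * pi * symp (z n) w)) = 1 by exact: sqn_expi.
have rM' n : nsq (tfshift (z n) (r n)) <= M by rewrite nsq_tfshift.
have := @locally_null_refl R d U UU g _ _ _ c1 rM' rw.
congr locally_null; apply/funext => n; apply/funext => w.
by rewrite [in RHS]refl_tfshift -[in RHS]tfshiftZ [RHS]ip_tfshiftl opprK.
Qed.

(** In the frame of one profile the other one is shifted twice as far and
    disappears in the weak limit. *)
Lemma weakly_null_remainder (z : nat -> V * V) (f : nat -> H) g h : escapes U z ->
  (forall k, (fun n => ip k (tfshift (z n) (f n))) @ U --> ip k h) ->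
  weakly_null U (fun n => tfshift (z n) (f n - (tfshift (z n) g + tfshift (- z n) h))).
Proof.
move=> zU fh k; have E n : ip k (tfshift (z n) (f n - (tfshift (z n) g + tfshift (- z n) h))) =
    ip k (tfshift (z n) (f n)) - (ip k (tfshift (2%:R *: z n) g) + ip k h).
  rewrite tfshiftD -scaleN1r tfshiftZ scaleN1r tfshiftD tfshift2 tfshiftKN.
  by rewrite ipDr ipNr ipDr.
under eq_fun do rewrite E.
suff : (fun n => ip k (tfshift (z n) (f n)) - (ip k (tfshift (2%:R *: z n) g) + ip k h)) @ U
    --> ip k h - (0 + ip k h) by rewrite add0r subrr.
apply: cvgB; first exact: fh.
apply: cvgD; last exact: cvg_cst.
have one1 (n : nat) : sqn (1 : R[i]) = 1 by rewrite /sqn /= expr1n expr0n addr0.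
apply/cvgrPdist_le => e e0.
apply: filterS (@escaping_shift_null R d U UU _ g k _ (escapes2 zU) one1 _ e0) => n.
by rewrite scale1r sub0r normrN ipC.
Qed.

Variables (Om : set (V * V)) (p : R).
Hypothesis mOm : measurable Om.
Hypothesis Omoo : (Lam Om < +oo)%E.
Hypothesis p1 : 1 <= p.
Local Notation N := (normOm Om p).
Local Notation L := (@best_quotient R d Om p).

(** The two profiles a and b are asymptotically orthogonal, so the remainder
    r = f - a - b has mass about 1 - nsq g - nsq h, and it contributes at most L
    times this.  The forms of a and of b alone and their interactions with r
    tend to 0 locally, and the interaction of a with b is left. *)
Lemma interaction_lower (z : nat -> V * V) (f : nat -> H) g h :
  (forall n, nsq (f n) = 1) -> 0 <= L ->
  (forall e : R, 0 < e -> \forall n \near U, L - e <= N (wform (f n))) ->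
  escapes U z ->
  (forall k, (fun n => ip k (tfshift (- z n) (f n))) @ U --> ip k g) ->
  (forall k, (fun n => ip k (tfshift (z n) (f n))) @ U --> ip k h) ->
  forall e : R, 0 < e -> \forall n \near U, L * (nsq g + nsq h) - e <=
    2 * N (fun w => ip (expi (4 * pi * symp (z n) w) *: refl w g) h).
Proof.
move=> f1 L0 fL zU fg fh e e0.
pose a n := tfshift (z n) g; pose b n := tfshift (- z n) h.
pose r n := f n - (a n + b n).
pose Mr := 2 * (1 + 2 * (nsq g + nsq h)).
have rM n : nsq (r n) <= Mr.
  apply: le_trans (nsqD_le _ _) _; rewrite nsqN f1 ler_pM2l// lerD2l.
  by apply: le_trans (nsqD_le _ _) _; rewrite !nsq_tfshift.
have rw1 : weakly_null U (fun n => tfshift (z n) (r n)) by exact: weakly_null_remainder.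
have rw2 : weakly_null U (fun n => tfshift (- z n) (r n)).
  have fh' k : (fun n => ip k (tfshift (- z n) (f n))) @ U --> ip k g by exact: fg.
  have := weakly_null_remainder h (escapesN zU) fh'.
  congr weakly_null; apply/funext => n; congr (tfshift _ _).
  by rewrite /r /a /b opprK [tfshift (z n) g + _]addrC.
(* All the terms of the expansion except the interaction of a with b and the form
   of r. *)
pose E n w := (wform (a n) w + wform (b n) w) +
  (2 * ip (refl w (a n)) (r n) + 2 * ip (refl w (b n)) (r n)).
have gE n : bounded_measurable (E n).
  by apply: bounded_measurableD; apply: bounded_measurableD;
    try exact: bounded_measurable_wform; apply: bounded_measurableZ; exact: bounded_measurable_refl.
have Enull : locally_null U E.
  apply: locally_nullD; apply: locally_nullD.
  - exact: locally_null_diagonal.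
  - exact: locally_null_diagonal (escapesN zU).
  - by apply: locally_null_double; exact: locally_null_cross rM rw1.
  - by apply: locally_null_double; exact: (@locally_null_cross (fun n => - z n) h _ _ rM rw2).
have sMr n : nrm (r n) <= Num.sqrt Mr by exact: ler_wsqrtr.
have aE n : nrm (a n) = nrm g by rewrite /nrm nsq_tfshift.
have bE n : nrm (b n) = nrm h by rewrite /nrm nsq_tfshift.
pose ME := (nrm g * nrm g + nrm h * nrm h) +
  (2 * (nrm g * Num.sqrt Mr) + 2 * (nrm h * Num.sqrt Mr)).
have EM n w : `|E n w| <= ME.
  apply: le_trans (ler_normD _ _) _; apply: lerD; apply: le_trans (ler_normD _ _) _; apply: lerD.
  - by rewrite -(aE n); exact: ip_refl_le.
  - by rewrite -(bE n); exact: ip_refl_le.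
  - rewrite normrM ger0_norm// ler_pM2l//; apply: le_trans (ip_refl_le _ _ _) _.
    by rewrite aE ler_wpM2l ?nrm_ge0.
  - rewrite normrM ger0_norm// ler_pM2l//; apply: le_trans (ip_refl_le _ _ _) _.
    by rewrite bE ler_wpM2l ?nrm_ge0.
pose q := e / (2 + 6 * L); have k0 : 0 < 2 + 6 * L by rewrite ltr_pwDl// mulr_ge0.
have q0 : 0 < q by rewrite divr_gt0.
have qe : q * (2 + 6 * L) = e by rewrite /q divfK// gt_eqF.
have nE := @normOm_locally_null R d Om p mOm Omoo p1 U UU _ _ Enull gE EM _ q0.
have one1 (n : nat) : sqn (1 : R[i]) = 1 by rewrite /sqn /= expr1n expr0n addr0.
have nab := @escaping_shift_null R d U UU _ g h _ (escapes2 zU) one1 _ q0.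
have ng : \forall n \near U, `|nsq g - ip g (tfshift (- z n) (f n))| <= q.
  by have /cvgrPdist_le /(_ _ q0) := fg g.
have nh : \forall n \near U, `|nsq h - ip h (tfshift (z n) (f n))| <= q.
  by have /cvgrPdist_le /(_ _ q0) := fh h.
apply: filterS3 (filterI (fL _ q0) nE) nab (filterI ng nh) => n [Ln En] abn [gn hn].
have nr : nsq (r n) <= 1 - nsq g - nsq h + 6 * q.
  rewrite /r nsqB f1 nsqD !nsq_tfshift ipDr.
  have -> : ip (a n) (b n) = ip (tfshift (2%:R *: z n) g) h.
    by rewrite /a /b -ip_tfshiftl tfshift2.
  rewrite scale1r in abn.
  have -> : ip (f n) (a n) = ip g (tfshift (- z n) (f n)).
    by rewrite ipC /a ip_tfshiftl.
  have -> : ip (f n) (b n) = ip h (tfshift (z n) (f n)).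
    by rewrite ipC /b ip_tfshiftl opprK.
  exact: remainder_arith abn gn hn.
pose I w := ip (expi (4 * pi * symp (z n) w) *: refl w g) h.
have IE w : ip (refl w (a n)) (b n) = I w.
  by rewrite /I /a /b refl_tfshift -[in LHS]tfshiftZ ip_tfshift.
have gI : bounded_measurable I.
  have -> : I = (fun w => ip (refl w (a n)) (b n)) by apply/funext => w; rewrite IE.
  exact: bounded_measurable_refl.
have : N (wform (f n)) <= 2 * N I + (q + L * (1 - nsq g - nsq h + 6 * q)).
  have -> : wform (f n) = (fun w => 2 * I w + (E n w + wform (r n) w)).
    apply/funext => w; have -> : f n = (a n + b n) + r n by rewrite /r addrC subrK.
    rewrite wformD wformD reflD ipDl -IE /E.
    by ring.
  have gr := bounded_measurable_wform (r n).
  apply: le_trans (normOmD mOm Omoo p1 (bounded_measurableZ 2 gI) (bounded_measurableD (gE n) gr)) _.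
  rewrite normOmZ// ger0_norm// lerD2l.
  apply: le_trans (normOmD mOm Omoo p1 (gE n) gr) _; apply: lerD => //.
  by apply: le_trans (best_quotient_ge mOm Omoo p1 _) _; rewrite ler_wpM2l.
exact: interaction_arith Ln qe.
Qed.

(** A constant phase optimal for the interaction makes the parallelogram identity
    for the two combinations of the profiles force both to be maximizers. *)
Lemma aligned_profiles_maximize g h (theta : R) : 0 < nsq g ->
  L * (nsq g + nsq h) <= 2 * N (fun w => ip (expi theta *: refl w g) h) ->
  exists2 f : H, 0 < nsq f & L * nsq f <= N (wform f).
Proof.
move=> g0 gh; pose k := conjc (expi theta) *: h.
have kn : nsq k = nsq h by rewrite nsqZ sqn_conj sqn_expi mul1r.
have kE w : ip (refl w g) k = ip (expi theta *: refl w g) h.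
  by rewrite [RHS]ipZJ.
have sumE w : 4 * ip (refl w g) k = wform (g + k) w + (-1) * wform (g - k) w.
  have E : wform (- k) w = wform k w.
    by rewrite -scaleN1r wformZ sqnN /sqn /= expr1n expr0n addr0 mul1r.
  by rewrite !wformD E ipNr; ring.
have sumn : nsq (g + k) + nsq (g - k) = 2 * (nsq g + nsq h).
  by rewrite nsqD nsqB kn; ring.
have gw := @bounded_measurable_wform R d.
have gk := bounded_measurable_refl g k.
have up : 4 * N (fun w => ip (refl w g) k) <= N (wform (g + k)) + N (wform (g - k)).
  rewrite -[4]ger0_norm// -normOmZ//.
  have -> : (fun w => 4 * ip (refl w g) k) = (fun w => wform (g + k) w + (-1) * wform (g - k) w).
    by apply/funext => w; rewrite sumE.
  apply: le_trans (normOmD mOm Omoo p1 (gw _) (bounded_measurableZ (-1) (gw _))) _.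
  by rewrite [N (fun z => -1 * _)]normOmZ// normrN1 mul1r.
have ghk : L * (nsq g + nsq h) <= 2 * N (fun w => ip (refl w g) k).
  by rewrite (_ : (fun w => ip (refl w g) k) = (fun w => ip (expi theta *: refl w g) h))//; apply/funext.
have b1 := best_quotient_ge mOm Omoo p1 (g + k).
have b2 := best_quotient_ge mOm Omoo p1 (g - k).
have tot : L * (nsq (g + k) + nsq (g - k)) <= N (wform (g + k)) + N (wform (g - k)).
  by rewrite sumn; exact: parallelogram_arith ghk up.
have [nz|z] := ltP 0 (nsq (g + k)).
  by exists (g + k) => //; move: tot b2; rewrite mulrDr; move: (L * _) (L * _) => x y; lra.
exists (g - k).
  by have := nsq_ge0 h; lra.
by move: tot b1; rewrite mulrDr; move: (L * _) (L * _) => x y; lra.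
Qed.

End two_profiles.

(** Either the weak limit of a maximizing sequence is nonzero, or two opposite
    profiles carry the limit and can be given a common phase. *)
Theorem maximizer (R : realType) (d : nat) (Om : set ('rV[R]_d * 'rV[R]_d)) (p : R) :
  measurable Om -> (@lebesgue_phase R d Om < +oo)%E -> 1 <= p ->
  exists2 f : L2T (lebesgue_rV R d), 0 < nsq f &
    best_quotient Om p * nsq f <= normOm Om p (wform f).
Proof.
move=> mOm Omoo p1; set L := best_quotient _ _.
have [L0|L0] := leP L 0.
  have [f f1] := @unit_vector R d; exists f; first by rewrite f1.
  by rewrite f1 mulr1 (le_trans L0)// normOm_ge0.
have [f [f1 fL']] := maximizing_sequence mOm Omoo p1.
have [U [UU UN]] := @ultraFilterLemma _ \oo _.
have fL (e : R) : 0 < e -> \forall n \near U, L - e <= normOm Om p (wform (f n)).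
  move=> e0; apply: UN; near=> n; apply: le_trans (fL' n); rewrite lerD2l lerN2.
  by apply: ltW; near: n; exact: (near_infty_natSinv_lt (PosNum e0)).
have f1' n : nsq (f n) <= 1 by rewrite f1.
have [f0 fw] := weak_limit f1'.
have [nf|nf] := ltP 0 (nsq f0).
  by exists f0 => //; apply: weak_limit_maximizes fw => //; exact: ltW.
have {nf}nf : nsq f0 = 0 by apply: le_anti; rewrite nf nsq_ge0.
have f_null : weakly_null U f.
  by move=> k; have := fw k; rewrite (nsq0_ip nf).
(* Now f is weakly null, and the profiles are those seen from z n and - z n. *)
have [phi [z [delta delta0 [zU zd]]]] := escaping_profile mOm Omoo p1 f1 L0 fL f_null.
have zf1 n : nsq (tfshift (z n) (f n)) <= 1 by rewrite nsq_tfshift f1.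
have zf2 n : nsq (tfshift (- z n) (f n)) <= 1 by rewrite nsq_tfshift f1.
have [h hw] := weak_limit zf1; have [g gw] := weak_limit zf2.
(* The coefficients against the shifted window would tend to 0 if g were null. *)
have g0 : 0 < nsq g.
  rewrite lt_neqAle nsq_ge0 andbT eq_sym; apply/negP => /eqP g0.
  have e0 : 0 < Num.sqrt delta / 2 by rewrite divr_gt0// sqrtr_gt0.
  have gnull : weakly_null U (fun n => tfshift (- z n) (f n)).
    by move=> k; have := gw k; rewrite (nsq0_ip g0).
  have n1 := weakly_null_near gnull phi e0.
  have n2 := weakly_null_near gnull ((0 +i* 1)%C *: phi) e0.
  have [n [dn [h1 h2]]] := @filter_ex _ U _ _ (filterI zd (filterI (n1 UU) (n2 UU))).
  move: dn; rewrite -tfshiftZ !(ipC (f n)) !ip_tfshiftl leNgt => /negP; apply.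
  have dE : delta = 4 * (Num.sqrt delta / 2) ^+ 2.
    by rewrite exprMn sqr_sqrtr ?(ltW delta0)//; field.
  have sq (x : R) : `|x| <= Num.sqrt delta / 2 -> x ^+ 2 <= (Num.sqrt delta / 2) ^+ 2.
    by move=> hx; rewrite -(real_normK (num_real x)) lerXn2r ?nnegrE ?(ltW e0).
  have := sq _ h1; have := sq _ h2; rewrite [X in _ < X]dE.
  by have := exprn_gt0 2 e0; move: (_ ^+ 2) (_ ^+ 2) (_ ^+ 2) => a b c; lra.
have low := interaction_lower mOm Omoo p1 f1 (ltW L0) fL zU gw hw.
pose A w := ip (refl w g) h; pose B w := ip ((0 +i* 1)%C *: refl w g) h.
have BE w : B w = ip (refl w ((0 +i* 1)%C *: g)) h by rewrite reflZ.
have AM w : `|A w| <= nrm g * nrm h by exact: ip_refl_le.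
have BM w : `|B w| <= nrm g * nrm h.
  rewrite BE; apply: le_trans (ip_refl_le _ _ _) _.
  by rewrite nrm_unimodular// /sqn /= expr1n expr0n add0r.
have mA : measurable_fun setT A by exact: measurable_ip_refl.
have mB : measurable_fun setT B.
  by rewrite (_ : B = (fun w => ip (refl w ((0 +i* 1)%C *: g)) h)); [exact: measurable_ip_refl|apply/funext].
have [|theta hth] := @phase_averaging R d Om p mOm Omoo p1 U UU A B _ mA mB AM BM z zU
    (L * (nsq g + nsq h) / 2).
  move=> e e0; have e2 : 0 < 2 * e by rewrite mulr_gt0.
  apply: filterS (low UU _ e2) => n; rewrite -/L.
  rewrite (_ : (fun w => ip (expi (4 * pi * symp (z n) w) *: refl w g) h) =
     oscillation A B (fun w => 4 * pi * symp (z n) w)); last first.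
    by apply/funext => w; rewrite ip_expi.
  by move: (normOm _ _ _) => x; lra.
apply: (@aligned_profiles_maximize R d Om p mOm Omoo p1 g h theta g0).
rewrite -/L (_ : (fun w => ip (expi theta *: refl w g) h) = oscillation A B (fun=> theta)).
  by move: hth; move: (normOm _ _ _) => x; lra.
by apply/funext => w; rewrite ip_expi.
Unshelve. all: by end_near. Qed.


(** * From the completed measure to the Borel measure *)

Section completion.
Context {d} {T : measurableType d} {R : realType}.
Variable mu : {measure set T -> \bar R}.
Hypothesis mu_sfinite : sigma_finite setT mu.
Local Notation cT := (caratheodory_type mu^*%mu).
Local Notation cmu := (completed_measure_extension (mu := mu)).

Lemma completionE (A : set T) : measurable A -> (mu^*)%mu A = mu A.
Proof. exact: measurable_mu_extE. Qed.

Lemma caratheodory_of_measurable (A : set T) : measurable A -> (mu^*)%mu.-cara.-measurable A.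
Proof. by move=> mA; apply: sub_caratheodory; exact: sub_sigma_algebra. Qed.

(** Covers of the outer measure give a measurable hull of the same measure. *)
Lemma measurable_hull (E : set T) : exists2 F : set T, measurable F &
  E `<=` F /\ mu F = (mu^*)%mu E.
Proof.
have [Eoo|Eoo] := eqVneq ((mu^*)%mu E) +oo%E.
  exists setT => //; split => //; apply/eqP; rewrite Eoo -leye_eq -Eoo -completionE//.
  exact: le_outer_measure.
have Efin : (mu^*)%mu E \is a fin_num by rewrite ge0_fin_numE ?outer_measure_ge0// ltey.
have /choice[G GP] : forall n, exists G : set T,
    [/\ measurable G, E `<=` G & (mu G <= (mu^*)%mu E + n.+1%:R^-1%:E)%E].
  move=> n; have n0 : (0 < n.+1%:R^-1 :> R) by rewrite invr_gt0.
  have [_ [A [mA EA] <-] lt] := lb_ereal_inf_adherent n0 Efin.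
  exists (\bigcup_k A k); split => //; first exact: bigcup_measurable.
  apply: le_trans (ltW lt); apply: measure_sigma_subadditive => //.
  exact: bigcup_measurable.
exists (\bigcap_n G n); first by apply: bigcapT_measurable => n; case: (GP n).
have mG : measurable (\bigcap_n G n) by apply: bigcapT_measurable => n; case: (GP n).
have EG : E `<=` \bigcap_n G n by apply: sub_bigcap => n _; case: (GP n).
split => //; apply/eqP; rewrite eq_le; apply/andP; split; last first.
  by rewrite -completionE//; exact: le_outer_measure.
apply/lee_addgt0Pr => e e0; near \oo => n.
have [mGn _ h] := GP n.
apply: (@le_trans _ _ (mu (G n))).
  by apply: le_measure; rewrite ?inE//; exact: bigcap_inf.
apply: le_trans h _; rewrite leeD2l// lee_fin ltW//.
by near: n; exact: (near_infty_natSinv_lt (PosNum e0)).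
Unshelve. all: by end_near. Qed.

(** For a set of finite measure, a measurable hull exceeds it by a null set, which
    has itself a measurable null hull; the general case is obtained by pieces. *)
Lemma caratheodory_approx (E : set T) : (mu^*)%mu.-cara.-measurable E ->
  exists A N : set T, [/\ measurable A, measurable N, mu N = 0%E &
    forall x, ~ N x -> (E x <-> A x)].
Proof.
have fin (F : set T) : (mu^*)%mu.-cara.-measurable F -> ((mu^*)%mu F < +oo)%E ->
    exists A N : set T, [/\ measurable A, measurable N, mu N = 0%E &
      forall x, ~ N x -> (F x <-> A x)].
  move=> mF Foo; have [A mA [FA muA]] := measurable_hull F.
  have [N mN [AN muN]] := measurable_hull (A `\` F).
  exists A, N; split => //; last first.
    move=> x Nx; split; first exact: FA.
    by move=> Ax; apply: contrapT => Fx; apply: Nx; apply: AN; split.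
  have cA : (mu^*)%mu.-cara.-measurable A by exact: caratheodory_of_measurable.
  have cAE : cmu A = (mu^*)%mu F by exact: etrans (completionE mA) muA.
  have AFE : cmu (A `\` F) = (cmu A - cmu (A `&` F))%E.
    apply: measureD => //; apply: le_lt_trans Foo.
    by rewrite le_eqVlt; apply/orP; left; apply/eqP; exact: cAE.
  rewrite muN; apply: etrans AFE _; rewrite setIidr//.
  transitivity ((mu^*)%mu F - (mu^*)%mu F)%E; first by congr (_ - _)%E.
  by apply: subee; rewrite ge0_fin_numE// outer_measure_ge0.
move=> mE; have [S ST Sfin] := mu_sfinite.
have /choice[AN ANP] : forall n, exists AN : set T * set T,
    [/\ measurable AN.1, measurable AN.2, mu AN.2 = 0%E &
    forall x, ~ AN.2 x -> ((E `&` S n) x <-> AN.1 x)].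
  move=> n; have [mS Soo] := Sfin n.
  have [||A [N [h1 h2 h3 h4]]] := fin (E `&` S n).
  - by apply: measurableI => //; exact: caratheodory_of_measurable.
  - apply: le_lt_trans Soo; rewrite -completionE//; apply: le_outer_measure.
    exact: subIsetr.
  by exists (A, N).
exists (\bigcup_n (AN n).1), (\bigcup_n (AN n).2).
have mN : measurable (\bigcup_n (AN n).2) by apply: bigcup_measurable => n _; case: (ANP n).
split => //.
- by apply: bigcup_measurable => n _; case: (ANP n).
- have h n : mu.-negligible (AN n).2 by have [_ mNn Nn0 _] := ANP n; exact/negligibleP.
  by apply: (measure_negligible mN); exact: negligible_bigcup.
- move=> x Nx; split => [Ex|[n _ An]].
    have : (\bigcup_n S n) x by rewrite -ST.
    case=> n _ Snx; exists n => //; have [_ _ _ h] := ANP n.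
    by apply/h => [Nnx|]; [apply: Nx; exists n|split].
  have [_ _ _ h] := ANP n.
  by have /h[] : (AN n).1 x := An => [Nnx|]; [apply: Nx; exists n|].
Qed.

(** Modifying a measurable function for the completion on a null set makes it
    measurable: it suffices to treat its rational sublevel sets. *)
Lemma caratheodory_fun (f : T -> R) : measurable_fun (setT : set cT) f ->
  exists N : set T, [/\ measurable N, mu N = 0%E &
    measurable_fun setT (fun x => f x * \1_(~` N) x)].
Proof.
move=> mf; pose r (n : nat) : R := ratr (odflt 0 (@unpickle rat n)).
have /choice[AN ANP] : forall n, exists AN : set T * set T,
    [/\ measurable AN.1, measurable AN.2, mu AN.2 = 0%E &
    forall x, ~ AN.2 x -> (f x < r n <-> AN.1 x)].
  move=> n; have [|A [N [h1 h2 h3 h4]]] := @caratheodory_approx [set x | f x < r n].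
    have := mf measurableT `]-oo, r n[%classic (measurable_itv _).
    by rewrite setTI; congr (measurable _); apply/seteqP; split => x; rewrite /= in_itv.
  by exists (A, N).
have mN : measurable (\bigcup_n (AN n).2) by apply: bigcup_measurable => n _; case: (ANP n).
exists (\bigcup_n (AN n).2); set N := \bigcup_n _ in mN *; split => //.
  have h n : mu.-negligible (AN n).2 by have [_ mNn Nn0 _] := ANP n; exact/negligibleP.
  by apply: (measure_negligible mN); exact: negligible_bigcup.
apply: (measurability (@RGenInftyO.G R)); first exact: RGenInftyO.measurableE.
move=> _ [_ [s ->] <-]; rewrite setTI.
have -> : (fun x => f x * \1_(~` N) x) @^-1` `]-oo, s[%classic =
   (~` N `&` \bigcup_(n in [set n | r n < s]) (AN n).1) `|` (N `&` [set x | 0 < s]).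
  apply/seteqP; split => x /=; rewrite in_itv/= indicE.
    have [Nx|Nx] := pselect (N x).
      by rewrite memNset ?mulr0 => [?|/(_ Nx)//]; right.
    rewrite mem_set// mulr1 => fs; left; split => //.
    have [q] := rat_in_itvoo fs; rewrite in_itv/= => /andP[q1 q2].
    have rq : r (pickle q) = ratr q by rewrite /r pickleK.
    exists (pickle q); first by rewrite /= rq.
    have [_ _ _ h] := ANP (pickle q); apply/h; last by rewrite rq.
    by move=> Nq; apply: Nx; exists (pickle q).
  move=> [[Nx [n ns An]]|[Nx s0]]; last by rewrite memNset ?mulr0// => /(_ Nx).
  rewrite mem_set// mulr1; apply: lt_trans ns; have [_ _ _ h] := ANP n.
  by apply/h => // Nn; apply: Nx; exists n.
apply: measurableU; last first.
  have [s0|s0] := pselect (0 < s).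
    by rewrite (_ : [set x | 0 < s] = setT) ?setIT//; apply/seteqP; split.
  by rewrite (_ : [set x | 0 < s] = set0) ?setI0//; apply/seteqP; split.
apply: measurableI; first exact: measurableC.
by apply: bigcup_measurable => n _; case: (ANP n).
Qed.

Lemma ge0_integral_completion (G : T -> \bar R) : measurable_fun setT G ->
  (forall x, 0 <= G x)%E -> (\int[cmu]_x G x = \int[mu]_x G x)%E.
Proof.
move=> mG G0.
have mid : measurable_fun (setT : set cT) (fun x : T => x).
  by move=> _ A mA; rewrite setTI; exact: caratheodory_of_measurable.
transitivity (\int[pushforward cmu (fun x : T => x)]_x G x)%E.
  by rewrite (ge0_integral_pushforward mid)// => y _; exact: G0.
by apply: eq_measure_integral => A mA _; exact: completionE.
Qed.

(** The completion measures all subsets of the null set N, so that changing values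
    there affects neither measurability nor integrals. *)
Lemma integral_completion (f g : T -> \bar R) (N : set T) : measurable_fun setT g ->
  measurable N -> mu N = 0%E -> (forall x, ~ N x -> f x = g x) ->
  measurable_fun (setT : set cT) f /\ (\int[cmu]_x f x = \int[mu]_x g x)%E.
Proof.
move=> mg mN N0 fg.
have cmg : measurable_fun (setT : set cT) g.
  move=> _ A mA; apply: caratheodory_of_measurable; exact: (mg measurableT A mA).
have Nnull (A : set T) : A `<=` N -> (mu^*)%mu.-cara.-measurable A.
  move=> AN; apply: (measure_is_complete_caratheodory (mu := (mu^*)%mu)).
  exists N; split => //; first exact: caratheodory_of_measurable.
  exact: etrans (completionE mN) N0.
have cmf : measurable_fun (setT : set cT) f.
  move=> _ A mA; rewrite setTI.
  have -> : f @^-1` A = ((g @^-1` A) `\` N) `|` (f @^-1` A `&` N).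
    apply/seteqP; split => [x Ax|x [[gA Nx]|[]//]].
      have [Nx|Nx] := pselect (N x); first by right.
      by left; split => //; rewrite /= -fg.
    by rewrite /= fg.
  apply: measurableU; last by apply: Nnull; exact: subIsetr.
  apply: measurableD; last exact: caratheodory_of_measurable.
  by rewrite -[X in _.-measurable X]setTI; exact: cmg.
split => //; transitivity (\int[cmu]_x g x)%E.
  apply: ae_eq_integral => //; exists N; split.
  - exact: caratheodory_of_measurable.
  - exact: etrans (completionE mN) N0.
  - by move=> x /= h; apply: contrapT => Nx; apply: h => _; exact: fg.
rewrite [LHS]integralE [RHS]integralE; congr (_ - _)%E.
  apply: ge0_integral_completion => //; exact: measurable_funepos.
by apply: ge0_integral_completion => //; exact: measurable_funeneg.
Qed.

End completion.


(** * Attainment of the supremum *)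

Section representatives.
Context {R : realType} {d : nat}.
Local Notation lam := (lebesgue_rV R d).
Local Notation Lam := (@lebesgue_phase R d).
Local Notation V := 'rV[R]_d.
Local Notation H := (L2T lam).
Local Notation cV := (caratheodory_type (lebesgue_rV R d)^*%mu).
Implicit Types (f : V -> R[i]) (F : H) (N : set V).

Let lam_sfinite : sigma_finite setT lam := sigma_finiteT _.

Lemma Rintegral_completion (f g : V -> R) N : measurable_fun setT g -> measurable N ->
  lam N = 0%E -> (forall x, ~ N x -> f x = g x) ->
  \int[@completed_lebesgue_rV R d]_x f x = \int[lam]_x g x.
Proof.
move=> mg mN N0 fg; rewrite /Rintegral; congr fine.
have mg' : measurable_fun setT (fun x => (g x)%:E) by exact/measurable_EFinP.
have [|_] := @integral_completion _ _ R lam (fun x => (f x)%:E) _ N mg' mN N0.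
  by move=> x Nx; rewrite fg.
by [].
Qed.

Lemma cintegral_completion f (g : V -> R[i]) N : cmeas g -> measurable N ->
  lam N = 0%E -> (forall x, ~ N x -> f x = g x) -> cintegral f = cint lam g.
Proof.
move=> [g1 g2] mN N0 fg; apply: eqcP => /=.
  by apply: Rintegral_completion g1 mN N0 _ => x /fg ->.
by apply: Rintegral_completion g2 mN N0 _ => x /fg ->.
Qed.

Lemma null_affine (a : R) (b : V) N : a != 0 -> measurable N -> lam N = 0%E ->
  measurable ((fun y : V => a *: y + b) @^-1` N) /\
  lam ((fun y : V => a *: y + b) @^-1` N) = 0%E.
Proof.
move=> a0 mN N0; split; last by apply: etrans (lebesgue_affine b a0 mN) _; rewrite N0 mule0.
by rewrite -[X in measurable X]setTI; exact: measurable_affine.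
Qed.

(** Reflections are self-adjoint, so the form is real. *)
Lemma cint_refl F z : cint lam (fun t => F t * conjc (refl z F t)) = (wform F z)%:C%C.
Proof.
apply: eqcP.
  by rewrite /= [RHS]ip_refl; apply: eq_Rintegral => t _; rewrite reJE.
rewrite -ip_iZr /=.
have : ip F ((0 +i* 1)%C *: refl z F) = - ip F ((0 +i* 1)%C *: refl z F).
  rewrite -[in LHS]reflZ -[LHS]ip_refl [LHS]ipC [LHS]ipZJ.
  rewrite (_ : conjc (0 +i* 1)%C = - (0 +i* 1)%C); last by apply: eqcP => /=; ring.
  by rewrite scaleNr ipNr.
lra.
Qed.

(** The substitution y = 2 (t - x) identifies the Wigner distribution with the
    quadratic form of the point reflections, up to the factor 2^d. *)
Lemma wigner_wform f F N z : measurable N -> lam N = 0%E ->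
  (forall t, ~ N t -> f t = F t) -> wigner f z = (2 ^+ d * wform F z)%:C%C.
Proof.
case: z => x xi mN N0 fF; have h0 : 2^-1 != 0 :> R by rewrite invr_eq0.
have hN : - 2^-1 != 0 :> R by rewrite oppr_eq0.
pose G t := F t * conjc (refl (x, xi) F t).
pose W y := expi (- (2 * pi * dotv xi y)) * F (x + 2^-1 *: y) * conjc (F (x - 2^-1 *: y)).
have GW : (fun y => G (2^-1 *: y + x)) = W.
  apply/funext => y; rewrite /G /W reflE conjcM conj_expi /=.
  have -> : 2 *: x - (2^-1 *: y + x) = x - 2^-1 *: y.
    by rewrite scaler_nat mulr2n opprD addrACA subrr addr0.
  have -> : dotv (2 *: xi) (2^-1 *: y + x - x) = dotv xi y.
    by rewrite addrK !dotvE mulrA mulfV ?mul1r.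
  by rewrite [2^-1 *: y + x]addrC; ring.
have Gi : cintegrable lam G by exact: cintegrable_l2.
have [Wi WE] := cint_affine x h0 Gi; rewrite GW in Wi WE.
have [m1 n1] := null_affine x h0 mN N0; have [m2 n2] := null_affine x hN mN N0.
set N1 := _ @^-1` N in m1 n1; set N2 := _ @^-1` N in m2 n2.
rewrite /wigner (@cintegral_completion _ W (N1 `|` N2)).
- rewrite WE cint_refl -rmorphM gtr0_norm ?invr_gt0//.
  by rewrite exprVn invrK.
- exact: cintegrable_cmeas Wi.
- exact: measurableU.
- apply/eqP; rewrite eq_le measure_ge0 andbT; apply: le_trans (measureU2 _ m1 m2) _.
  by rewrite [X in (X + _)%E](n1 : lam N1 = 0%E) [X in (_ + X)%E](n2 : lam N2 = 0%E) adde0.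
- move=> y /not_orP[y1 y2]; rewrite /W !fF//.
  + by move=> Ny; apply: y2; rewrite /N2 /= scaleNr addrC.
  + by move=> Ny; apply: y1; rewrite /N1 /= addrC.
Qed.

Lemma L2norm_nsq f F N : measurable N -> lam N = 0%E ->
  (forall t, ~ N t -> f t = F t) -> L2norm f = (nrm F)%:E.
Proof.
move=> mN N0 fF; rewrite /L2norm unlock.
have -> : (\int[@completed_lebesgue_rV R d]_x (`| (normc (f x))%:E | `^ 2) = (nsq F)%:E)%E.
  have mg : measurable_fun setT (fun x => (sqn (F x))%:E) by apply: measurable_sqnE; exact: l2_cmeas.
  have [|_ E] := @integral_completion _ _ R lam
      (fun x => (`|(normc (f x))%:E| `^ 2)%E) _ N mg mN N0.
    move=> x Nx; rewrite fF// abse_EFin ger0_norm ?normc_ge0// poweR_EFin.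
    by rewrite -[2]/(2%:R) powR_mulrn ?normc_ge0// sqnE.
  by rewrite EFin_nsq -E.
by rewrite poweR_EFin powR12_sqrt ?nsq_ge0.
Qed.

Lemma square_integrable_representative f : L2 f -> exists F, exists2 N, measurable N /\ lam N = 0%E &
  forall t, ~ N t -> f t = F t.
Proof.
move=> [m1 m2 foo].
have [N1 [mN1 N10 h1]] := caratheodory_fun lam_sfinite m1.
have [N2 [mN2 N20 h2]] := caratheodory_fun lam_sfinite m2.
pose N := N1 `|` N2; have mN : measurable N by exact: measurableU.
have N0 : lam N = 0%E.
  apply/eqP; rewrite eq_le measure_ge0 andbT; apply: le_trans (measureU2 _ mN1 mN2) _.
  by rewrite [X in (X + _)%E]N10 [X in (_ + X)%E]N20 adde0.
pose g t := f t * (\1_(~` N) t)%:C%C.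
have gE t : ~ N t -> f t = g t by move=> Nt; rewrite /g indicE mem_set// mulr1.
have mNc : measurable_fun setT (\1_(~` N) : V -> R).
  by apply: measurable_indic; exact: measurableC.
have indE t : \1_(~` N) t = \1_(~` N1) t * \1_(~` N) t :> R.
  rewrite !indicE; have [Nt|Nt] := pselect (N t).
    by rewrite [t \in ~` N]memNset ?mulr0// => /(_ Nt).
  by rewrite [t \in ~` N]mem_set// mem_set ?mulr1// => N1t; apply: Nt; left.
have indE2 t : \1_(~` N) t = \1_(~` N2) t * \1_(~` N) t :> R.
  rewrite !indicE; have [Nt|Nt] := pselect (N t).
    by rewrite [t \in ~` N]memNset ?mulr0// => /(_ Nt).
  by rewrite [t \in ~` N]mem_set// mem_set ?mulr1// => N2t; apply: Nt; right.
have mg : cmeas g.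
  split.
    have := measurable_funM h1 mNc; apply: eq_measurable_fun => t _.
    by rewrite /g cReM /= mulr0 subr0 -mulrA -indE.
  have := measurable_funM h2 mNc; apply: eq_measurable_fun => t _.
  by rewrite /g cImM /= mulr0 add0r -mulrA -indE2.
have gL : g \in sqintegrable lam.
  apply/sqintegrableP; split => //.
  have mg2 : measurable_fun setT (fun x => (sqn (g x))%:E) by exact: measurable_sqnE.
  have [|_ E] := @integral_completion _ _ R lam
      (fun x => (`|(normc (f x))%:E| `^ 2)%E) _ N mg2 mN N0.
    move=> x Nx; rewrite gE// abse_EFin ger0_norm ?normc_ge0// poweR_EFin.
    by rewrite -[2]/(2%:R) powR_mulrn ?normc_ge0// sqnE.
  rewrite -E; move: foo; rewrite /L2norm unlock; apply: lty_poweRy.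
  by rewrite invr_eq0.
by exists (MkL2 gL), N.
Qed.

(** Null sets of the completion have measurable null hulls. *)
Lemma ae_zero_nsq f F N : measurable N -> lam N = 0%E ->
  (forall t, ~ N t -> f t = F t) -> ae_zero f <-> nsq F = 0.
Proof.
move=> mN N0 fF; have mF := l2_cmeas F.
have msF := measurable_sqnE mF.
have pos : nsq F = 0 <-> {ae lam, forall t, F t = 0}.
  split=> [F0|F0].
    have : (\int[lam]_t `|(sqn (F t))%:E| = 0)%E.
      under eq_integral do rewrite gee0_abs ?lee_fin ?sqn_ge0//.
      by rewrite -EFin_nsq F0.
    move/(ae_eq_integral_abs lam measurableT msF); apply: filterS => t /(_ I).
    by move=> h; apply: sqn_eq0; apply: EFin_inj; exact: h.
  apply: EFin_inj; rewrite EFin_nsq; apply: etrans _ (integral0 lam setT).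
  apply: ae_eq_integral => //; apply: filterS F0 => t -> _; by rewrite sqn0.
rewrite pos; split.
  move=> [B [mB B0 hB]].
  have [G mG [BG G0]] := measurable_hull lam B.
  exists (G `|` N); split.
  - exact: measurableU.
  - apply/eqP; rewrite eq_le measure_ge0 andbT; apply: le_trans (measureU2 _ mG mN) _.
    rewrite [X in (_ + X)%E]N0 adde0 [X in (X <= _)%E]G0.
    by rewrite le_eqVlt; apply/orP; left; apply/eqP; exact: B0.
  - move=> t /= Ft; have [Nt|Nt] := pselect (N t); [by right|left].
    by apply/BG/hB => /= ft; apply: Ft; rewrite -fF.
move=> [B [mB B0 hB]]; exists (B `|` N); split.
- by apply: caratheodory_of_measurable; exact: measurableU.
- apply: etrans (completionE lam (measurableU _ _ mB mN)) _.
  apply/eqP; rewrite eq_le measure_ge0 andbT; apply: le_trans (measureU2 _ mB mN) _.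
  by rewrite [X in (_ + X)%E]N0 adde0 [X in (X <= _)%E]B0.
- move=> t /= ft; have [Nt|Nt] := pselect (N t); [by right|left].
  by apply: hB => /= Ft; apply: ft; rewrite fF.
Qed.

Section quotient.
Variables (Omega Om M : set (V * V)) (p : R).
Hypothesis mOm : measurable Om.
Hypothesis mM : measurable M.
Hypothesis M0 : Lam M = 0%E.
Hypothesis OmE : forall z, ~ M z -> (Omega z <-> Om z).
Hypothesis Omoo : (Lam Om < +oo)%E.
Hypothesis p1 : 1 <= p.

(** The power 2^d of the reflection formula comes out of the norm, and nothing
    depends on the values on null sets; the quotient is thus the one maximized
    over the Hilbert space. *)
Lemma wigner_quotientE f F N : measurable N -> lam N = 0%E ->
  (forall t, ~ N t -> f t = F t) -> 0 < nsq F ->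
  wigner_quotient Omega p f = (2 ^+ d * (normOm Om p (wform F) / nsq F))%:E.
Proof.
move=> mN N0 fF F0; have p0 : 0 < p by exact: lt_le_trans p1.
have p00 : p != 0 by rewrite gt_eqF.
pose u z := 2 ^+ d * wform F z.
have gw := bounded_measurable_wform F.
have gu : bounded_measurable u by exact: bounded_measurableZ.
have E1 : (\int[@completed_lebesgue_phase R d]_(z in Omega) ((normc (wigner f z)) `^ p)%:E =
    \int[Lam]_z (`|cutoff Om u z| `^ p)%:E)%E.
  rewrite integral_mkcond.
  have mg : measurable_fun setT (fun z => (`|cutoff Om u z| `^ p)%:E).
    by apply: measurable_powR_norm; apply: measurable_cutoff => //; case: gu.
  have [|_] := @integral_completion _ _ R Lam
     (((fun z => ((normc (wigner f z)) `^ p)%:E) \_ Omega)%E) _ M mg mM M0; last by [].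
  move=> z Mz; rewrite patchE /cutoff indicE.
  have [Oz|Oz] := pselect (Omega z).
    rewrite mem_set// mem_set ?mul1r; last exact/(OmE Mz).
    by rewrite (wigner_wform z mN N0 fF) normc_real.
  rewrite memNset// memNset ?mul0r ?normr0 ?powR0//.
  by move=> Oz'; apply: Oz; apply/(OmE Mz).
rewrite /wigner_quotient E1 (L2norm_nsq mN N0 fF).
rewrite -[X in (X / _)%E]LpnE -(normOmE mOm Omoo p1 gu) /u normOmZ//.
rewrite ger0_norm ?exprn_ge0// -EFin_expe sqr_nrm.
by rewrite inver gt_eqF// -EFinM mulrA.
Qed.

End quotient.

End representatives.

Theorem theorem1p1 (R : realType) (d : nat)
    (Omega : set ('rV[R]_d * 'rV[R]_d)) (p : R)
    (mOmega : (@lebesgue_phase R d)^*%mu.-cara.-measurable Omega)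
    (Omega_gt0 : (0 < completed_lebesgue_phase Omega)%E)
    (Omega_fin : (completed_lebesgue_phase Omega < +oo)%E)
    (p_ge1 : 1 <= p) :
  exists2 f : 'rV[R]_d -> R[i], (L2 `\` ae_zero) f &
    wigner_quotient Omega p f =
    ereal_sup [set wigner_quotient Omega p g | g in L2 `\` ae_zero].
Proof.
have sf : sigma_finite setT (@lebesgue_phase R d) := sigma_finiteT _.
have [Om [M [mOm mM M0 OmE]]] := caratheodory_approx sf mOmega.
have Omoo : (@lebesgue_phase R d Om < +oo)%E.
  have h : Om `<=` Omega `|` M.
    move=> z Oz; have [Mz|Mz] := pselect (M z); [by right|left].
    exact/(OmE z Mz).
  have Mo : completed_lebesgue_phase M = 0%E by exact: etrans (completionE _ mM) M0.
  have : (completed_lebesgue_phase Om <= completed_lebesgue_phase Omega + completed_lebesgue_phase M)%E.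
    apply: le_trans (le_outer_measure _ _ _ h) _.
    exact: outer_measureU2.
  rewrite Mo adde0 => /le_lt_trans /(_ Omega_fin); apply: le_lt_trans.
  by rewrite le_eqVlt; apply/orP; left; apply/eqP; apply: esym; exact: completionE.
have [F F0 hF] := maximizer mOm Omoo p_ge1.
have null0 : lebesgue_rV R d set0 = 0%E by exact: measure0.
have FE : forall t : 'rV[R]_d, ~ set0 t -> (F : 'rV[R]_d -> R[i]) t = F t by [].
have qE := wigner_quotientE mOm mM M0 OmE Omoo p_ge1.
have FL : (L2 `\` ae_zero) (F : 'rV[R]_d -> R[i]).
  split; last by move=> /(ae_zero_nsq measurable0 null0 FE) F00; rewrite F00 ltxx in F0.
  have mid (u : 'rV[R]_d -> R) : measurable_fun setT u ->
      measurable_fun (setT : set (caratheodory_type (lebesgue_rV R d)^*%mu)) u.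
    by move=> mu _ A mA; apply: caratheodory_of_measurable; exact: (mu measurableT A mA).
  split; [by apply: mid; case: (l2_cmeas F)|by apply: mid; case: (l2_cmeas F)|].
  by rewrite (L2norm_nsq measurable0 null0 FE) ltry.
exists (F : 'rV[R]_d -> R[i]); first exact: FL.
apply/esym/eqP; rewrite eq_le; apply/andP; split; last first.
  exact: ereal_sup_ubound (imageP (wigner_quotient Omega p) FL).
apply: ge_ereal_sup => _ [g [gL g0] <-].
have [G [N [mN N0] gG]] := square_integrable_representative gL.
have G0 : 0 < nsq G.
  rewrite lt_neqAle nsq_ge0 andbT eq_sym; apply/negP => /eqP G0.
  by apply: g0; apply/(ae_zero_nsq mN N0 gG).
rewrite (qE _ _ _ mN N0 gG G0) (qE _ _ _ measurable0 null0 FE F0) lee_fin.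
rewrite ler_pM2l ?exprn_gt0// ler_pdivrMr//.
apply: le_trans (best_quotient_ge mOm Omoo p_ge1 G) _.
by rewrite ler_wpM2r ?nsq_ge0// ler_pdivlMr.
Qed.
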